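(* Let $f:\mathbb{R}^n\to\mathbb{R}$ be continuously differentiable and bounded from below, $\lambda>0$, $q\in[0,1)$, and $F(x)=f(x)+\lambda\|x\|_q^q$. Let $x^*\in\mathbb{R}^n$, $S^*:=\mathrm{supp}(x^* )$, and suppose $f$ is $LC^1$ at $x^*$. Then: 1) If $x^*$ is a local minimizer of $F$ over $\mathbb{R}^n$, then there exists $M^*\in\partial^2_{S^*}E(x^* )$ such that $\langle M^*v,v\rangle\ge 0$ for all $v\in\mathbb{R}^{|S^*|}$. 2) If $x^*$ is a P-stationary point (with some constant $\alpha>0$) and $$\langle M^*v,v\rangle>0\quad\text{for all } M^*\in\partial^2_{S^*}E(x^* )\text{ and all } v\in\mathbb{R}^{|S^*|},\ v\neq0,$$ then $x^*$ is a unique local minimizer of $F$, namely there are $\eta_*>0$ and a neighbourhood $\mathbb{N}^*$ of $x^*$ such that $$F(x)\ge F(x^* )+\eta_*\|x-x^*\|^2\quad\text{for all }x\in\mathbb{N}^*.$$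
   Context: $\|x\|_q^q:=\sum_i|x_i|^q$, with the convention $|t|^0=1$ for $t\ne0$ and $|0|^0=0$. $\mathrm{supp}(x)$ is the set of indices of nonzero entries of $x$; $x_T$ is the sub-vector indexed by $T$, and $H_T$ is the principal sub-matrix of $H$ with rows and columns indexed by $T$. $f$ is $LC^1$ at $x$ if it is continuously differentiable and $\nabla f$ is Lipschitz continuous on some neighbourhood of $x$. Generalized Hessian: for a function $g$ that is continuously differentiable with Lipschitz gradient near $x$, $\partial^2 g(x)$ is the convex hull of the set of all matrices $H$ for which there is a sequence $x^i\to x$ with $g$ twice differentiable at each $x^i$ and $\nabla^2 g(x^i)\to H$. $E(x;T):=f(x)+\lambda\|x_T\|_q^q$. For $S=\mathrm{supp}(x)$, $\partial^2_{S}E(x):=\{M_{S}:M\in\partial^2E(\cdot;S)(x)\}$, where the generalized Hessian is that of the function $E(\cdot;S)$ at $x$. P-stationary point: $x^*$ is a P-stationary point with constant $\alpha>0$ if $x^*\in \mathrm{Prox}_{\alpha\lambda\|\cdot\|_q^q}(x^*-\alpha\nabla f(x^* ))$, where $\mathrm{Prox}_{r}(z):=\operatorname{argmin}_{w\in\mathbb{R}^n}\frac12\|z-w\|^2+r(w)$ (the set of global minimizers). Standing assumption: $\nabla f(0)\ne0$ and, when a P-stationary point with constant $\alpha$ is considered in part 2), $\lambda<\frac{\alpha^{1-q}}{2}\|\nabla f(0)\|_\infty^{2-q}$ (so that $0$ is not P-stationary with constant $\alpha$). *)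

(* Defs.v *)
From HB Require Import structures.
From mathcomp Require Import all_boot all_order all_algebra.
From mathcomp Require Import all_classical all_reals all_analysis.

Set Implicit Arguments.
Unset Strict Implicit.
Unset Printing Implicit Defensive.

Import Order.TTheory GRing.Theory Num.Theory.
Import numFieldNormedType.Exports.

Local Open Scope classical_set_scope.
Local Open Scope ring_scope.

(* Vectors of R^n are row vectors 'rV[R]_n.  The library norm `|x| on 'rV[R]_n
   is the max norm (it also induces the usual topology); the Euclidean norm is
   enorm below. *)

Section Euclidean.
Context {R : realType} {n : nat}.
Implicit Types (x y : 'rV[R]_n) (M : 'M[R]_n).

Definition dotv x y : R := \sum_(i < n) x 0 i * y 0 i.

Definition enorm x : R := Num.sqrt (dotv x x).

(* <M v, v>: for a row vector v, v *m M^T is the transpose of M v^T *)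
Definition quad M x : R := dotv (x *m M^T) x.

Definition supp x : {set 'I_n} := [set i | x 0 i != 0]%SET.

Definition subvec (T : {set 'I_n}) x : 'rV[R]_#|T| :=
  colsub (fun i : 'I_#|T| => enum_val i) x.

Definition submat (T : {set 'I_n}) M : 'M[R]_#|T| :=
  mxsub (fun i : 'I_#|T| => enum_val i) (fun i : 'I_#|T| => enum_val i) M.

End Euclidean.

(* |t|^q with |0|^0 = 0, whereas 0 `^ 0 = 1 in the library *)
Definition absq {R : realType} (q t : R) : R :=
  if t == 0 then 0 else `|t| `^ q.

Definition lqq {R : realType} {n : nat} (q : R) (x : 'rV[R]_n) : R :=
  \sum_(i < n) absq q (x 0 i).

Section Calculus.
Context {R : realType} {n : nat}.
Implicit Types (g : 'rV[R]_n -> R) (x : 'rV[R]_n).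

Definition grad g x : 'rV[R]_n := \row_(i < n) ('D_(delta_mx 0 i) g x : R).

Definition hessian g x : 'M[R]_n := 'J (grad g) x.

Definition twice_differentiable g x : Prop :=
  (\forall y \near x, differentiable g y) /\ differentiable (grad g) x.

Definition continuously_differentiable g : Prop :=
  (forall x, differentiable g x) /\ continuous (grad g).

Definition LC1 g x : Prop :=
  exists U : set 'rV[R]_n,
    [/\ open_nbhs x U,
        forall y, U y -> differentiable g y,
        forall y, U y -> {for y, continuous (grad g)} &
        [lipschitz grad g y | y in U]].

Definition convex_hull {V : lmodType R} (A : set V) : set V :=
  smallest (@convex_set R V) A.

Definition generalized_hessian g x : set 'M[R]_n :=
  convex_hull [set H : 'M[R]_n | exists u : nat -> 'rV[R]_n,
    [/\ u @ \oo --> x,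
        forall k, twice_differentiable g (u k) &
        (fun k => hessian g (u k)) @ \oo --> H]].

Definition argmin (phi : 'rV[R]_n -> R) : set 'rV[R]_n :=
  [set w | forall u, phi w <= phi u].

Definition prox (r : 'rV[R]_n -> R) (z : 'rV[R]_n) : set 'rV[R]_n :=
  argmin (fun w => 2^-1 * enorm (z - w) ^+ 2 + r w).

Definition local_minimizer g x : Prop := \forall y \near x, g x <= g y.

End Calculus.

Section Lq_problem.
Context {R : realType} {n : nat}.
Variables (f : 'rV[R]_n -> R) (lambda q : R).
Implicit Types (x : 'rV[R]_n) (T : {set 'I_n}).

Definition objF x : R := f x + lambda * lqq q x.

Definition objE T x : R := f x + lambda * lqq q (subvec T x).

Definition generalized_hessian_supp x : set 'M[R]_#|supp x| :=
  submat (supp x) @` generalized_hessian (objE (supp x)) x.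

Definition P_stationary (alpha : R) x : Prop :=
  prox (fun w => alpha * lambda * lqq q w) (x - alpha *: grad f x) x.

End Lq_problem.

Arguments generalized_hessian_supp {R n} f lambda q x _.

(* Main.v *)
(* The function E := E(.; supp xs) is C^{1,1} near xs, because the coordinates
   kept in the power term stay away from 0 there, and F = E on the coordinate
   subspace R^S of the support S.  Both parts need Hessians of E at points close
   to xs carrying a prescribed second-order information; such points are found
   as follows.  A set is called null when it is covered by cubes of arbitrarily
   small total volume: null sets are stable under countable unions and Lipschitz
   maps, balls are not null, and Lipschitz maps are differentiable off a null
   set (Rademacher), so any set of "contact points" that a Lipschitz map sends
   onto a ball contains a point of twice differentiability.

   Rademacher's theorem is obtained without integration.  Along a coordinate
   direction, the mean square of the dyadic difference quotients, averaged over
   a fine grid of parallel lines, increases with the dyadic level and is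
   bounded, hence is eventually almost constant; a greedy maximal inequality
   then bounds the volume of the cubes on which the quotients still oscillate.
   Linearity of the directional derivatives follows from the differentiability
   of distance functions (Preiss-Zajicek), and Frechet differentiability from
   the Lipschitz bound.

   Part 1: contact points of E from below with tilted paraboloids on the slices
   parallel to R^S (Jensen's lemma) give Hessians that are almost positive
   semidefinite on R^S; pass to a limit.
   Part 2: by compactness the Hessians are uniformly positive definite on R^S
   near xs.  If the gradient failed to be strongly monotone along a segment,
   the last points of parallel segments at which a tilted slope attains a level
   would be contact points contradicting this.  Stationarity kills the gradient
   on R^S, so E grows quadratically along R^S, and off S the power term
   dominates every linear function since q < 1. *)

From HB Require Import structures.
Require Import Defs.
From mathcomp Require Import all_boot all_order all_algebra.
From mathcomp Require Import all_classical all_reals all_analysis.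
From mathcomp Require Import ring lra zify.

Set Implicit Arguments.
Unset Strict Implicit.
Unset Printing Implicit Defensive.

Import Order.TTheory GRing.Theory Num.Theory.
Import numFieldNormedType.Exports.

Local Open Scope classical_set_scope.
Local Open Scope ring_scope.

(** * Discrete maximal inequality *)

Section DiscreteMaximal.
Context {R : realType}.
Implicit Types (a d : nat -> R).

(** The subspace [R^S] is itself null unless [S] is full, so a contact argument confined to it could
    miss every point of twice differentiability. Each contact family is therefore parametrized by a
    full-dimensional vector with two roles. In part 1 its coordinates in [S] tilt the function and
    the others translate the slice; in part 2 all coordinates but one select a segment and the
    remaining one prescribes the level. The parameter is recovered from the contact point and the
    gradient there, so this map is Lipschitz.

    The energies are squared L2 norms of the dyadic conditional expectations of a derivative. The
    gap between two levels is thus a variance, and a weak-type maximal inequality turns a small gap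
    into few bad points. The stable level must be fixed before the fineness of the witnesses of
    badness is known, hence stability against all finer levels, on arbitrarily fine grids. Bad cubes
    are defined by dyadic data valid on the whole cube, so that counting grid points measures their
    volume. *)

Lemma sum_sqr_sub_mean d m p : (m < p)%N ->
  \sum_(m <= i < p) (d i - (\sum_(m <= i < p) d i) / (p - m)%:R) ^+ 2 =
  \sum_(m <= i < p) d i ^+ 2 - (\sum_(m <= i < p) d i) ^+ 2 / (p - m)%:R.
Proof.
move=> mp; set s := \sum_(m <= i < p) d i; set q := (p - m)%:R : R.
have q0 : q != 0 by rewrite pnatr_eq0 subn_eq0 -ltnNge.
have -> : \sum_(m <= i < p) (d i - s / q) ^+ 2 =
  \sum_(m <= i < p) (d i ^+ 2 + (- (2 * s / q)) * d i + s ^+ 2 / q ^+ 2).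
  by apply: eq_bigr => i _; field.
rewrite !big_split /= -mulr_sumr -/s sumr_const_nat -mulr_natr -/q.
by field.
Qed.

Lemma sqr_sum_le d m p : (m < p)%N ->
  (\sum_(m <= i < p) d i) ^+ 2 <= (p - m)%:R * \sum_(m <= i < p) d i ^+ 2.
Proof.
move=> mp; have q0 : 0 < (p - m)%:R :> R by rewrite ltr0n subn_gt0.
rewrite mulrC -ler_pdivrMr // -subr_ge0 -sum_sqr_sub_mean //.
by apply: sumr_ge0 => i _; exact: sqr_ge0.
Qed.

(* Greedy selection: jump over the block starting at the first bad index. *)
Lemma discrete_maximal a (F : pred nat) (lam : R) (p : nat) : 0 <= lam ->
  (forall i, (i < p)%N -> F i -> exists i', [/\ (i < i')%N, (i' <= p)%N &
     lam * (i' - i)%:R < `|a i' - a i|]) ->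
  lam ^+ 2 * \sum_(0 <= i < p) (F i)%:R <= \sum_(0 <= i < p) (a i.+1 - a i) ^+ 2.
Proof.
move=> lam0 HF.
suff H k m : (m <= p)%N -> (p - m <= k)%N ->
  lam ^+ 2 * \sum_(m <= i < p) (F i)%:R <= \sum_(m <= i < p) (a i.+1 - a i) ^+ 2.
  by apply: (H p 0%N) => //; rewrite subn0.
elim: k m => [|k IH] m mp pmk.
  by rewrite !big_geq ?mulr0 //; lia.
have [pm|{}mp] := leqP p m; first by rewrite !big_geq ?mulr0.
have [Fm|NFm] := boolP (F m); last first.
  rewrite big_ltn // [leRHS]big_ltn // (negbTE NFm) add0r.
  by apply: ler_wpDl; [exact: sqr_ge0|apply: IH; lia].
have [m' [mm' m'p Hm']] := HF _ mp Fm.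
rewrite (@big_cat_nat _ _ _ m') /= ?(ltnW mm') //.
rewrite [leRHS](@big_cat_nat _ _ _ m') /= ?(ltnW mm') //.
rewrite mulrDr; apply: lerD; last by apply: IH; lia.
have q0 : 0 < (m' - m)%:R :> R by rewrite ltr0n subn_gt0.
have le1 : \sum_(m <= i < m') (F i)%:R <= (m' - m)%:R :> R.
  rewrite -[leRHS]mulr1 mulr_natl -sumr_const_nat; apply: ler_sum => i _.
  by case: (F i).
(* Cauchy-Schwarz on the telescoped block: its energy is at least [(a m' - a m) ^+ 2 / (m' - m)],
   hence more than [lam ^+ 2 * (m' - m)], and the block has at most [m' - m] bad indices. *)
apply: (le_trans (ler_wpM2l (sqr_ge0 lam) le1)).
rewrite -(ler_pM2l q0); apply: le_trans (sqr_sum_le _ mm').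
rewrite telescope_sumr ?(ltnW mm') //.
rewrite mulrCA -expr2 -exprMn -[leRHS]real_normK ?num_real //.
by rewrite ler_sqr ?nnegrE // ?mulr_ge0 // ltW.
Qed.

End DiscreteMaximal.

Section Cell.
Context {R : realType}.
Implicit Types (a : nat -> R).

(** Subtracting the mean slope turns the energy into its excess over that of the chord, by the
    variance identity. The factor 2 pays for witnesses on the right and on the left, the latter
    being handled by reversing the indices. *)
Lemma discrete_maximal_cell a (F : pred nat) (lam : R) (p : nat) :
  (0 < p)%N -> 0 <= lam ->
  (forall i, (i < p)%N -> F i -> exists i', [/\ (i' <= p)%N, i' != i &
     lam * `|i'%:R - i%:R| <
       `|a i' - a i - (i'%:R - i%:R) * ((a p - a 0%N) / p%:R)|]) ->
  lam ^+ 2 * \sum_(0 <= i < p) (F i)%:R <=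
  2 * (\sum_(0 <= i < p) (a i.+1 - a i) ^+ 2 - (a p - a 0%N) ^+ 2 / p%:R).
Proof.
move=> p0 lam0 HF; set sg := (a p - a 0%N) / p%:R.
pose b i := a i - i%:R * sg.
have Eb : \sum_(0 <= i < p) (b i.+1 - b i) ^+ 2 =
    \sum_(0 <= i < p) (a i.+1 - a i) ^+ 2 - (a p - a 0%N) ^+ 2 / p%:R.
  have := sum_sqr_sub_mean (fun i => a i.+1 - a i) p0.
  rewrite telescope_sumr // subn0 => <-; apply: eq_bigr => i _.
  by rewrite /b /sg -natr1; congr (_ ^+ 2); ring.
rewrite -Eb mulrDl mul1r.
pose A i := `[< exists i', [/\ (i < i')%N, (i' <= p)%N &
   lam * (i' - i)%:R < `|b i' - b i|] >].
pose B i := `[< exists i', [/\ (i' < i)%N, (i <= p)%N &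
   lam * (i - i')%:R < `|b i' - b i|] >].
have leF : lam ^+ 2 * \sum_(0 <= i < p) (F i)%:R <=
    lam ^+ 2 * \sum_(0 <= i < p) (A i)%:R + lam ^+ 2 * \sum_(0 <= i < p) (B i)%:R.
  rewrite -mulrDr ler_wpM2l ?sqr_ge0 // -big_split /=.
  apply: ler_sum_nat => i /andP[_ ip].
  have [Fi|_] := boolP (F i); last by rewrite addr_ge0.
  have [i' [i'p i'i Hi']] := HF _ ip Fi.
  have E : a i' - a i - (i'%:R - i%:R) * sg = b i' - b i by rewrite /b; ring.
  rewrite -/sg E in Hi'.
  have [lti|gti|eqi] := ltngtP i' i; last by rewrite eqi eqxx in i'i.
  - suff -> : B i by rewrite lerDr.
    apply/asboolP; exists i'; split => //; first exact: ltnW.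
    by rewrite natrB ?(ltnW lti) // -[_ - _]ger0_norm ?subr_ge0 ?ler_nat ?(ltnW lti) // distrC.
  - suff -> : A i by rewrite lerDl.
    apply/asboolP; exists i'; split => //.
    by rewrite natrB ?(ltnW gti) // -[_ - _]ger0_norm ?subr_ge0 ?ler_nat ?(ltnW gti).
apply: (le_trans leF); apply: lerD.
  by apply: discrete_maximal => // i _ /asboolP.
(* Reversal sends [0, ..., p - 1] to [p, ..., 1]; losing index [0] is harmless because nothing lies
   to its left. *)
have B0 : B 0%N = false by apply/asboolP => -[i' []].
have leB : \sum_(0 <= i < p) (B i)%:R <= \sum_(0 <= i < p) (B (p - i)%N)%:R :> R.
  have -> : \sum_(0 <= i < p) (B (p - i)%N)%:R = \sum_(0 <= i < p) (B i.+1)%:R :> R.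
    rewrite [RHS]big_nat_rev /=; apply: eq_big_nat => i /andP[_ ip].
    by congr ((B _)%:R); lia.
  have := @big_nat_recl R 0 +%R p 0%N (fun i => (B i)%:R) (leq0n _).
  by rewrite B0 add0r => <-; rewrite big_nat_recr //= lerDl.
apply: (le_trans (ler_wpM2l (sqr_ge0 lam) leB)).
have -> : \sum_(0 <= i < p) (b i.+1 - b i) ^+ 2 =
    \sum_(0 <= i < p) (b (p - i.+1)%N - b (p - i)%N) ^+ 2.
  rewrite [LHS]big_nat_rev /=; apply: eq_big_nat => i /andP[_ ip].
  by rewrite add0n -sqrrN opprB subnSK.
apply: (discrete_maximal (a := fun i => b (p - i)%N) (F := fun i => B (p - i)%N)) => // i ip.
move=> /asboolP[i' [i'p pi H]]; exists (p - i')%N; split; [lia|lia|].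
have -> : (p - (p - i') = i')%N by lia.
by have -> : (p - i' - i = p - i - i')%N by lia.
Qed.

End Cell.

(** * Energies of dyadic difference quotients on an interval *)

Section Energy.
Context {R : realType}.
Implicit Types (phi : R -> R).

Lemma sum_nat_mul (f : nat -> R) (q p : nat) :
  \sum_(0 <= i < q * p) f i =
  \sum_(0 <= c < q) \sum_(0 <= l < p) f (c * p + l)%N.
Proof.
elim: q => [|q IH]; first by rewrite mul0n !big_geq.
rewrite big_nat_recr //= -IH mulSn addnC.
rewrite (@big_cat_nat _ _ _ (q * p)) //= ?leq_addr //; congr (_ + _).
rewrite -{1}[(q * p)%N]add0n big_addn addKn.
by apply: eq_bigr => i _; rewrite addnC.
Qed.

(** The mean square of the [2 ^ k] difference quotients of level [k]: each quotient is [2 ^+ k]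
    times an increment, and averaging divides once by [2 ^+ k]. *)
Definition dyadic_energy phi (k : nat) : R :=
  2 ^+ k * \sum_(0 <= j < 2 ^ k) (phi (j.+1%:R / 2 ^+ k) - phi (j%:R / 2 ^+ k)) ^+ 2.

Lemma dyadic_energy_ge0 phi k : 0 <= dyadic_energy phi k.
Proof. by rewrite mulr_ge0 ?exprn_ge0 // sumr_ge0 // => j _; exact: sqr_ge0. Qed.

Lemma dyadic_energy_le phi k (L : R) :
  (forall x y, `|phi x - phi y| <= L * `|x - y|) -> dyadic_energy phi k <= L ^+ 2.
Proof.
move=> HL; have p2 : 0 < 2 ^+ k :> R by rewrite exprn_gt0.
have L0 : 0 <= L by have := HL 1 0; rewrite subr0 normr1 mulr1; apply: le_trans.
have H : \sum_(0 <= j < 2 ^ k) (phi (j.+1%:R / 2 ^+ k) - phi (j%:R / 2 ^+ k)) ^+ 2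
   <= \sum_(0 <= j < 2 ^ k) (L / 2 ^+ k) ^+ 2.
  apply: ler_sum => j _; rewrite -real_normK ?num_real //.
  rewrite ler_sqr ?nnegrE // ?divr_ge0 // ?(ltW p2) //.
  apply: (le_trans (HL _ _)); rewrite -mulrBl -natrB // subSnn mul1r.
  by rewrite ger0_norm // invr_ge0 ltW.
apply: (le_trans (ler_wpM2l (ltW p2) H)).
rewrite sumr_const_nat subn0 -[X in _ * X <= _]mulr_natr natrX.
by rewrite le_eqVlt; apply/orP; left; apply/eqP; field; exact: lt0r_neq0.
Qed.

(** Weak-type estimate: the proportion of bad nodes is at most twice the energy gap over [eps ^+ 2].
    The cell inequality is applied in each level [k] cell, with [eps / 2 ^+ M] because distances
    there are counted in grid steps, and then summed. *)
Lemma dyadic_maximal phi (k M : nat) (eps : R) (F : pred nat) :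
  (k <= M)%N -> 0 <= eps ->
  (forall c l, (c < 2 ^ k)%N -> (l < 2 ^ (M - k))%N -> F (c * 2 ^ (M - k) + l)%N ->
    exists l', [/\ (l' <= 2 ^ (M - k))%N, l' != l &
     let x := (c * 2 ^ (M - k) + l)%:R / 2 ^+ M in
     let x' := (c * 2 ^ (M - k) + l')%:R / 2 ^+ M in
     eps * `|x' - x| < `|phi x' - phi x - (x' - x) *
       (2 ^+ k * (phi (c.+1%:R / 2 ^+ k) - phi (c%:R / 2 ^+ k)))|]) ->
  eps ^+ 2 * \sum_(0 <= i < 2 ^ M) (F i)%:R <=
  2 * 2 ^+ M * (dyadic_energy phi M - dyadic_energy phi k).
Proof.
move=> kM eps0 HF; set p := (2 ^ (M - k))%N in HF *.
have EM : (2 ^ M = 2 ^ k * p)%N by rewrite -expnD subnKC.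
have k2 : 0 < 2 ^+ k :> R by rewrite exprn_gt0.
have pp : (0 < p)%N by rewrite expn_gt0.
have p2 : 0 < p%:R :> R by rewrite ltr0n.
have EMr : 2 ^+ M = 2 ^+ k * p%:R :> R by rewrite -natrX EM natrM natrX.
have M2 : 0 < 2 ^+ M :> R by rewrite exprn_gt0.
have Ec c : (c * p)%:R / 2 ^+ M = c%:R / 2 ^+ k :> R.
  by rewrite EMr natrM; field; rewrite !lt0r_neq0.
pose a c l := phi ((c * p + l)%:R / 2 ^+ M).
have Hc c : (c < 2 ^ k)%N -> (eps / 2 ^+ M) ^+ 2 * \sum_(0 <= l < p) (F (c * p + l)%N)%:R <=
   2 * (\sum_(0 <= l < p) (a c l.+1 - a c l) ^+ 2 - (a c p - a c 0%N) ^+ 2 / p%:R).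
  move=> ck; apply: discrete_maximal_cell => //; first by rewrite divr_ge0 // ltW.
  move=> l lp /(HF _ _ ck lp)[l' [l'p l'l /= H]]; exists l'; split => //.
  move: H; rewrite -mulrBl !natrD opprD addrACA subrr add0r.
  rewrite normrM [`|(2 ^+ M)^-1|]ger0_norm ?invr_ge0 ?ltW // mulrA mulrAC.
  rewrite /a addn0 -mulSnr !Ec => /lt_le_trans; apply.
  rewrite !natrD le_eqVlt; apply/orP; left; apply/eqP; congr `|_ - _|.
  by rewrite EMr; field; rewrite !lt0r_neq0.
have sumH : (eps / 2 ^+ M) ^+ 2 * \sum_(0 <= i < 2 ^ M) (F i)%:R <=
   2 * (\sum_(0 <= i < 2 ^ M) (phi (i.+1%:R / 2 ^+ M) - phi (i%:R / 2 ^+ M)) ^+ 2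
       - (\sum_(0 <= c < 2 ^ k) (phi (c.+1%:R / 2 ^+ k) - phi (c%:R / 2 ^+ k)) ^+ 2) / p%:R).
  rewrite EM !sum_nat_mul mulr_sumr mulr_suml -sumrB mulr_sumr.
  apply: ler_sum_nat => c /andP[_ ck]; apply: (le_trans (Hc c ck)).
  by rewrite /a addn0 -mulSnr !Ec; under eq_bigr do rewrite addnS.
move: sumH; rewrite -(ler_pM2l (exprn_gt0 2 M2)) /dyadic_energy.
congr (_ <= _); first by field; rewrite lt0r_neq0.
by rewrite EMr; field; rewrite !lt0r_neq0.
Qed.

(** This is the maximal estimate with [eps = 0] and no bad index. *)
Lemma dyadic_energy_le_mono phi k M : (k <= M)%N ->
  dyadic_energy phi k <= dyadic_energy phi M.
Proof.
move=> kM.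
have := @dyadic_maximal phi k M 0 pred0 kM (lexx _) (fun c l _ _ => ltac:(done)).
rewrite expr0n mul0r pmulr_rge0 ?subr_ge0 //.
Qed.

End Energy.

(** * Null sets *)

Section CubeNull.
Context {R : realType} {n : nat}.
Local Notation V := 'rV[R]_n.+1.
Implicit Types (A B : set V) (x y : V).

(* Balls are cubes for the sup norm, so up to the factor 2 ^ n.+1 this says
   that the Lebesgue outer measure vanishes. *)
Definition cube_null A : Prop := forall eps : R, 0 < eps ->
  exists (c : nat -> V) (r : nat -> R),
    [/\ forall k, 0 <= r k,
        A `<=` \bigcup_k ball (c k) (r k) &
        forall N, \sum_(0 <= k < N) r k ^+ n.+1 <= eps].

Lemma cube_null_sub A B : A `<=` B -> cube_null B -> cube_null A.
Proof.
move=> AB HB eps eps0; have [c [r [r0 Bc Hs]]] := HB _ eps0.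
by exists c, r; split => //; exact: subset_trans Bc.
Qed.

Lemma ler_sum_uniq_sub (I : eqType) (s t : seq I) (f : I -> R) :
  uniq s -> uniq t -> {subset s <= t} -> (forall i, 0 <= f i) ->
  \sum_(i <- s) f i <= \sum_(i <- t) f i.
Proof.
move=> us ut st f0.
have E : perm_eq s [seq i <- t | i \in s].
  apply: uniq_perm => //; first exact: filter_uniq.
  by move=> i; rewrite mem_filter; case: (boolP (i \in s)) => // /st ->.
by rewrite (perm_big _ E) big_filter [leRHS](bigID (fun i => i \in s)) /= lerDl sumr_ge0.
Qed.

(** Later covers are indexed by pairs or by dyadic cubes of all levels. Numbers that code no index
    receive radius [0], hence an empty ball and a zero term. *)
Lemma cube_null_count A : (forall eps : R, 0 < eps ->
  exists (I : countType) (c : I -> V) (r : I -> R),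
    [/\ forall i, 0 <= r i,
        A `<=` \bigcup_i ball (c i) (r i) &
        forall s : seq I, uniq s -> \sum_(i <- s) r i ^+ n.+1 <= eps]) ->
  cube_null A.
Proof.
move=> H eps eps0; have [I [c [r [r0 Ac Hs]]]] := H _ eps0.
exists (fun k => oapp c 0 (pickle_inv k)), (fun k => oapp r 0 (pickle_inv k)).
split.
- by move=> k; case: pickle_inv => //=.
- by move=> x /Ac[i _ xi]; exists (pickle i) => //; rewrite pickleK_inv.
move=> N; set s := pmap (@pickle_inv I) (iota 0 N).
have -> : \sum_(0 <= k < N) oapp r 0 (pickle_inv k) ^+ n.+1 =
          \sum_(i <- s) r i ^+ n.+1.
  rewrite /s /index_iota subn0; elim: (iota 0 N) => [|k l IH]; first by rewrite !big_nil.
  rewrite big_cons IH /=; case: (pickle_inv k : option I) => [i|] /=.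
    by rewrite big_cons.
  by rewrite expr0n /= add0r.
apply: Hs; apply: (pmap_uniq (g := pickle)); last exact: iota_uniq.
exact: pickle_invK.
Qed.

Lemma sum_half_le (eps : R) N : 0 <= eps ->
  \sum_(0 <= k < N) eps / 2 ^+ k.+1 <= eps.
Proof.
move=> eps0; suff -> : \sum_(0 <= k < N) eps / 2 ^+ k.+1 = eps - eps / 2 ^+ N.
  by rewrite lerBlDr lerDl divr_ge0 ?exprn_ge0.
elim: N => [|N IH]; first by rewrite big_geq // expr0 divr1 subrr.
rewrite big_nat_recr //= IH exprS; field.
by rewrite expf_neq0 // pnatr_eq0.
Qed.

Lemma cube_null_bigcup (A : nat -> set V) :
  (forall k, cube_null (A k)) -> cube_null (\bigcup_k A k).
Proof.
move=> HA; apply: cube_null_count => eps eps0.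
have H k : exists p : (nat -> V) * (nat -> R), [/\ forall j, 0 <= p.2 j,
      A k `<=` \bigcup_j ball (p.1 j) (p.2 j) &
      forall N, \sum_(0 <= j < N) p.2 j ^+ n.+1 <= eps / 2 ^+ k.+1].
  have [|c [r H]] := HA k (eps / 2 ^+ k.+1); first by rewrite divr_gt0 ?exprn_gt0.
  by exists (c, r).
have [p Hp] := choice H.
exists (nat * nat)%type, (fun q => (p q.1).1 q.2), (fun q => (p q.1).2 q.2).
split.
- by move=> [k j] /=; have [] := Hp k.
- move=> x [k _ Akx]; have [_ /(_ _ Akx)[j _ xj] _] := Hp k.
  by exists (k, j).
(* A finite list of pairs lies in a square of side [K], whose rows are bounded by the geometric
   budgets [eps / 2 ^+ k.+1]. *)
move=> s us; pose K := (\max_(q <- s) maxn q.1 q.2).+1.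
pose t := [seq (k, j) | k <- iota 0 K, j <- iota 0 K].
apply: (@le_trans _ _ (\sum_(q <- t) (p q.1).2 q.2 ^+ n.+1)).
  apply: ler_sum_uniq_sub => //.
  - by apply: allpairs_uniq; rewrite ?iota_uniq // => -[? ?] [? ?].
  - move=> q qs; have qK : (maxn q.1 q.2 < K)%N.
      by rewrite ltnS; apply: (leq_bigmax_seq (F := fun q : nat * nat => maxn q.1 q.2)).
    move: qK; rewrite gtn_max => /andP[q1 q2].
    by rewrite [q]surjective_pairing; apply: allpairs_f; rewrite mem_iota.
  - by move=> q; rewrite exprn_ge0 //; have [] := Hp q.1.
rewrite big_allpairs /=.
apply: (le_trans _ (sum_half_le K (ltW eps0))).
rewrite /index_iota subn0; apply: ler_sum => k _.
by have [_ _ /(_ K)] := Hp k; rewrite /index_iota subn0.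
Qed.

Lemma cube_null_bigcup_count (T : countType) (A : T -> set V) :
  (forall t, cube_null (A t)) -> cube_null (\bigcup_t A t).
Proof.
move=> HA.
pose B k := if pickle_inv k is Some t then A t else set0.
apply: (@cube_null_sub _ (\bigcup_k B k)).
  by move=> x [t _ Atx]; exists (pickle t) => //; rewrite /B pickleK_inv.
apply: cube_null_bigcup => k; rewrite /B; case: pickle_inv => // eps eps0.
exists (fun=> 0), (fun=> 0); split => // N.
by rewrite big1 ?ltW // => k' _; rewrite expr0n.
Qed.

Lemma cube_nullU A B : cube_null A -> cube_null B -> cube_null (A `|` B).
Proof.
move=> HA HB; apply: (@cube_null_sub _ (\bigcup_(b : bool) if b then A else B)).
  by move=> x [Ax|Bx]; [exists true|exists false].
by apply: cube_null_bigcup_count => -[].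
Qed.

(** The Lipschitz bound is assumed on [A] only, so the new balls are centred at images of points of
    [A] and not at images of the old centres; this doubles the radius, whence [K = 2 * L]. *)
Lemma cube_null_lipschitz A (Phi : V -> V) (L : R) : 0 < L ->
  (forall x y, A x -> A y -> `|Phi x - Phi y| <= L * `|x - y|) ->
  cube_null A -> cube_null (Phi @` A).
Proof.
move=> L0 HL HA eps eps0; pose K := 2 * L; have K0 : 0 < K by rewrite mulr_gt0.
have [|c [r [r0 Ac Hs]]] := HA (eps / K ^+ n.+1); first by rewrite divr_gt0 ?exprn_gt0.
have Hd k : exists d : V, forall x, A x -> ball (c k) (r k) x -> ball d (K * r k) (Phi x).
  have [[y [Ay yk]]|N] := pselect (exists y, A y /\ ball (c k) (r k) y); last first.
    by exists 0 => x Ax xk; case: N; exists x.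
  exists (Phi y) => x Ax xk; move: xk yk; rewrite -!ball_normE /= => xk yk.
  have lt2 : `|y - x| < 2 * r k.
    rewrite -(subrKA (c k)) mulr_natl mulr2n (le_lt_trans (ler_normD _ _)) //.
    by rewrite ltrD // distrC.
  by apply: (le_lt_trans (HL _ _ Ay Ax)); rewrite /K [2 * L]mulrC -mulrA ltr_pM2l.
have [d Hd'] := choice Hd.
exists d, (fun k => K * r k); split.
- by move=> k; rewrite mulr_ge0 // ltW.
- by move=> _ [x Ax <-]; have [k _ xk] := Ac _ Ax; exists k => //; exact: Hd'.
move=> N; under eq_bigr do rewrite exprMn.
by rewrite -mulr_sumr mulrC -ler_pdivlMr ?exprn_gt0.
Qed.

End CubeNull.

(** * Nontriviality of null sets, by counting grid points *)

Section UnitCube.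
Context {R : realType} {n : nat}.
Local Notation V := 'rV[R]_n.+1.

Lemma sum_pred_count (s : seq nat) (P : pred nat) :
  \sum_(j <- s) (P j)%:R = (count P s)%:R :> R.
Proof.
by elim: s => [|j s IH]; rewrite ?big_nil // big_cons IH /= natrD.
Qed.

Lemma sum_nat_itv_le (a b : R) N : a <= b ->
  \sum_(0 <= j < N) (a < j%:R < b)%R%:R <= b - a + 1.
Proof.
move=> ab; have ba0 : 0 <= b - a by rewrite subr_ge0.
have [[j0 Hj0]|NE] := pselect (exists j : nat, a < j%:R < b); last first.
  rewrite big1; first by lra.
  by move=> j _; case: (boolP (a < _ < b)) => // H; case: NE; exists j.
have ex : exists j : nat, a < j%:R < b by exists j0.
case: (ex_minnP ex) => m /andP[am mb] mmin; set K := Num.trunc (b - a).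
rewrite (sum_pred_count _ (fun j => a < j%:R < b)) -size_filter.
have KK : (K.+1)%:R <= b - a + 1 by rewrite -natr1 lerD2r truncn_le.
apply: le_trans KK; rewrite ler_nat -[K.+1](size_iota m).
apply: uniq_leq_size; first by rewrite filter_uniq // iota_uniq.
move=> j; rewrite mem_filter => /andP[ajb _]; rewrite mem_iota (mmin _ ajb) /=.
move: ajb => /andP[aj jb]; rewrite addnS ltnS -leq_subLR truncn_ge_nat //.
by rewrite natrB ?mmin ?aj // lerB // ltW.
Qed.

Lemma sum_ffun_prod (I J : finType) (F : I -> J -> R) :
  \sum_(g : {ffun I -> J}) \prod_i F i (g i) = \prod_i \sum_j F i j.
Proof. by rewrite bigA_distr_bigA. Qed.

Lemma ltr_norm_rV (x : V) (r : R) : 0 < r ->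
  (`|x| < r) = [forall i, `|x 0 i| < r].
Proof.
move=> r0; rewrite /Num.norm /= mx_normrE; apply/idP/forallP.
  move=> /bigmax_ltP[_ H] i; exact: (H (0, i)).
by move=> H; apply/bigmax_ltP; split => // -[i j] _; rewrite (ord1 i); exact: H.
Qed.

Lemma ler_norm_rV (x : V) (r : R) : 0 <= r ->
  (`|x| <= r) = [forall i, `|x 0 i| <= r].
Proof.
move=> r0; rewrite /Num.norm /= mx_normrE; apply/idP/forallP.
  move=> /bigmax_leP[_ H] i; exact: (H (0, i)).
by move=> H; apply/bigmax_leP; split => // -[i j] _; rewrite (ord1 i); exact: H.
Qed.

Lemma coord_le_norm (x : V) i : `|x 0 i| <= `|x|.
Proof. by have := lexx `|x|; rewrite ler_norm_rV // => /forallP. Qed.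

(** By compactness finitely many balls cover the cube. Among the [N ^ n.+1] points of a fine grid a
    ball of radius [r] contains at most [(3 * r * N) ^ n.+1], so the sum of the [r ^ n.+1] is at
    least [3 ^- n.+1]; the cover is chosen with half of that. *)
Lemma unit_cube_not_null :
  ~ cube_null [set x : V | forall i, 0 <= x 0 i <= 1].
Proof.
move=> HN; pose d : R := 3 ^+ n.+1.
have d0 : 0 < d by rewrite exprn_gt0.
have [|c [r [r0 cov Hs]]] := HN (2 * d)^-1; first by rewrite invr_gt0 mulr_gt0.
have : compact [set x : V | forall i, 0 <= x 0 i <= 1].
  have := @rV_compact R n.+1 (fun=> `[0, 1]%classic) (fun=> @segment_compact R 0 1).
  by congr compact; apply/seteqP; split => x /= H i; have := H i; rewrite in_itv.
rewrite compact_cover => /(_ nat setT (fun k => ball (c k) (r k))).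
case=> [k _|//|Df _ HDf]; first exact: ball_open.
pose D : seq nat := finmap.enum_fset Df.
have HD (x : V) : (forall i, 0 <= x 0 i <= 1) -> exists2 k, k \in D & ball (c k) (r k) x.
  by move=> /HDf[k /= kD xk]; exists k.
(* [N] exceeds the inverse of every positive radius of the subcover, so the rounding error [1] in
   counting integers is at most [r k * N]; this gives the factor [3 = 2 + 1]. *)
pose N := (\sum_(k <- D) (Num.trunc (r k)^-1).+1).+1.
have N0 : 0 < N%:R :> R by rewrite ltr0n.
have HrN k : k \in D -> r k = 0 \/ 1 <= r k * N%:R.
  move=> kD; have := r0 k; rewrite le_eqVlt eq_sym => /orP[/eqP|rk0]; first by left.
  right; rewrite mulrC -ler_pdivrMr // mul1r ltW // -truncn_lt_nat ?invr_ge0 ?ltW //.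
  by rewrite ltnS; apply: leq_trans (leqnSn _) _; rewrite (big_rem k) //= leq_addr.
pose pt (g : {ffun 'I_n.+1 -> 'I_N}) : V := \row_i ((g i)%:R / N%:R).
pose F k (i : 'I_n.+1) (j : 'I_N) : R := (`|c k 0 i - j%:R / N%:R| < r k)%R%:R.
have H1 (g : {ffun 'I_n.+1 -> 'I_N}) : 1 <= \sum_(k <- D) \prod_i F k i (g i).
  have [|k kD Hk] := HD (pt g).
    move=> i; rewrite mxE divr_ge0 ?ler0n //= ler_pdivrMr // mul1r ler_nat.
    exact: ltnW.
  rewrite (big_rem k) //=.
  have rk0 : 0 < r k by move: Hk; rewrite -ball_normE; apply: le_lt_trans.
  rewrite big1 ?lerDl ?sumr_ge0 // => [|i _].
    by move=> k' _; apply: prodr_ge0.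
  move: Hk; rewrite -ball_normE /= ltr_norm_rV // => /forallP/(_ i).
  by rewrite !mxE /F => ->.
have H2 k : k \in D -> \prod_i \sum_j F k i j <= (3 * (r k * N%:R)) ^+ n.+1.
  move=> kD; rewrite -[X in _ ^+ X]card_ord -prodr_const; apply: ler_prod => i _.
  rewrite sumr_ge0 //=.
  have [rk|rk1] := HrN _ kD.
    by rewrite rk mul0r mulr0 big1 // => j _; rewrite /F rk normr_lt0.
  rewrite -(big_mkord xpredT (fun j => (`|c k 0 i - j%:R / N%:R| < r k)%R%:R)).
  have -> : \sum_(0 <= j < N) (`|c k 0 i - j%:R / N%:R| < r k)%R%:R =
    \sum_(0 <= j < N) ((c k 0 i - r k) * N%:R < j%:R < (c k 0 i + r k) * N%:R)%R%:R :> R.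
    apply: eq_bigr => j _; rewrite distrC ltr_distl.
    by rewrite ltr_pdivrMr // ltr_pdivlMr.
  apply: (le_trans (sum_nat_itv_le _ _)); last by lra.
  by rewrite ler_pM2r // lerD2l ge0_cp.
have : \sum_(g : {ffun 'I_n.+1 -> 'I_N}) 1 <=
    \sum_(k <- D) (3 * (r k * N%:R)) ^+ n.+1.
  apply: (@le_trans _ _ (\sum_(g : {ffun 'I_n.+1 -> 'I_N}) \sum_(k <- D) \prod_i F k i (g i))).
    by apply: ler_sum.
  rewrite exchange_big /= big_seq [leRHS]big_seq; apply: ler_sum => k kD.
  by rewrite sum_ffun_prod; exact: H2.
rewrite sumr_const card_ffun !card_ord natrX.
under eq_bigr do rewrite mulrA exprMn exprMn -/d.
rewrite -mulr_suml -mulr_sumr -[leLHS]mul1r ler_pM2r ?exprn_gt0 //.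
apply/negP; rewrite -ltNge.
apply: (@le_lt_trans _ _ (d * (2 * d)^-1)); last first.
  by rewrite invfM mulrCA mulfV ?lt0r_neq0 // mulr1 invf_lt1 // ltr1n.
rewrite ler_pM2l //; pose M := (\max_(k <- D) k).+1.
apply: le_trans (Hs M); apply: ler_sum_uniq_sub.
- exact: finmap.fset_uniq.
- exact: iota_uniq.
- move=> k kD; rewrite mem_index_iota /= /M ltnS.
  exact: (leq_bigmax_seq (F := id)).
- by move=> k; rewrite exprn_ge0.
Qed.

End UnitCube.

(** * Dyadic cubes *)

Section Dyadic.
Context {R : realType}.

(** If every level were beaten by more than [eta] at some finer level for all large [m], iteration
    would push the energy above [B]. The level [k] does not depend on [m], while the good values of
    [m] may depend on [M]. *)
Lemma energy_pigeonhole (e : nat -> nat -> R) (B eta : R) : 0 < eta ->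
  (forall k m, 0 <= e k m <= B) ->
  (forall k k' m, (k <= k')%N -> e k m <= e k' m) ->
  exists k, forall M, (k <= M)%N -> forall m0, exists2 m, (m0 <= m)%N &
    e M m - e k m <= eta.
Proof.
move=> eta0 He mono; apply: contrapT => H.
have step J : exists k m0, forall m, (m0 <= m)%N -> J%:R * eta <= e k m.
  elim: J => [|J [k [m0 IH]]].
    by exists 0%N, 0%N => m _; rewrite mul0r; case/andP: (He 0%N m).
  apply: contrapT => N; apply: H; exists k => M kM m1.
  apply: contrapT => N'; apply: N; exists M, (maxn m0 m1) => m.
  rewrite geq_max => /andP[m0m m1m]; rewrite -natr1 mulrDl mul1r addrC -lerBrDr.
  have lt : eta < e M m - e k m.
    by rewrite ltNge; apply/negP => le; apply: N'; exists m.
  have := IH m m0m; lra.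
have [k [m0 Hk]] := step (Num.trunc (B / eta)).+1.
have := Hk m0 (leqnn _); have /andP[_ eB] := He k m0.
apply/negP; rewrite -ltNge; apply: (le_lt_trans eB).
by rewrite -ltr_pdivrMr // -truncn_lt_nat // divr_ge0 ?(ltW eta0) // (le_trans _ eB) //; case/andP: (He k m0).
Qed.

Lemma dyadic_itvE (T m a j : nat) : (T <= m)%N ->
  (a%:R / 2 ^+ T <= (j%:R / 2 ^+ m : R) < a.+1%:R / 2 ^+ T) =
  (j %/ 2 ^ (m - T) == a)%N.
Proof.
move=> Tm; set p := (2 ^ (m - T))%N; have p0 : (0 < p)%N by rewrite expn_gt0.
have Em : 2 ^+ m = 2 ^+ T * p%:R :> R by rewrite natrX -exprD subnKC.
have T2 : 0 < 2 ^+ T :> R by rewrite exprn_gt0.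
have m2 : 0 < 2 ^+ m :> R by rewrite exprn_gt0.
have pR : 0 < p%:R :> R by rewrite ltr0n.
have E x : x%:R / 2 ^+ T = (x * p)%:R / 2 ^+ m :> R.
  by rewrite Em natrM; field; rewrite !lt0r_neq0.
rewrite !E ler_pM2r ?invr_gt0 // ltr_pM2r ?invr_gt0 // ler_nat ltr_nat.
by rewrite eqn_leq -[(_ %/ _ <= _)%N]ltnS ltn_divLR // leq_divRL // andbC.
Qed.

Lemma sum_dyadic_itv (T m a : nat) : (T <= m)%N -> (a < 2 ^ T)%N ->
  \sum_(j < 2 ^ m) ((j %/ 2 ^ (m - T))%N == a)%:R = 2 ^+ (m - T) :> R.
Proof.
move=> Tm aT; rewrite -(big_mkord xpredT (fun j => ((j %/ 2 ^ (m - T))%N == a)%:R)).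
have -> : (2 ^ m = 2 ^ T * 2 ^ (m - T))%N by rewrite -expnD subnKC.
have p0 : (0 < 2 ^ (m - T))%N by rewrite expn_gt0.
rewrite sum_nat_mul (big_rem a) ?mem_index_iota //=.
rewrite [X in _ + X]big_seq_cond [X in _ + X]big1 ?addr0.
  rewrite (eq_big_nat _ _ (F2 := fun=> 1)); last first.
    by move=> l /andP[_ lp]; rewrite divnMDl // divn_small // addn0 eqxx.
  by rewrite sumr_const_nat subn0 natrX.
move=> c; rewrite andbT (rem_filter _ (iota_uniq _ _)) mem_filter /= => /andP[ca _].
rewrite big_nat_cond big1 // => l /andP[/andP[_ lp] _].
by rewrite divnMDl // divn_small // addn0 (negbTE ca).
Qed.

End Dyadic.

(** * Energies averaged over grid lines, and bad cubes *)

Section Cubes.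
Context {R : realType} {n : nat} (i0 : 'I_n.+1) (h : 'rV[R]_n.+1 -> R) (L : R).
Context (hL : forall x y, `|h x - h y| <= L * `|x - y|).
Local Notation V := 'rV[R]_n.+1.
Local Notation grid m := {ffun 'I_n.+1 -> 'I_(2 ^ m)}.
Implicit Types (x y : V).

Definition put y (s : R) : V := \row_l (if l == i0 then s else y 0 l).

Lemma put_put x s t : put (put x s) t = put x t.
Proof. by apply/rowP => l; rewrite !mxE; case: eqP. Qed.

Lemma norm_put_sub x s t : `|put x s - put x t| <= `|s - t|.
Proof.
rewrite ler_norm_rV //; apply/forallP => l; rewrite !mxE; case: eqP => // _.
by rewrite subrr normr0.
Qed.

Lemma put_lipschitz x s t : `|h (put x s) - h (put x t)| <= L * `|s - t|.
Proof.
apply: (le_trans (hL _ _)); apply: ler_wpM2l; last exact: norm_put_sub.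
have := hL (const_mx 1) 0; rewrite subr0 => /(le_trans (normr_ge0 _)).
rewrite pmulr_lge0 // normr_gt0; apply/eqP => /rowP/(_ 0).
by rewrite !mxE; apply/eqP; rewrite oner_eq0.
Qed.

Definition gridpt m (g : grid m) : V := \row_l ((g l)%:R / 2 ^+ m).

(* [put] overwrites the coordinate [i0] of the grid point, so every line is
   counted [2 ^ m] times; the normalization takes this into account. *)
Definition grid_energy (k m : nat) : R :=
  (\sum_(g : grid m) dyadic_energy (fun s => h (put (gridpt g) s)) k) /
  2 ^+ (m * n.+1).

Lemma card_grid m : #|{: grid m}| = (2 ^ (m * n.+1))%N.
Proof. by rewrite card_ffun !card_ord expnM. Qed.

Lemma grid_energy_bound k m : 0 <= grid_energy k m <= L ^+ 2.
Proof.
have p0 : 0 < 2 ^+ (m * n.+1) :> R by rewrite exprn_gt0.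
rewrite /grid_energy divr_ge0 ?(ltW p0) //=; last first.
  by apply: sumr_ge0 => g _; exact: dyadic_energy_ge0.
rewrite ler_pdivrMr //.
apply: (@le_trans _ _ (\sum_(g : grid m) L ^+ 2)).
  by apply: ler_sum => g _; apply: dyadic_energy_le => s t; exact: put_lipschitz.
by rewrite sumr_const card_grid -[leLHS]mulr_natr natrX.
Qed.

Lemma grid_energy_mono k k' m : (k <= k')%N -> grid_energy k m <= grid_energy k' m.
Proof.
move=> kk'; rewrite /grid_energy ler_pM2r ?invr_gt0 ?exprn_gt0 //.
by apply: ler_sum => g _; exact: dyadic_energy_le_mono.
Qed.

Lemma grid_energy_stable (eta : R) : 0 < eta ->
  exists k, forall M, (k <= M)%N -> forall m0, exists2 m, (m0 <= m)%N &
    grid_energy M m - grid_energy k m <= eta.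
Proof.
move=> eta0; apply: (@energy_pigeonhole _ _ (L ^+ 2)) => //.
  exact: grid_energy_bound.
by move=> *; exact: grid_energy_mono.
Qed.

Definition in_cube T (w : grid T) x : bool :=
  [forall l, (w l)%:R / 2 ^+ T <= x 0 l < (w l).+1%:R / 2 ^+ T].

(** The starting coordinate lies in the half-open cell, so that it determines [c]; the step may end
    at the right endpoint, which is a node of the cell too. *)
Definition deviates (k : nat) (eps : R) (c : nat) (t : R) x : Prop :=
  [/\ c%:R / 2 ^+ k <= x 0 i0 < c.+1%:R / 2 ^+ k,
      c%:R / 2 ^+ k <= x 0 i0 + t <= c.+1%:R / 2 ^+ k &
      eps * `|t| < `|h (put x (x 0 i0 + t)) - h x - t *
        (2 ^+ k * (h (put x (c.+1%:R / 2 ^+ k)) - h (put x (c%:R / 2 ^+ k))))|].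

(** One cell [c] and one dyadic step serve all points of the cube. On a fine enough grid the step is
    a whole number of grid steps, so every grid point of the cube is a bad index for the maximal
    inequality. *)
Definition bad_cube k eps T (w : grid T) : Prop :=
  exists c M (z : int), (c < 2 ^ k)%N /\
    forall x, in_cube w x -> deviates k eps c (z%:~R / 2 ^+ M) x.

Lemma in_cube_uniq T (w w' : grid T) x : in_cube w x -> in_cube w' x -> w = w'.
Proof.
move=> /forallP H /forallP H'; apply/ffunP => l; apply/val_inj/eqP => /=.
have T2 : 0 < 2 ^+ T :> R by rewrite exprn_gt0.
have := H l; have := H' l => /andP[a b] /andP[c d].
have := le_lt_trans a d; have := le_lt_trans c b.
by rewrite !ltr_pM2r ?invr_gt0 // !ltr_nat !ltnS => ? ?; rewrite eqn_leq; apply/andP.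
Qed.

(** Among the pairs of a grid line and a node on it, the proportion falling in the cube is its
    volume; the indicator factors over the coordinates, so the count is a product. *)
Lemma sum_in_cube T M m (w : grid T) : (T <= M)%N -> (T <= m)%N ->
  \sum_(g : grid m) \sum_(0 <= i < 2 ^ M)
     (in_cube w (put (gridpt g) (i%:R / 2 ^+ M)))%:R =
  2 ^+ M * 2 ^+ (m * n.+1) / 2 ^+ (T * n.+1) :> R.
Proof.
move=> TM Tm; rewrite exchange_big /=.
pose F i l (j : 'I_(2 ^ m)) : R := if l == i0
  then (i %/ 2 ^ (M - T) == w i0)%N%:R else (j %/ 2 ^ (m - T) == w l)%N%:R.
have E i (g : grid m) : (in_cube w (put (gridpt g) (i%:R / 2 ^+ M)))%:R =
    \prod_l F i l (g l).
  transitivity (\prod_l ((w l)%:R / 2 ^+ T <=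
      put (gridpt g) (i%:R / 2 ^+ M) 0 l < (w l).+1%:R / 2 ^+ T)%R%:R : R).
    have [/forallP H|] := boolP (in_cube w _).
      by rewrite big1 // => l _; rewrite H.
    by move=> /forallPn[l /negbTE Hl]; rewrite (bigD1 l) //= Hl mul0r.
  apply: eq_bigr => l _; rewrite /F !mxE; case: (eqVneq l i0) => [->|_].
    by rewrite dyadic_itvE.
  by rewrite dyadic_itvE.
under eq_bigr do under eq_bigr do rewrite E.
under eq_bigr do rewrite sum_ffun_prod (bigD1 i0) //=.
have E1 i : \sum_(j < 2 ^ m) F i i0 j = 2 ^+ m * (i %/ 2 ^ (M - T) == w i0)%N%:R.
  by rewrite /F eqxx sumr_const card_ord -[LHS]mulr_natl natrX.
have E2 i : \prod_(l | l != i0) \sum_(j < 2 ^ m) F i l j = 2 ^+ ((m - T) * n).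
  rewrite (eq_bigr (fun=> 2 ^+ (m - T))); last first.
    by move=> l /negbTE li0; rewrite /F li0 sum_dyadic_itv.
  by rewrite prodr_const cardC1 card_ord /= -exprM.
under eq_bigr do rewrite E1 E2 -mulrA.
rewrite -mulr_sumr -mulr_suml (big_mkord xpredT (fun i => (i %/ 2 ^ (M - T) == w i0)%N%:R)).
rewrite sum_dyadic_itv //.
apply: (canRL (mulfK _)); first by rewrite expf_neq0 // pnatr_eq0.
rewrite -!exprD; congr (_ ^+ _); rewrite mulnBl !mulnS.
have : (T * n <= m * n)%N by rewrite leq_mul2r Tm orbT.
lia.
Qed.

End Cubes.

Section Cubes2.
Context {R : realType} {n : nat} (i0 : 'I_n.+1) (h : 'rV[R]_n.+1 -> R).
Local Notation V := 'rV[R]_n.+1.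
Local Notation grid m := {ffun 'I_n.+1 -> 'I_(2 ^ m)}.
Implicit Types (x y : V).

Lemma absz_addr (a l : nat) (z : int) : (a%:Z <= (a + l)%:Z + z)%R ->
  (a + absz (l%:Z + z)%R)%N%:Z = ((a + l)%:Z + z)%R.
Proof. lia. Qed.

(** Double counting of the bad nodes on grid lines: the maximal inequality bounds them from above by
    the energy gap, and disjointness of the cubes bounds them from below by the total volume of
    [C]. *)
Lemma card_bad_cubes (k : nat) (eps eta : R) T (C : pred (grid T)) :
  0 <= eps ->
  (forall M, (k <= M)%N -> forall m0, exists2 m, (m0 <= m)%N &
     grid_energy i0 h M m - grid_energy i0 h k m <= eta) ->
  (forall w, C w -> bad_cube i0 h k eps w) ->
  eps ^+ 2 * (\sum_w (C w)%:R / 2 ^+ (T * n.+1)) <= 2 * eta.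
Proof.
move=> eps0 Heta HC.
have HM w : exists M, C w -> exists c (z : int), (c < 2 ^ k)%N /\
    forall x, in_cube w x -> deviates i0 h k eps c (z%:~R / 2 ^+ M) x.
  have [Cw|_] := boolP (C w); last by exists 0%N.
  by have [c [M [z H]]] := HC _ Cw; exists M => _; exists c, z.
have [Mf HMf] := choice HM.
(* The cubes of level [T] are finitely many, so one fine level [M] resolves all their steps; the
   grid [m] is chosen only afterwards. *)
pose M := maxn (maxn k T) (\max_w Mf w).
have kM : (k <= M)%N by rewrite /M !leq_max leqnn.
have TM : (T <= M)%N by rewrite /M !leq_max leqnn orbT.
have MfM w : (Mf w <= M)%N by rewrite leq_max leq_bigmax orbT.
have [m Tm Hm] := Heta M kM T.
pose F (g : grid m) i : bool :=
  [exists w, C w && in_cube w (put i0 (gridpt g) (i%:R / 2 ^+ M : R))].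
have M2 : 0 < 2 ^+ M :> R by rewrite exprn_gt0.
have k2 : 0 < 2 ^+ k :> R by rewrite exprn_gt0.
have up : eps ^+ 2 * \sum_(g : grid m) \sum_(0 <= i < 2 ^ M) (F g i)%:R <=
    2 * 2 ^+ M * (2 ^+ (m * n.+1) * eta).
  apply: (@le_trans _ _ (\sum_(g : grid m) 2 * 2 ^+ M *
     (dyadic_energy (fun s => h (put i0 (gridpt g) s)) M -
      dyadic_energy (fun s => h (put i0 (gridpt g) s)) k))).
    rewrite mulr_sumr; apply: ler_sum => g _; apply: dyadic_maximal => //.
    set p := (2 ^ (M - k))%N; move=> c l ck lp /existsP[w /andP[Cw Hw]].
    have [c' [z [c'k /(_ _ Hw)[]]]] := HMf _ Cw.
    rewrite !mxE eqxx dyadic_itvE // divnMDl ?expn_gt0 // divn_small // addn0.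
    move=> /eqP <- Ht Hdev.
    have Et : z%:~R / 2 ^+ Mf w = (z * (2 ^ (M - Mf w))%N%:Z)%:~R / 2 ^+ M :> R.
      rewrite intrM -pmulrn natrX; apply/eqP; rewrite eqr_div ?lt0r_neq0 ?exprn_gt0 //.
      by rewrite -mulrA -exprD subnK.
    set z' := (z * _)%R in Et; rewrite Et in Ht Hdev.
    have Ex (a : int) : (c * p)%:R / 2 ^+ M + a%:~R / 2 ^+ M =
       ((c * p)%:Z + a)%:~R / 2 ^+ M :> R.
      by rewrite intrD -pmulrn mulrDl.
    have Ec b : b%:R / 2 ^+ k = (b * p)%:R / 2 ^+ M :> R.
      apply/eqP; rewrite eqr_div ?lt0r_neq0 // natrM natrX -mulrA -exprD subnK //.
    have Exz : (c * p + l)%:R / 2 ^+ M + z'%:~R / 2 ^+ M =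
      ((c * p + l)%:Z + z')%:~R / 2 ^+ M :> R by rewrite intrD -pmulrn mulrDl.
    rewrite Exz in Ht.
    have /andP[Hlo Hhi] : ((c * p)%:Z <= (c * p + l)%:Z + z' <= (c.+1 * p)%:Z)%R.
      move: Ht; rewrite !Ec !ler_pM2r ?invr_gt0 // -!(ler_int R) -!pmulrn.
      by [].
    pose l' := absz (l%:Z + z'); exists l'.
    have El : (c * p + l')%N%:Z = ((c * p + l)%:Z + z')%R by exact: absz_addr.
    have Elr : (c * p + l')%:R = ((c * p + l)%:Z + z')%:~R :> R.
      by rewrite -El -pmulrn.
    have Esub : ((c * p + l')%:R / 2 ^+ M) -
       (c * p + l)%:R / 2 ^+ M = z'%:~R / 2 ^+ M :> R.
      by rewrite Elr intrD -pmulrn mulrDl addrAC subrr add0r.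
    split.
    - by move: Hhi; rewrite -El lez_nat mulSnr leq_add2l.
    - apply/eqP => El'; move: Hdev; have -> : z' = 0.
        by move: El; rewrite El' => /eqP; rewrite -subr_eq0 opprD addrA subrr sub0r oppr_eq0 => /eqP.
      by rewrite mul0r normr0 mulr0 addr0 put_put subrr mul0r subrr normr0 ltxx.
    - move=> x x'; rewrite {}/x {}/x' Esub; move: Hdev.
      rewrite Exz -Elr !put_put; congr (_ < _).
  rewrite -mulr_sumr ler_pM2l ?mulr_gt0 // sumrB mulrC -ler_pdivrMr ?exprn_gt0 //.
  by rewrite mulrBl.
have low : \sum_w (C w)%:R * (2 ^+ M * 2 ^+ (m * n.+1) / 2 ^+ (T * n.+1)) <=
    \sum_(g : grid m) \sum_(0 <= i < 2 ^ M) (F g i)%:R :> R.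
  under eq_bigr => w _ do rewrite -(@sum_in_cube R n i0 T M m w) // mulr_sumr.
  rewrite exchange_big /=; apply: ler_sum => g _.
  under eq_bigr => w _ do rewrite mulr_sumr.
  rewrite exchange_big /=; apply: ler_sum => i _.
  have [/existsP[w /andP[Cw Hw]]|NF] := boolP (F g i); last first.
    rewrite big1 // => w _; rewrite -natrM mulnb.
    by case: (boolP (_ && _)) => // Hw; case/existsP: NF; exists w.
  rewrite (bigD1 w) //= big1 ?addr0 => [|w' w'w].
    by case: (C w); case: in_cube; rewrite ?mulr0 ?mul0r ?mulr1.
  case: (boolP (in_cube w' _)) => Hw'; last by rewrite mulr0.
  by rewrite (in_cube_uniq Hw' Hw) eqxx in w'w.
have p0 : 0 < 2 ^+ M * 2 ^+ (m * n.+1) :> R by rewrite mulr_gt0 ?exprn_gt0.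
rewrite -(ler_pM2r p0).
apply: le_trans (_ : _ <= 2 * 2 ^+ M * (2 ^+ (m * n.+1) * eta)) _; last first.
  rewrite le_eqVlt; apply/orP; left; apply/eqP.
  by move: (2 ^+ M) (2 ^+ (m * n.+1)) => a b; ring.
apply: le_trans up; rewrite -mulrA ler_wpM2l ?sqr_ge0 //.
apply: le_trans low; rewrite mulr_suml le_eqVlt; apply/orP; left; apply/eqP.
apply: eq_bigr => w _.
by move: (2 ^+ M) (2 ^+ (m * n.+1)) (2 ^+ (T * n.+1))^-1 (C w)%:R => a b c d; ring.
Qed.

End Cubes2.

(** * Covering by maximal dyadic cubes *)

Section DyadicCover.
Context {R : realType} {n : nat}.
Local Notation V := 'rV[R]_n.+1.
Local Notation grid m := {ffun 'I_n.+1 -> 'I_(2 ^ m)}.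
Implicit Types (x y : V).

Lemma half_ltn_expn T (i : 'I_(2 ^ T.+1)) : (i %/ 2 < 2 ^ T)%N.
Proof. by rewrite ltn_divLR // mulnC -expnS. Qed.

Definition parent T (w : grid T.+1) : grid T :=
  [ffun l => Ordinal (half_ltn_expn (w l))].

Lemma in_cube_parent T (w : grid T.+1) x : in_cube w x -> in_cube (parent w) x.
Proof.
move=> /forallP H; apply/forallP => l; have := H l; rewrite ffunE /=.
have T2 : 0 < 2 ^+ T :> R by rewrite exprn_gt0.
have E a : a%:R / 2 ^+ T = (a * 2)%:R / 2 ^+ T.+1 :> R.
  by rewrite exprS natrM; field; rewrite lt0r_neq0.
move=> /andP[a b]; rewrite !E; apply/andP; split.
  apply: le_trans a; rewrite ler_pM2r ?invr_gt0 ?exprn_gt0 // ler_nat.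
  exact: leq_divM.
apply: (lt_le_trans b); rewrite ler_pM2r ?invr_gt0 ?exprn_gt0 // ler_nat.
exact: ltn_ceil.
Qed.

Lemma sum_parent T (P : pred (grid T)) :
  \sum_(w : grid T.+1) (P (parent w))%:R = 2 ^+ n.+1 * \sum_v (P v)%:R :> R.
Proof.
pose F (v : grid T) l (j : 'I_(2 ^ T.+1)) : R :=
  ((j %/ 2 ^ (T.+1 - T))%N == v l)%:R.
have E (v : grid T) (w : grid T.+1) : (parent w == v)%:R = \prod_l F v l (w l).
  have e2 : (2 ^ (T.+1 - T) = 2)%N by rewrite subSnn.
  have [<-|] := eqVneq (parent w) v.
    by rewrite big1 // => l _; rewrite /F ffunE /= e2 eqxx.
  case: (boolP [forall l, (w l %/ 2)%N == v l]) => [/forallP H /eqP[]|].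
    by apply/ffunP => l; apply/val_inj; rewrite ffunE /=; exact/eqP.
  by move=> /forallPn[l /negbTE Hl] _; rewrite (bigD1 l) //= /F e2 Hl mul0r.
transitivity (\sum_(w : grid T.+1) \sum_(v : grid T) (parent w == v)%:R * (P v)%:R : R).
  apply: eq_bigr => w _; rewrite (bigD1 (parent w)) //= eqxx mul1r big1 ?addr0 //.
  by move=> v /negbTE; rewrite eq_sym => ->; rewrite mul0r.
rewrite exchange_big mulr_sumr; apply: eq_bigr => v _ /=.
rewrite -mulr_suml; congr (_ * _); under eq_bigr do rewrite E.
rewrite sum_ffun_prod; under eq_bigr do rewrite sum_dyadic_itv // subSnn expr1.
by rewrite prodr_const card_ord.
Qed.

(** Only maximal cubes are kept, those whose parent fails [P]. Subdividing the ones found up to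
    level [K] gives disjoint families of level [K] cubes satisfying [P], so their volumes over all
    levels add up to at most [B]. *)
Lemma dyadic_cover (P : forall T, pred (grid T)) (B : R) :
  (forall T w, P T (parent w) -> P T.+1 w) ->
  (forall T, \sum_w (P T w)%:R / 2 ^+ (T * n.+1) <= B) ->
  exists (I : countType) (c : I -> V) (r : I -> R),
    [/\ forall i, 0 <= r i,
        [set x | exists T w, P T w /\ in_cube w x] `<=` \bigcup_i ball (c i) (r i) &
        forall s : seq I, uniq s -> \sum_(i <- s) r i ^+ n.+1 <= B].
Proof.
move=> Pchild HB.
pose New T := match T return pred (grid T) with
  | 0 => P 0%N | S T' => fun w => P T'.+1 w && ~~ P T' (parent w) end.
have cov T (w : grid T) x : P T w -> in_cube w x ->
    exists T' (w' : grid T'), New T' w' /\ in_cube w' x.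
  elim: T w => [|T IH] w Pw wx; first by exists 0%N, w.
  have [Pp|NPp] := boolP (P T (parent w)); first exact: IH Pp (in_cube_parent wx).
  by exists T.+1, w; split => //=; rewrite Pw.
have sumN K : \sum_(0 <= T < K.+1) \sum_w (New T w)%:R / 2 ^+ (T * n.+1) <=
    \sum_w (P K w)%:R / 2 ^+ (K * n.+1) :> R.
  elim: K => [|K IH]; first by rewrite big_nat1.
  rewrite big_nat_recr //= (le_trans (lerD IH (lexx _))) //.
  have -> : \sum_w (P K w)%:R / 2 ^+ (K * n.+1) =
     \sum_(w : grid K.+1) (P K (parent w))%:R / 2 ^+ (K.+1 * n.+1) :> R.
    rewrite -!mulr_suml sum_parent mulSn exprD; field.
    by rewrite !expf_neq0 // pnatr_eq0.
  rewrite -big_split /=; apply: ler_sum => w _.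
  rewrite -mulrDl ler_pM2r ?invr_gt0 ?exprn_gt0 // -natrD ler_nat.
  by have := @Pchild K w; case: (P K _); case: (P K.+1 _) => //= /(_ isT).
exists {T : nat & grid T}.
(* In the sup norm a half-open cube of side [2 ^- T] lies in the open ball of that radius around its
   lowest corner, so [r ^+ n.+1] is exactly the volume of the cube. *)
exists (fun i : {T : nat & grid T} => \row_l ((tagged i l)%:R / 2 ^+ tag i)).
exists (fun i : {T : nat & grid T} => if New (tag i) (tagged i) then (2 ^+ tag i)^-1 else 0).
split.
- by move=> [T w] /=; case: ifP => // _; rewrite invr_ge0 exprn_ge0.
- move=> x [T [w [Pw wx]]]; have [T' [w' [Nw' w'x]]] := cov _ _ _ Pw wx.
  exists (Tagged (fun T => grid T) w') => //=; rewrite Nw' -ball_normE /=.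
  rewrite ltr_norm_rV ?invr_gt0 ?exprn_gt0 //; apply/forallP => l; rewrite !mxE /=.
  have /forallP/(_ l)/andP[a b] := w'x; rewrite distrC ger0_norm ?subr_ge0 //.
  by rewrite ltrBlDr; move: b; rewrite -natr1 mulrDl mul1r addrC.
move=> s us; pose K := \max_(i <- s) tag i.
apply: le_trans (HB K); apply: le_trans (sumN K).
pose t := [seq Tagged (fun T => grid T) w | T <- iota 0 K.+1, w <- enum {: grid T}].
apply: (@le_trans _ _ (\sum_(i <- t)
  (if New (tag i) (tagged i) then (2 ^+ tag i)^-1 else 0) ^+ n.+1)).
  apply: ler_sum_uniq_sub => //.
  - apply: allpairs_uniq_dep; [exact: iota_uniq|by move=> T _; exact: enum_uniq|].
    by move=> [T w] [T' w'] _ _ /=.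
  - move=> [T w] Tw; apply: allpairs_f_dep; last by rewrite mem_enum.
    rewrite mem_iota /= ltnS.
    exact: (@leq_bigmax_seq _ s xpredT (fun i : {T : nat & grid T} => tag i) _ Tw).
  - by move=> i; rewrite exprn_ge0 //; case: ifP => // _; rewrite invr_ge0 exprn_ge0.
rewrite big_allpairs_dep /= /index_iota subn0; apply: ler_sum => T _.
rewrite big_enum /=; apply: ler_sum => w _; case: (New T w).
  by rewrite exprVn -exprM mul1r.
by rewrite expr0n mul0r.
Qed.

End DyadicCover.

(** * Derivatives in epsilon-delta form *)

Section EpsDelta.
Context {R : realType} {V W : normedModType R}.
Implicit Types (f : V -> W) (x u : V).

Lemma derivable_cauchy (f : V -> R) x u :
  (forall eps : R, 0 < eps -> exists2 d : R, 0 < d & forall t t' : R,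
     0 < `|t| < d -> 0 < `|t'| < d ->
     `|t^-1 * (f (x + t *: u) - f x) - t'^-1 * (f (x + t' *: u) - f x)| < eps) ->
  derivable f x u.
Proof.
move=> H; rewrite /derivable.
apply: cauchy_cvg; apply: cauchy_exP => eps eps0.
have [d d0 Hd] := H _ eps0.
exists ((d / 2)^-1 * (f (x + (d / 2) *: u) - f x)).
exists d => //= t; rewrite /= sub0r normrN => td t0.
rewrite -ball_normE /= [t *: u + x]addrC; apply: Hd.
  by rewrite gtr0_norm ?divr_gt0 // ltr_pdivrMr //; apply/andP; split => //; lra.
by rewrite normr_gt0 t0 td.
Qed.

Lemma derivable_eps f x u (eps : R) : derivable f x u -> 0 < eps ->
  exists2 d : R, 0 < d & forall t : R, `|t| < d ->
    `|f (x + t *: u) - f x - t *: 'D_u f x| <= eps * `|t|.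
Proof.
move=> df eps0; have /cvgrPdist_le/(_ _ eps0) : cvg_to
   ((t^-1 *: ((f \o shift x) (t *: u) - f x)) @[t --> 0^'])%classic
   (nbhs ('D_u f x)) := df.
move=> [d /= d0 Hd]; exists d => // t td.
have [->|t0] := eqVneq t 0; first by rewrite !scale0r addr0 subrr subr0 !normr0 mulr0.
have := Hd t; rewrite /= sub0r normrN => /(_ td t0).
have -> : 'D_u f x - t^-1 *: (f (t *: u + x) - f x) =
   - (t^-1 *: (f (x + t *: u) - f x - t *: 'D_u f x)).
  by rewrite [t *: u + x]addrC [in RHS]scalerBr scalerA mulVf // scale1r opprB.
by rewrite normrN normrZ normfV mulrC ler_pdivrMr // normr_gt0.
Qed.

Lemma is_derive_eps f x u a :
  (forall eps : R, 0 < eps -> exists2 d : R, 0 < d & forall t : R, `|t| < d ->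
    `|f (x + t *: u) - f x - t *: a| <= eps * `|t|) -> is_derive x u f a.
Proof.
move=> H.
have H' : ((t^-1 *: ((f \o shift x) (t *: u) - f x)) @[t --> (0 : R)^'] --> a)%classic.
  apply/cvgrPdist_le => eps eps0; have [d d0 Hd] := H _ eps0.
  exists d => //= t; rewrite /= sub0r normrN => td t0.
  have -> : a - t^-1 *: (f (t *: u + x) - f x) =
     - (t^-1 *: (f (x + t *: u) - f x - t *: a)).
    by rewrite [t *: u + x]addrC [in RHS]scalerBr scalerA mulVf // scale1r opprB.
  by rewrite normrN normrZ normfV mulrC ler_pdivrMr ?normr_gt0 //; exact: Hd.
by apply: DeriveDef; [apply/cvg_ex; exists a|apply: cvg_lim].
Qed.

Lemma differentiable_eps f x (eps : R) : differentiable f x -> 0 < eps ->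
  exists2 d : R, 0 < d & forall w, `|w| < d ->
    `|f (x + w) - f x - 'd f x w| <= eps * `|w|.
Proof.
move=> df eps0; have := diff_locally df.
move=> /eqaddoP/(_ _ eps0)/nbhs_ballP[d /= d0 Hd]; exists d => // w wd.
have := Hd w; rewrite -ball_normE /= sub0r normrN => /(_ wd).
by rewrite !fctE /= [w + x]addrC opprD addrA.
Qed.

Lemma eps_differentiable f x (l : {linear V -> W}) :
  (exists2 C : R, 0 < C & forall w, `|l w| <= C * `|w|) ->
  (forall eps : R, 0 < eps -> exists2 d : R, 0 < d & forall w, `|w| < d ->
    `|f (x + w) - f x - l w| <= eps * `|w|) ->
  differentiable f x /\ 'd f x = l :> (V -> W).
Proof.
move=> [C C0 HC] H.
have lcont : continuous l.
  apply/linear_bounded_continuous/linear_boundedP.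
  by near=> k => w; rewrite (le_trans (HC w)) // ler_wpM2r //; near: k;
     apply: nbhs_pinfty_ge; rewrite num_real.
have E : f \o shift x = cst (f x) + l +o_ 0 id.
  apply/eqaddoP => eps eps0; have [d d0 Hd] := H _ eps0.
  apply/nbhs_ballP; exists d => //= w; rewrite -ball_normE /= sub0r normrN => wd.
  by rewrite !fctE /= [w + x]addrC opprD addrA; exact: Hd.
have El := diff_unique lcont E.
by split => //; apply/diff_locallyP; rewrite El.
Unshelve. all: by end_near. Qed.

End EpsDelta.

(** * Directional derivatives exist almost everywhere *)

Section UnitCubeDerivative.
Context {R : realType}.

Lemma exp2_inv_lt (r : R) : 0 < r -> exists M : nat, (2 ^+ M)^-1 < r.
Proof.
move=> r0; exists (Num.trunc r^-1).+1; rewrite invf_plt ?posrE ?exprn_gt0 //.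
apply: lt_le_trans (_ : (Num.trunc r^-1).+1%:R <= _).
  by rewrite -truncn_lt_nat // invr_ge0 ltW.
by rewrite -natrX ler_nat ltnW // ltn_expl.
Qed.

Lemma dyadic_dense (t r : R) : 0 < r ->
  exists (z : int) (M : nat), `|t - z%:~R / 2 ^+ M| < r.
Proof.
move=> r0; have [M HM] := exp2_inv_lt r0; have M2 : 0 < 2 ^+ M :> R by rewrite exprn_gt0.
exists (Num.floor (t * 2 ^+ M)), M; apply: le_lt_trans HM.
have /andP[lo hi] := floor_itv (t * 2 ^+ M).
rewrite intrD in hi.
have -> : t - (Num.floor (t * 2 ^+ M))%:~R / 2 ^+ M =
    (t * 2 ^+ M - (Num.floor (t * 2 ^+ M))%:~R) / 2 ^+ M.
  by rewrite mulrBl mulfK ?lt0r_neq0.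
rewrite ger0_norm; last by rewrite divr_ge0 ?subr_ge0 ?(ltW M2).
by rewrite ler_pdivrMr // mulVf ?lt0r_neq0 // lerBlDl ltW.
Qed.

Context {n : nat} (i0 : 'I_n.+1) (h : 'rV[R]_n.+1 -> R) (L : R).
Context (L0 : 0 < L) (hL : forall x y, `|h x - h y| <= L * `|x - y|).
Local Notation V := 'rV[R]_n.+1.
Local Notation grid m := {ffun 'I_n.+1 -> 'I_(2 ^ m)}.
Local Notation e0 := (delta_mx 0 i0 : V).
Implicit Types (x y : V).

Lemma put_shift x t : put i0 x (x 0 i0 + t) = x + t *: e0.
Proof.
apply/rowP => l; rewrite !mxE eqxx /=; case: eqP => [->|_]; first by rewrite mulr1.
by rewrite mulr0 addr0.
Qed.

Lemma norm_putB x y s t : `|put i0 x s - put i0 y t| <= Num.max `|s - t| `|x - y|.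
Proof.
rewrite ler_norm_rV; last by rewrite le_max normr_ge0.
apply/forallP => l; rewrite !mxE le_max; case: eqP => _; first by rewrite lexx.
by have := coord_le_norm (x - y) l; rewrite !mxE => ->; rewrite orbT.
Qed.

Lemma in_cube_ex T x : (forall l, 0 < x 0 l < 1) -> exists w : grid T, in_cube w x.
Proof.
move=> Hx; have T2 : 0 < 2 ^+ T :> R by rewrite exprn_gt0.
have H (l : 'I_n.+1) : (Num.trunc (x 0 l * 2 ^+ T)%R < 2 ^ T)%N.
  have /andP[a b] := Hx l; rewrite truncn_lt_nat ?mulr_ge0 ?(ltW a) ?(ltW T2) //.
  by rewrite natrX -[ltRHS]mul1r ltr_pM2r.
exists [ffun l => Ordinal (H l)]; apply/forallP => l; rewrite ffunE /=.
have /andP[a b] := Hx l.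
rewrite ler_pdivrMr // ltr_pdivlMr // truncn_le ?mulr_ge0 ?(ltW a) ?(ltW T2) //=.
by rewrite -truncn_lt_nat ?mulr_ge0 ?(ltW a) ?(ltW T2).
Qed.

(** A non-dyadic coordinate [i0] puts the point inside its cell at every level, so that small steps
    of both signs stay in the cell. *)
Definition bad_quotient (eps : R) : set V := [set x : V | [/\
  forall l, 0 < x 0 l < 1, forall c k : nat, x 0 i0 != c%:R / 2 ^+ k &
  forall d : R, 0 < d -> exists t t' : R, [/\ 0 < `|t| < d, 0 < `|t'| < d &
    2 * eps < `|t^-1 * (h (x + t *: e0) - h x) - t'^-1 * (h (x + t' *: e0) - h x)|]]].

(** Two quotients more than [2 * eps] apart cannot both be within [eps] of the chord slope. The
    resulting deviation is a strict inequality, so it survives replacing the step by a dyadic one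
    and the point by a small cube around it. *)
Lemma bad_quotient_cube (k : nat) eps x : 0 < eps -> bad_quotient eps x ->
  exists T (w : grid T), bad_cube i0 h k eps w /\ in_cube w x.
Proof.
move=> eps0 [Hx nd Hbad]; have k2 : 0 < 2 ^+ k :> R by rewrite exprn_gt0.
have [wk /forallP/(_ i0)/andP[clo chi]] := in_cube_ex k Hx.
pose c : nat := wk i0; have ck : (c < 2 ^ k)%N by exact: ltn_ord.
rewrite -/c in clo chi.
pose a : R := c%:R / 2 ^+ k; pose b : R := c.+1%:R / 2 ^+ k.
have {clo} clo : a < x 0 i0 by rewrite lt_neqAle eq_sym nd clo.
pose sl y := 2 ^+ k * (h (put i0 y b) - h (put i0 y a)).
pose D y t := `|h (put i0 y (y 0 i0 + t)) - h y - t * sl y| - eps * `|t|.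
pose d := Num.min (x 0 i0 - a) (b - x 0 i0).
have d0 : 0 < d by rewrite lt_min !subr_gt0 clo chi.
have [t [td Dt]] : exists t, `|t| < d /\ 0 < D x t.
  have [t [t' [/andP[t0 td] /andP[t'0 t'd] H]]] := Hbad _ d0.
  have key u : 0 < `|u| -> D x u <= 0 ->
      `|u^-1 * (h (x + u *: e0) - h x) - sl x| <= eps.
    move=> u0; rewrite /D put_shift subr_le0 => Hu.
    have un0 : u != 0 by rewrite -normr_gt0.
    have -> : u^-1 * (h (x + u *: e0) - h x) - sl x =
      u^-1 * (h (x + u *: e0) - h x - u * sl x) by field.
    by rewrite normrM normfV mulrC ler_pdivrMr.
  have [lt1|ge1] := ltP 0 (D x t); first by exists t.
  have [lt2|ge2] := ltP 0 (D x t'); first by exists t'.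
  exfalso; move: H; apply/negP; rewrite -leNgt.
  rewrite (_ : _ - _ = (t^-1 * (h (x + t *: e0) - h x) - sl x) -
     (t'^-1 * (h (x + t' *: e0) - h x) - sl x)); last by ring.
  rewrite (le_trans (ler_normB _ _)) //.
  by have := key _ t0 ge1; have := key _ t'0 ge2; lra.
pose K := L + `|sl x| + eps.
have K0 : 0 < K by rewrite /K ltr_wpDl // addr_ge0 // ltW.
have [|z [M Hz]] := @dyadic_dense t (Num.min (d - `|t|) (D x t / K)).
  by rewrite lt_min subr_gt0 td divr_gt0.
set t' := z%:~R / 2 ^+ M in Hz; move: Hz; rewrite lt_min => /andP[Hz1 Hz2].
have t'd : `|t'| < d.
  have := ler_normB t (t - t'); rewrite opprB addrC subrK => /le_lt_trans; apply.
  by rewrite -ltrBrDl.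
have Dt' : 0 < D x t'.
  suff : D x t - D x t' <= K * `|t - t'|.
    by move: Hz2; rewrite ltr_pdivlMr // mulrC; lra.
  rewrite /D /K.
  set A := h (put i0 x (x 0 i0 + t)); set A' := h (put i0 x (x 0 i0 + t')).
  have HA : `|A - A'| <= L * `|t - t'|.
    apply: (le_trans (hL _ _)); rewrite ler_pM2l //.
    apply: (le_trans (norm_put_sub _ _ _ _)); rewrite opprD addrACA subrr add0r //.
  have h1 : `|A - h x - t * sl x| - `|A' - h x - t' * sl x| <=
     `|A - A'| + `|t - t'| * `|sl x|.
    apply: (le_trans (lerB_dist _ _)); rewrite -normrM.
    rewrite (_ : _ - _ = (A - A') - (t - t') * sl x); last by ring.
    exact: ler_normB.
  have h2 : `|t'| - `|t| <= `|t - t'| by rewrite distrC lerB_dist.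
  have h3 : eps * (`|t'| - `|t|) <= eps * `|t - t'| by rewrite ler_pM2l.
  lra.
(* Lipschitz constant of [D] in the point for the fixed step [t'], just as [K] was its Lipschitz
   constant in the step; the chord slope contributes the factor [2 ^+ k]. *)
pose K2 := 2 * L + `|t'| * (2 ^+ k * (2 * L)).
have K20 : 0 < K2 by rewrite /K2 ltr_wpDr ?mulr_ge0 ?mulr_gt0 ?(ltW k2) ?(ltW L0).
pose r := Num.min (d - `|t'|) (Num.min d (D x t' / K2)).
have r0 : 0 < r by rewrite lt_min subr_gt0 t'd lt_min d0 divr_gt0.
have [T HT] := exp2_inv_lt r0.
have [w wx] := in_cube_ex T Hx; exists T, w; split => //.
exists c, M, z; split => // y wy; rewrite /deviates -/t' -/a -/b.
have xy : `|x - y| < r.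
  apply: lt_trans HT; rewrite ltr_norm_rV ?invr_gt0 ?exprn_gt0 //; apply/forallP => l.
  rewrite !mxE ltr_distl; move: (forallP wx l) (forallP wy l).
  by rewrite -[(w l).+1%:R]natr1 mulrDl mul1r => /andP[a1 a2] /andP[b1 b2]; clear -a1 a2 b1 b2;
    apply/andP; split; lra.
move: xy; rewrite lt_min => /andP[xy1]; rewrite lt_min => /andP[xy2 xy3].
have := coord_le_norm (x - y) i0; rewrite !mxE => xyi.
have [dm1 dm2] : d <= x 0 i0 - a /\ d <= b - x 0 i0 by rewrite /d !ge_min !lexx orbT.
have := ler_norm t'; have := ler_norm (- t'); rewrite normrN => t1 t2.
have := ler_norm (x 0 i0 - y 0 i0); have := ler_norm (- (x 0 i0 - y 0 i0)).
rewrite normrN => n1 n2.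
split.
- by clear -xy2 dm1 dm2 xyi n1 n2; apply/andP; split; lra.
- by clear -xy1 dm1 dm2 xyi t1 t2 n1 n2; apply/andP; split; lra.
rewrite -subr_gt0 -/(sl y) -/(D y t').
suff : D x t' - D y t' <= K2 * `|x - y|.
  by move: xy3; rewrite ltr_pdivlMr // mulrC; clear; lra.
rewrite /D opprB addrA subrK.
set A := h (put i0 x _); set A' := h (put i0 y _).
have HA : `|A - A'| <= L * `|x - y|.
  apply: (le_trans (hL _ _)); rewrite ler_pM2l // (le_trans (norm_putB _ _ _ _)) //.
  by rewrite opprD addrACA subrr addr0 ge_max xyi lexx.
have Hput s : `|h (put i0 x s) - h (put i0 y s)| <= L * `|x - y|.
  apply: (le_trans (hL _ _)); rewrite ler_pM2l // (le_trans (norm_putB _ _ _ _)) //.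
  by rewrite subrr normr0 ge_max normr_ge0 lexx.
have Hsl : `|sl x - sl y| <= 2 ^+ k * (2 * L) * `|x - y|.
  rewrite /sl -mulrBr normrM gtr0_norm // -mulrA ler_pM2l //.
  rewrite (_ : _ - _ = (h (put i0 x b) - h (put i0 y b)) -
     (h (put i0 x a) - h (put i0 y a))); last by ring.
  by rewrite (le_trans (ler_normB _ _)) //; have := Hput a; have := Hput b; clear; lra.
apply: (le_trans (lerB_dist _ _)).
rewrite (_ : _ - _ = (A - A') - (h x - h y) - t' * (sl x - sl y)); last by ring.
rewrite (le_trans (ler_normB _ _)) // normrM.
have := ler_normB (A - A') (h x - h y); have := hL x y.
have : `|t'| * `|sl x - sl y| <= `|t'| * (2 ^+ k * (2 * L) * `|x - y|) by rewrite ler_wpM2l.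
rewrite /K2; clear -HA; lra.
Qed.

Lemma bad_quotient_null eps : 0 < eps -> cube_null (bad_quotient eps).
Proof.
move=> eps0; apply: cube_null_count => B B0.
(* With this [eta] the counting estimate bounds the volume of the bad cubes of each level by [B]. *)
have [|k Hk] := @grid_energy_stable R n i0 h L hL (eps ^+ 2 * B / 2).
  by rewrite divr_gt0 ?mulr_gt0 ?exprn_gt0.
pose P T (w : grid T) := `[< bad_cube i0 h k eps w >].
have [||I [c [r [r0 cov Hs]]]] := @dyadic_cover R n P B.
- move=> T w /asboolP[c [M [z [ck H]]]]; apply/asboolP; exists c, M, z; split => //.
  by move=> x /in_cube_parent/H.
- move=> T; have := @card_bad_cubes R n i0 h k eps _ T (@P T) (ltW eps0) Hk.
  have e2 : 0 < eps ^+ 2 by rewrite exprn_gt0.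
  move=> /(_ (fun w => @asboolW _)); rewrite mulrCA mulfV ?mulr1 ?pnatr_eq0 //.
  by rewrite ler_pM2l.
exists I, c, r; split => // x /(bad_quotient_cube k eps0)[T [w [Hb Hw]]].
by apply: cov; exists T, w; split => //; apply/asboolP.
Qed.

Lemma unit_cube_derivable_null : cube_null [set x : V | [/\
  forall l, 0 < x 0 l < 1, forall c k : nat, x 0 i0 != c%:R / 2 ^+ k &
  ~ derivable h x e0]].
Proof.
apply: (@cube_null_sub _ _ _ (\bigcup_q bad_quotient q.+1%:R^-1)); last first.
  by apply: cube_null_bigcup => q; apply: bad_quotient_null; rewrite invr_gt0.
move=> x [Hx nd Nd]; apply: contrapT => NB; apply: Nd.
apply: derivable_cauchy => eps eps0.
have [q Hq] : exists q : nat, 2 * q.+1%:R^-1 < eps.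
  exists (Num.trunc (2 / eps)); rewrite ltr_pdivrMr // mulrC -ltr_pdivrMr //.
  by rewrite -truncn_lt_nat // divr_ge0 // ltW.
have [d Hd] : exists d : R, ~ (0 < d -> exists t t', [/\ 0 < `|t| < d, 0 < `|t'| < d &
    2 * q.+1%:R^-1 < `|t^-1 * (h (x + t *: e0) - h x) - t'^-1 * (h (x + t' *: e0) - h x)|]).
  by apply/existsNP => H; apply: NB; exists q.
have /not_implyP[d0 Hd'] := Hd.
exists d => // t t' td t'd; apply: le_lt_trans Hq; rewrite leNgt; apply/negP => H.
by apply: Hd'; exists t, t'.
Qed.

End UnitCubeDerivative.

(** * Arbitrary directions in the whole space *)

Section DirectionalDerivative.
Context {R : realType} {n : nat}.
Local Notation V := 'rV[R]_n.+1.
Implicit Types (x y u : V) (h : V -> R).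

(** Otherwise [3] would divide a power of [2]. Two positions a third apart are thus never both
    dyadic. *)
Lemma third_not_dyadic (c k c' k' : nat) :
  c%:R / 2 ^+ k - c'%:R / 2 ^+ k' <> 3^-1 :> R.
Proof.
move=> H; have k2 : 2 ^+ k != 0 :> R by rewrite expf_neq0 // pnatr_eq0.
have k'2 : 2 ^+ k' != 0 :> R by rewrite expf_neq0 // pnatr_eq0.
have E : (c * 2 ^ k' * 3)%N = (2 ^ (k + k') + c' * 2 ^ k * 3)%N.
  apply/eqP; rewrite -(eqr_nat R) natrD !natrM !natrX exprD; apply/eqP.
  have -> : c%:R = (3^-1 + c'%:R / 2 ^+ k') * 2 ^+ k :> R by rewrite -H subrK mulfVK.
  by field.
have : (3 %| 2 ^ (k + k'))%N.
  by rewrite -(dvdn_addl _ (dvdn_mull (c' * 2 ^ k) (dvdnn 3))) -E dvdn_mull.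
by rewrite Euclid_dvdX.
Qed.

Lemma derivable_scaled h x u (a : R) : a != 0 ->
  derivable h x (a *: u) -> derivable h x u.
Proof.
move=> a0 dh; suff : is_derive x u h (a^-1 * 'D_(a *: u) h x) by case.
apply: is_derive_eps => eps eps0.
have an0 : 0 < `|a| by rewrite normr_gt0.
have [|d d0 Hd] := derivable_eps dh (_ : 0 < eps * `|a|); first by rewrite mulr_gt0.
exists (d * `|a|); first by rewrite mulr_gt0.
move=> t td; have := Hd (t / a); rewrite normrM normfV ltr_pdivrMr // => /(_ td).
rewrite scalerA mulfVK //.
rewrite (_ : eps * `|a| * (`|t| / `|a|) = eps * `|t|); last by field; exact: lt0r_neq0.
by rewrite /GRing.scale /= mulrA.
Qed.

Lemma cube_null0 : cube_null (set0 : set V).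
Proof.
move=> eps eps0; exists (fun=> 0), (fun=> 0); split => // N.
by rewrite big1 ?ltW // => k' _; rewrite expr0n.
Qed.

(** The linear map [A] sends [e0] to [u] and is invertible because [u 0 i0] is nonzero; [B] maps the
    unit cube onto a large cube. Derivability along [u] is pulled back to a coordinate direction in
    the unit cube, and the exceptional sets are pushed forward by Lipschitz maps. *)
Lemma derivable_null h (L : R) u : 0 < L ->
  (forall x y, `|h x - h y| <= L * `|x - y|) ->
  cube_null [set x | ~ derivable h x u].
Proof.
move=> L0 hL; have [->|/rV0Pn[i0 u0]] := eqVneq u 0.
  by apply: cube_null_sub cube_null0 => x; apply; exact: derivable0.
pose e0 : V := delta_mx 0 i0; pose C := 1 + `|u - e0|.
have C0 : 0 < C by rewrite ltr_wpDr.
pose A y : V := y + y 0 i0 *: (u - e0).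
have AB y z : A y - A z = A (y - z).
  by rewrite /A !mxE opprD addrACA scalerBl.
have An y : `|A y| <= C * `|y|.
  rewrite /C mulrDl mul1r (le_trans (ler_normD _ _)) // lerD2l normrZ mulrC.
  by rewrite ler_wpM2l // coord_le_norm.
pose K (p : nat * bool) : R := p.1.+1%:R.
have K0 p : 0 < K p by rewrite ltr0n.
(* Shifting by a third of the cube moves a point off the dyadic hyperplanes. *)
pose sg (p : nat * bool) : R := p.2%:R * (2 * K p / 3).
pose B p z : V := 2 * K p *: z - const_mx (K p) + sg p *: e0.
pose Phi p z := A (B p z).
have BB p z z' : B p z - B p z' = 2 * K p *: (z - z').
  by rewrite /B opprD addrACA subrr addr0 opprB addrA subrK scalerBr.
have Phin p z z' : `|Phi p z - Phi p z'| <= C * (2 * K p) * `|z - z'|.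
  rewrite /Phi AB BB (le_trans (An _)) // normrZ gtr0_norm ?mulr_gt0 //.
  by rewrite mulrA.
have Ae s : A (s *: e0) = s *: u.
  by rewrite /A !mxE !eqxx /= mulr1 -scalerDr addrC subrK.
have Phie p z t : Phi p (z + t *: e0) = Phi p z + t *: ((2 * K p) *: u).
  rewrite -[LHS](subrK (Phi p z)) [RHS]addrC; congr (_ + _).
  rewrite /Phi AB BB [z + _ - z]addrAC subrr add0r.
  by rewrite [_ *: (t *: e0)]scalerA Ae scalerA [t * _]mulrC.
pose N p := [set z : V | [/\
  forall l, 0 < z 0 l < 1, forall c k : nat, z 0 i0 != c%:R / 2 ^+ k &
  ~ derivable (h \o Phi p) z e0]].
have NN p : cube_null (N p).
  apply: (@unit_cube_derivable_null _ _ i0 _ (L * (C * (2 * K p)))).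
    by rewrite !mulr_gt0.
  move=> y z; rewrite -mulrA /= (le_trans (hL _ _)) // ler_pM2l //.
apply: (@cube_null_sub _ _ _ (\bigcup_p (Phi p @` N p))); last first.
  apply: cube_null_bigcup_count => p.
  apply: (@cube_null_lipschitz _ _ _ _ (C * (2 * K p))) => //; first by rewrite !mulr_gt0.
move=> x /= Nx; pose y : V := x - (x 0 i0 / u 0 i0) *: (u - e0).
have Ay : A y = x.
  rewrite /A {1}/y; have -> : y 0 i0 = x 0 i0 / u 0 i0.
    by rewrite !mxE !eqxx /=; field.
  by rewrite subrK.
(* The factor [3] keeps the rescaled coordinates of [y] in the middle third of the unit interval, so
   that subtracting a third does not leave it. *)
pose q := Num.trunc (3 * `|y|).
have Kq (b : bool) : 3 * `|y| < K (q, b) by rewrite /K -truncn_lt_nat // mulr_ge0.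
pose zz b : V := (2 * K (q, b))^-1 *: (y + const_mx (K (q, b)) - sg (q, b) *: e0).
have Bz b : B (q, b) (zz b) = y.
  rewrite /B /zz scalerA mulfV ?scale1r ?lt0r_neq0 ?mulr_gt0 //.
  by rewrite addrAC -[_ - sg _ *: _ + _]addrA addNr addr0 addrK.
have zz01 b l : 0 < zz b 0 l < 1.
  have := coord_le_norm y l; rewrite ler_norml => /andP[y1 y2].
  have Kb := Kq b; have K0b := K0 (q, b); have n0 := normr_ge0 y.
  have s1 : 0 <= sg (q, b) * (e0 : V) 0 l <= 2 * K (q, b) / 3.
    rewrite /sg mxE eqxx /=; case: b Kb K0b => /= Kb K0b; case: (l == i0) => /=;
    rewrite ?mul1r ?mul0r ?mulr1 ?mulr0; lra.
  move: s1 => /andP[s1 s2].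
  have -> : zz b 0 l = (y 0 l + K (q, b) - sg (q, b) * e0 0 l) / (2 * K (q, b)).
    by rewrite /zz [LHS]mxE mulrC !mxE.
  by rewrite divr_gt0 ?mulr_gt0 ?ltr_pdivrMr ?mulr_gt0 // ?mul1r; lra.
have notd b : zz b 0 i0 = (y 0 i0 + K (q, b)) / (2 * K (q, b)) - b%:R / 3.
  have -> : zz b 0 i0 = (2 * K (q, b))^-1 * (y 0 i0 + K (q, b) - sg (q, b)).
    by rewrite /zz !mxE !eqxx mulr1.
  rewrite /sg /=; have := lt0r_neq0 (K0 (q, b)).
  by move: (K (q, b)) (y 0 i0) (b%:R : R) => k y0 b' k0; field.
have [b nd] : exists b, forall c k : nat, zz b 0 i0 != c%:R / 2 ^+ k.
  apply: contrapT => H.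
  have H' b : exists c k : nat, zz b 0 i0 = c%:R / 2 ^+ k.
    apply: contrapT => H'; apply: H; exists b => c k; apply/eqP => E.
    by apply: H'; exists c, k.
  have [c [k E]] := H' false; have [c' [k' E']] := H' true.
  apply: (@third_not_dyadic c k c' k'); rewrite -E -E' !notd mul0r subr0 mul1r.
  by rewrite opprB addrC subrK.
exists (q, b) => //; exists (zz b); last by rewrite /Phi Bz.
split; [exact: zz01|exact: nd|move=> dh; apply: Nx].
apply: (@derivable_scaled _ _ _ (2 * K (q, b))); first by rewrite lt0r_neq0 ?mulr_gt0.
suff : is_derive x (2 * K (q, b) *: u) h ('D_e0 (h \o Phi (q, b)) (zz b)) by case.
apply: is_derive_eps => eps eps0; have [d d0 Hd] := derivable_eps dh eps0.
exists d => // t td; have := Hd _ td; rewrite /= Phie.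
by rewrite {1 2}/Phi Bz Ay.
Qed.

End DirectionalDerivative.

(** * Rademacher's theorem *)

Section Rademacher.
Context {R : realType} {n : nat}.
Local Notation V := 'rV[R]_n.+1.
Implicit Types (x y z u v : V) (h : V -> R).

Definition distset (A : set V) x : R := inf [set `|x - z| | z in A].

Lemma distset_lb (A : set V) x : has_lbound [set `|x - z| | z in A].
Proof. by exists 0 => _ [z _ <-]. Qed.

Lemma distset_ge0 (A : set V) x : A !=set0 -> 0 <= distset A x.
Proof.
move=> [a Aa]; apply: lb_le_inf; first by exists `|x - a|, a.
by move=> _ [z _ <-].
Qed.

Lemma distset_le (A : set V) x z : A z -> distset A x <= `|x - z|.
Proof. by move=> Az; apply: ge_inf; [exact: distset_lb|exists z]. Qed.

Lemma distset_lt (A : set V) x (r : R) : A !=set0 -> distset A x < r ->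
  exists2 z, A z & `|x - z| < r.
Proof.
move=> [a Aa] /inf_lt[|_ [z Az <-] zr]; first by exists `|x - a|, a.
by exists z.
Qed.

Lemma distset_lipschitz (A : set V) x y : `|distset A x - distset A y| <= 1 * `|x - y|.
Proof.
rewrite mul1r; have [[a Aa]|/nonemptyPn ->] := pselect (A !=set0); last first.
  by rewrite /distset !image_set0 subrr normr0.
have A0 : A !=set0 by exists a.
have H x' y' : distset A x' - distset A y' <= `|x' - y'|.
  rewrite lerBlDr -lerBlDl; apply: lb_le_inf; first by exists `|y' - a|, a.
  move=> _ [z Az <-]; rewrite lerBlDl.
  apply: (le_trans (distset_le _ Az)); exact: ler_distD.
by rewrite ler_norml H andbT lerNl opprB distrC H.
Qed.

Lemma rat_approx (a eps : R) : 0 < eps -> exists q : rat, `|a - ratr q| <= eps.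
Proof.
move=> eps0; have [|q] := @rat_in_itvoo R (a - eps) (a + eps).
  by rewrite ltrD2l gt0_cp.
rewrite in_itv /= => /andP[q1 q2]; exists q.
by rewrite ler_distl; apply/andP; split; lra.
Qed.

Lemma inv_nat_lt (eps : R) : 0 < eps -> exists k : nat, k.+1%:R^-1 < eps.
Proof.
move=> eps0; exists (Num.trunc eps^-1).
by rewrite invf_plt ?posrE // -truncn_lt_nat // invr_ge0 ltW.
Qed.

(* Preiss-Zajicek: failure of additivity at a point of a set [A] where the
   difference quotients are uniformly close to [a] and [b] forces holes of [A]
   in the direction [u], which is excluded wherever the distance to [A] is
   differentiable along [u]. *)
Lemma derive_additive_null h (L : R) u v : 0 < L ->
  (forall x y, `|h x - h y| <= L * `|x - y|) ->
  cube_null [set x | derivable h x u /\ derivable h x v /\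
    ~ is_derive x (u + v) h ('D_u h x + 'D_v h x)].
Proof.
move=> L0 hL.
pose A (p : rat * rat * nat * nat) := [set x | forall t : R, `|t| < p.2.+1%:R^-1 ->
   `|h (x + t *: u) - h x - t * ratr p.1.1.1| <= p.1.2.+1%:R^-1 * `|t| /\
   `|h (x + t *: v) - h x - t * ratr p.1.1.2| <= p.1.2.+1%:R^-1 * `|t|].
apply: (@cube_null_sub _ _ _ (\bigcup_p [set x | ~ derivable (distset (A p)) x u])); last first.
  apply: cube_null_bigcup_count => p; apply: (@derivable_null _ _ _ 1) => //.
  exact: distset_lipschitz.
move=> x /= [du [dv Nd]]; apply: contrapT => Hx; apply: Nd.
have {}Hx p : derivable (distset (A p)) x u.
  by apply: contrapT => N; apply: Hx; exists p.
(* In units of [e1 * |t|]: two passages between [x + t u] and a nearby point of [A p] cost [3 * L]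
   each, while the increment along [u], the increment along [v] and the rational approximation of
   the slopes cost [1] each. *)
apply: is_derive_eps => eps eps0; pose K := 6 * L + 3.
have K0 : 0 < K by rewrite /K addr_gt0 // mulr_gt0.
have [|k Hk] := @inv_nat_lt (eps / K); first by rewrite divr_gt0.
set e1 := k.+1%:R^-1 in Hk; have e10 : 0 < e1 by rewrite invr_gt0.
have e20 : 0 < e1 / 2 by rewrite divr_gt0.
have [a Ha] := rat_approx ('D_u h x) e20; have [b Hb] := rat_approx ('D_v h x) e20.
have [d1 d10 Hd1] := derivable_eps du e20; have [d2 d20 Hd2] := derivable_eps dv e20.
have [|m] := @inv_nat_lt (Num.min d1 d2); first by rewrite lt_min d10.
rewrite lt_min => /andP[md1 md2].
pose p := (a, b, k, m).
have Ax : A p x.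
  move=> t /= tm; split.
  - have := Hd1 t (lt_trans tm md1); rewrite /GRing.scale /= => H.
    rewrite (_ : _ - _ = (h (x + t *: u) - h x - t * 'D_u h x) +
      t * ('D_u h x - ratr a)); last by ring.
    rewrite (le_trans (ler_normD _ _)) // normrM.
    by have := ler_wpM2l (normr_ge0 t) Ha; rewrite -/e1; lra.
  - have := Hd2 t (lt_trans tm md2); rewrite /GRing.scale /= => H.
    rewrite (_ : _ - _ = (h (x + t *: v) - h x - t * 'D_v h x) +
      t * ('D_v h x - ratr b)); last by ring.
    rewrite (le_trans (ler_normD _ _)) // normrM.
    by have := ler_wpM2l (normr_ge0 t) Hb; rewrite -/e1; lra.
have A0 : A p !=set0 by exists x.
have [d3 d30 Hd3] := derivable_eps (Hx p) e10.
have m0 : 0 < m.+1%:R^-1 :> R by rewrite invr_gt0.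
exists (Num.min d3 m.+1%:R^-1); first by rewrite lt_min d30.
move=> t; rewrite lt_min => /andP[td3 tm].
have [->|t0] := eqVneq t 0.
  by rewrite !scale0r addr0 subrr subr0 !normr0 mulr0.
have t0' : 0 < `|t| by rewrite normr_gt0.
have dx0 : distset (A p) x = 0.
  apply/eqP; rewrite eq_le distset_ge0 // andbT.
  by have := distset_le x Ax; rewrite subrr normr0.
(* The distance is nonnegative and vanishes at [x]: adding its expansions at [t] and [- t] cancels
   the linear term, so [A p] comes close to [x + t u]. *)
have dt : distset (A p) (x + t *: u) < 3 * e1 * `|t|.
  have := Hd3 _ td3; have := Hd3 (- t); rewrite normrN => /(_ td3).
  rewrite dx0 !subr0 /GRing.scale /= => /ler_normlP[_ H1] /ler_normlP[_ H2].
  have := distset_ge0 (x + - t *: u) A0.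
  have : 0 < e1 * `|t| by rewrite mulr_gt0.
  by clear -H1 H2; lra.
have [z Az Hz] := distset_lt A0 dt.
have [_ Hzv] := Az t tm; have [Hxu _] := Ax t tm.
rewrite /= -/e1 in Hzv Hxu.
have h1 := hL (x + t *: (u + v)) (z + t *: v).
rewrite scalerDr addrA opprD addrACA subrr addr0 in h1.
have h2 := hL z (x + t *: u); rewrite distrC in h2.
have h3 : L * `|x + t *: u - z| <= L * (3 * e1 * `|t|) by rewrite ler_pM2l // ltW.
rewrite scalerDr addrA /GRing.scale /=.
rewrite (_ : _ - _ = (h (x + t *: u + t *: v) - h (z + t *: v)) +
  (h (z + t *: v) - h z - t * ratr b) + (h z - h (x + t *: u)) +
  (h (x + t *: u) - h x - t * ratr a) -
  t * (('D_u h x - ratr a) + ('D_v h x - ratr b))); last by ring.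
apply: (@le_trans _ _ (K * e1 * `|t|)); last first.
  by rewrite ler_pM2r // -ler_pdivlMl // mulrC ltW.
rewrite (le_trans (ler_normB _ _)) // normrM.
have h4 : `|t| * `|'D_u h x - ratr a + ('D_v h x - ratr b)| <= `|t| * e1.
  by rewrite ler_wpM2l // (le_trans (ler_normD _ _)) //; clear -Ha Hb; lra.
apply: (@le_trans _ _ (L * (3 * e1 * `|t|) + e1 * `|t| + L * (3 * e1 * `|t|) +
  e1 * `|t| + `|t| * e1)); last first.
  by rewrite /K le_eqVlt; apply/orP; left; apply/eqP; ring.
have h5 : `|h z - h (x + t *: u)| <= L * (3 * e1 * `|t|).
  by rewrite (le_trans _ h3) // distrC.
have h6 := le_trans h1 h3.
apply: lerD => //.
by do 3![apply: (le_trans (ler_normD _ _)); apply: lerD => //].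
Qed.

Lemma is_derive_scaled h x u (a : R) : derivable h x u ->
  is_derive x (a *: u) h (a * 'D_u h x).
Proof.
move=> du; have [->|a0] := eqVneq a 0.
  by rewrite scale0r mul0r; apply: is_derive0.
apply: is_derive_eps => eps eps0; have an0 : 0 < `|a| by rewrite normr_gt0.
have [|d d0 Hd] := derivable_eps du (_ : 0 < eps / `|a|); first by rewrite divr_gt0.
exists (d / `|a|); first by rewrite divr_gt0.
move=> t; rewrite ltr_pdivlMr // -normrM => /Hd.
rewrite scalerA (_ : eps / `|a| * `|t * a| = eps * `|t|); last first.
  by rewrite normrM; field; exact: lt0r_neq0.
by rewrite /GRing.scale /= mulrA.
Qed.

Definition rat_row (q : 'rV[rat]_n.+1) : V := map_mx ratr q.

Lemma rat_row0 : rat_row 0 = 0.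
Proof. exact: map_mx0. Qed.

Lemma rat_rowD q q' : rat_row (q + q') = rat_row q + rat_row q'.
Proof. exact: map_mxD. Qed.

Lemma rat_rowZ a q : rat_row (a *: q) = ratr a *: rat_row q.
Proof. exact: map_mxZ. Qed.

Lemma rat_row_delta i : rat_row (delta_mx 0 i) = delta_mx 0 i.
Proof. exact: map_delta_mx. Qed.

(* Lipschitz continuity makes the convergence of the difference quotients uniform
   over all directions once it holds along a finite net of rational ones. *)
Lemma rational_differentiable h (L : R) x : 0 < L ->
  (forall x y, `|h x - h y| <= L * `|x - y|) ->
  (forall q, derivable h x (rat_row q)) ->
  (forall q q', is_derive x (rat_row q + rat_row q') h
     ('D_(rat_row q) h x + 'D_(rat_row q') h x)) ->
  differentiable h x.
Proof.
move=> L0 hL dq addq.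
pose D i := 'D_(delta_mx 0 i) h x : R.
pose l (w : V) : R := \sum_i w 0 i * D i.
have l_lin : linear l.
  move=> a w w'; rewrite /l scaler_sumr -big_split /=; apply: eq_bigr => i _.
  by rewrite !mxE mulrDl -mulrA.
pose lL : {linear V -> R} := HB.pack l (GRing.isLinear.Build _ _ _ _ l l_lin).
pose C : R := \sum_i `|D i|.
have C0 : 0 <= C by apply: sumr_ge0.
have lC w : `|l w| <= C * `|w|.
  rewrite /l /C mulr_suml (le_trans (ler_norm_sum _ _ _)) //; apply: ler_sum => i _.
  by rewrite normrM mulrC ler_wpM2l // coord_le_norm.
(* Additivity along rational directions identifies the derivative along each of them with the linear
   form built from the partial derivatives. *)
have lq q : is_derive x (rat_row q) h (l (rat_row q)).
  rewrite (row_sum_delta q).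
  elim/big_ind : _ => [|q1 q2 H1 H2|i _].
  - by rewrite rat_row0 -[l 0]/(lL 0) linear0; exact: is_derive0.
  - rewrite rat_rowD -[l _]/(lL _) linearD /=.
    by have := addq q1 q2; rewrite (derive_val (is_derive := H1)) (derive_val (is_derive := H2)).
  - rewrite rat_rowZ rat_row_delta -[l _]/(lL _) linearZ /=.
    have -> : l (delta_mx 0 i) = D i.
      rewrite /l (bigD1 i) //= big1 ?addr0 ?mxE ?eqxx ?mul1r // => j /negbTE ji.
      by rewrite mxE ji andbF mul0r.
    by apply: is_derive_scaled; rewrite -rat_row_delta.
suff [] : differentiable h x /\ 'd h x = lL :> (V -> R) by [].
apply: eps_differentiable.
  by exists (C + 1) => [|w]; rewrite ?ltr_wpDl // (le_trans (lC w)) // ler_wpM2r // lerDl.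
(* In units of [N^-1], rounding the direction to the net costs [L] in [h] and [C] in the linear
   form, and the expansion along the net direction costs [1]. *)
move=> eps eps0; pose K := L + C + 1.
have K0 : 0 < K by rewrite /K; lra.
have [|N0 HN] := @inv_nat_lt (eps / K); first by rewrite divr_gt0.
set N := N0.+1 in HN; have N0' : 0 < N%:R :> R by rewrite ltr0n.
pose q (g : {ffun 'I_n.+1 -> 'I_(2 * N).+1}) : 'rV[rat]_n.+1 :=
  \row_i ((g i)%:R / N%:R - 1).
have iN0 : 0 < N%:R^-1 :> R by rewrite invr_gt0.
have Hg g : exists d : R, 0 < d /\ forall t, `|t| < d ->
    `|h (x + t *: rat_row (q g)) - h x - t * l (rat_row (q g))| <= N%:R^-1 * `|t|.
  have [d d0 Hd] := derivable_eps (dq (q g)) iN0.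
  by exists d; split => // t /Hd; rewrite (derive_val (is_derive := lq (q g))).
have [d Hd] := choice Hg.
exists (\big[Num.min/1]_g d g); first by apply: lt_bigmin => // g _; have [] := Hd g.
move=> w wd; have [->|w0] := eqVneq w 0.
  by rewrite addr0 linear0 !subrr !normr0 mulr0.
have t0 : 0 < `|w| by rewrite normr_gt0.
set t := `|w| in wd t0 *; pose w1 := t^-1 *: w.
have w1E : w = t *: w1 by rewrite /w1 scalerA mulfV ?scale1r ?lt0r_neq0.
have w11 i : `|w1 0 i| <= 1.
  by rewrite (le_trans (coord_le_norm _ _)) // normrZ normfV  -/t (ger0_norm (ltW t0)) mulVf ?lt0r_neq0.
have Hj i : (Num.trunc ((w1 0%R i + 1) * N%:R)%R < (2 * N).+1)%N.
  have := w11 i; rewrite ler_norml => /andP[a b].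
  have p0 : 0 <= (w1 0 i + 1) * N%:R by apply: mulr_ge0; [lra|exact: ltW].
  rewrite ltnS -(ler_nat R); apply: (@le_trans _ _ ((w1 0 i + 1) * N%:R)).
    by rewrite truncn_le.
  by rewrite natrM ler_pM2r //; lra.
pose g := [ffun i => Ordinal (Hj i)].
have Hqg : `|w1 - rat_row (q g)| <= N%:R^-1.
  rewrite ler_norm_rV ?ltW //; apply/forallP => i; rewrite !mxE ffunE /=.
  have := w11 i; rewrite ler_norml => /andP[a b].
  have p0 : 0 <= (w1 0 i + 1) * N%:R by apply: mulr_ge0; [lra|exact: ltW].
  rewrite rmorphB rmorph1 fmorph_div /= !rmorph_nat.
  set j := Num.trunc _.
  have j1 : j%:R <= (w1 0 i + 1) * N%:R by rewrite truncn_le.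
  have j2 : (w1 0 i + 1) * N%:R < j%:R + 1 by rewrite natr1 -truncn_lt_nat.
  have E1 : w1 0 i = t^-1 * w 0 i by rewrite mxE.
  rewrite -E1.
  have -> : w1 0 i - (j%:R / N%:R - 1) = ((w1 0 i + 1) * N%:R - j%:R) / N%:R.
    by field; exact: lt0r_neq0.
  by rewrite ger0_norm ?divr_ge0 ?subr_ge0 ?(ltW N0') // ler_pdivrMr // mulVf ?lt0r_neq0 //; lra.
have tdg : t < d g by apply: (lt_le_trans wd); exact: bigmin_le.
have [_ /(_ t)] := Hd g; rewrite ger0_norm ?(ltW t0) // => /(_ tdg).
set qq := rat_row (q g) in Hqg * => Hq.
have E : `|x + w - (x + t *: qq)| = t * `|w1 - qq|.
  by rewrite opprD addrACA subrr add0r w1E -scalerBr normrZ ger0_norm // ltW.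
have h1 : `|h (x + w) - h (x + t *: qq)| <= t * (L * N%:R^-1).
  by rewrite (le_trans (hL _ _)) // E mulrCA ler_pM2l // ler_pM2l.
have h2 : `|t * l qq - l w| <= t * (C * N%:R^-1).
  rewrite -[l w]/(lL w) {1}w1E linearZ /= /GRing.scale /= -[l w1]/(lL w1).
  rewrite -mulrBr -[l qq]/(lL qq) -linearB normrM ger0_norm ?(ltW t0) // ler_pM2l //.
  by rewrite (le_trans (lC _)) // ler_wpM2l // distrC.
rewrite (_ : _ - _ - _ = (h (x + w) - h (x + t *: qq)) +
  (h (x + t *: qq) - h x - t * l qq) + (t * l qq - l w)); last by rewrite /=; ring.
apply: (@le_trans _ _ (K * N%:R^-1 * t)); last first.
  by rewrite ler_pM2r // -ler_pdivlMl // mulrC ltW.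
apply: (le_trans (ler_normD _ _)).
have := ler_normD (h (x + w) - h (x + t *: qq)) (h (x + t *: qq) - h x - t * l qq).
rewrite /K; lra.
Qed.

Lemma rademacher_global h (L : R) : 0 < L ->
  (forall x y, `|h x - h y| <= L * `|x - y|) ->
  cube_null [set x | ~ differentiable h x].
Proof.
move=> L0 hL.
apply: (@cube_null_sub _ _ _ ((\bigcup_q [set x | ~ derivable h x (rat_row q)]) `|`
  \bigcup_(p : 'rV[rat]_n.+1 * 'rV[rat]_n.+1) [set x |
    derivable h x (rat_row p.1) /\ derivable h x (rat_row p.2) /\
    ~ is_derive x (rat_row p.1 + rat_row p.2) h
        ('D_(rat_row p.1) h x + 'D_(rat_row p.2) h x)])); last first.
  apply: cube_nullU; apply: cube_null_bigcup_count.
    by move=> q; exact: derivable_null L0 hL.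
  by move=> p; exact: derive_additive_null L0 hL.
move=> x Nd; apply: contrapT => Hx; apply: Nd.
have dq q : derivable h x (rat_row q).
  by apply: contrapT => N; apply: Hx; left; exists q.
apply: (rational_differentiable L0 hL) => // q q'.
by apply: contrapT => N; apply: Hx; right; exists (q, q').
Qed.

Lemma differentiable_near_eq (W : normedModType R) (f g : V -> W) x :
  (\forall y \near x, f y = g y) -> differentiable f x ->
  differentiable g x /\ 'd g x = 'd f x :> (V -> W).
Proof.
move=> /nbhs_ballP[r /= r0 Hr] df.
apply: eps_differentiable; first exact: linear_lipschitz (diff_continuous df).
move=> eps eps0; have [d d0 Hd] := differentiable_eps df eps0.
exists (Num.min d r); first by rewrite lt_min d0.
move=> w; rewrite lt_min => /andP[/Hd H wr].
rewrite -!Hr //; first exact: ballxx.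
by rewrite -ball_normE /= opprD addrA subrr sub0r normrN.
Qed.

(* The function is truncated by a cone supported in the ball to make it
   globally Lipschitz. *)
Lemma rademacher h (L r : R) x0 : 0 < L -> 0 < r ->
  (forall x y, ball x0 r x -> ball x0 r y -> `|h x - h y| <= L * `|x - y|) ->
  cube_null [set x | ball x0 (r / 2) x /\ ~ differentiable h x].
Proof.
move=> L0 r0 hL.
pose b x := L * (r - `|x - x0|).
have bL x y : `|b x - b y| <= L * `|x - y|.
  rewrite /b -mulrBr normrM gtr0_norm // ler_pM2l //.
  rewrite (_ : _ - _ = `|y - x0| - `|x - x0|); last by ring.
  rewrite (le_trans (ler_dist_dist _ _)) // distrC.
  by rewrite opprB addrA subrK.
pose k x := Num.max (- b x) (Num.min (b x) (h x - h x0)).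
pose hh x := if `|x - x0| < r then k x else 0.
have inb x : ball x0 r x = (`|x - x0| < r) :> Prop by rewrite -ball_normE /= distrC.
have b0 x : `|x - x0| < r -> 0 < b x by move=> xr; rewrite mulr_gt0 // subr_gt0.
have kb x : `|x - x0| < r -> `|k x| <= b x.
  move=> /b0 bx; rewrite ler_norml /k le_max lexx /= ge_max ge_min lexx /= andbT.
  by lra.
have maxL (a a' c c' e : R) : `|a - a'| <= e -> `|c - c'| <= e ->
    `|Num.max a c - Num.max a' c'| <= e.
  rewrite !ler_distl => /andP[h1 h2] /andP[h3 h4]; clear -h1 h2 h3 h4.
  by case: (leP a c) => ?; case: (leP a' c') => ?; apply/andP; split; lra.
have minL (a a' c c' e : R) : `|a - a'| <= e -> `|c - c'| <= e ->
    `|Num.min a c - Num.min a' c'| <= e.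
  rewrite !ler_distl => /andP[h1 h2] /andP[h3 h4]; clear -h1 h2 h3 h4.
  by case: (leP a c) => ?; case: (leP a' c') => ?; apply/andP; split; lra.
have out x y : `|x - x0| < r -> ~~ (`|y - x0| < r) -> `|k x| <= L * `|x - y|.
  rewrite -leNgt => xr yr; rewrite (le_trans (kb _ xr)) // /b ler_pM2l //.
  have := ler_distD x y x0; rewrite (distrC y x); lra.
have hhL x y : `|hh x - hh y| <= L * `|x - y|.
  rewrite /hh; case: ifPn => xr; case: ifPn => yr.
  - apply: maxL; first by rewrite -opprD normrN bL.
    apply: minL => //; rewrite opprB addrA subrK.
    by apply: hL; rewrite inb.
  - by rewrite subr0; exact: out.
  - by rewrite sub0r normrN distrC; exact: out.
  - by rewrite subrr normr0 mulr_ge0 // ltW.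
have := rademacher_global L0 hhL; apply: cube_null_sub => x [xr Nd] dh.
apply: Nd.
have dh1 : differentiable (hh + cst (h x0)) x by exact: differentiableD.
suff E : \forall y \near x, (hh + cst (h x0)) y = h y by have [] := differentiable_near_eq E dh1.
have : nbhs x (ball x0 (r / 2)) by apply: open_nbhs_nbhs; split => //; exact: ball_open.
apply: filterS => y; rewrite -ball_normE /= distrC => yr.
have yr' : `|y - x0| < r by lra.
(* On the half ball the cone is at least [L * r / 2], which dominates the increment of [h], so the
   truncation is inactive there. *)
have hb : `|h y - h x0| <= b y.
  rewrite (le_trans (hL _ _ _ _)) ?inb // ?subrr ?normr0 // /b ler_pM2l //; lra.
move: hb; rewrite ler_norml => /andP[hb1 hb2].
rewrite !fctE /hh yr' /k (min_idPr hb2) (max_idPr hb1); ring.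
Qed.

End Rademacher.

(** * Gradients and second-order expansions *)

Section Lines.
Context {R : realType} {n : nat}.
Local Notation V := 'rV[R]_n.+1.
Implicit Types (x y z u v w : V) (g : V -> R).

Lemma dotvC x y : dotv x y = dotv y x.
Proof. by apply: eq_bigr => i _; rewrite mulrC. Qed.

Lemma dotvDl x y z : dotv (x + y) z = dotv x z + dotv y z.
Proof. by rewrite /dotv -big_split; apply: eq_bigr => i _; rewrite mxE mulrDl. Qed.

Lemma dotvZl a x z : dotv (a *: x) z = a * dotv x z.
Proof. by rewrite /dotv mulr_sumr; apply: eq_bigr => i _; rewrite mxE mulrA. Qed.

Lemma dotvBl x y z : dotv (x - y) z = dotv x z - dotv y z.
Proof. by rewrite dotvDl -scaleN1r dotvZl mulN1r. Qed.

Lemma dotvZr a x z : dotv x (a *: z) = a * dotv x z.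
Proof. by rewrite dotvC dotvZl dotvC. Qed.

Lemma dotv_ge0 x : 0 <= dotv x x.
Proof. by apply: sumr_ge0 => i _; rewrite -expr2 sqr_ge0. Qed.

Lemma dotv_gt0 x : x != 0 -> 0 < dotv x x.
Proof.
move=> /rV0Pn[i xi]; rewrite /dotv (bigD1 i) //= ltr_wpDr //.
  by apply: sumr_ge0 => j _; rewrite -expr2 sqr_ge0.
by rewrite -expr2 exprn_even_gt0.
Qed.

Lemma dotv_norm_le x y : `|dotv x y| <= n.+1%:R * `|x| * `|y|.
Proof.
rewrite /dotv (le_trans (ler_norm_sum _ _ _)) // -mulrA mulr_natl.
rewrite -[X in _ *+ X]card_ord -sumr_const; apply: ler_sum => i _.
by rewrite normrM ler_pM // coord_le_norm.
Qed.

Lemma dotv_delta x i : dotv x (delta_mx 0 i) = x 0 i.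
Proof.
rewrite /dotv (bigD1 i) //= big1 ?addr0 ?mxE ?eqxx ?mulr1 // => j /negbTE ji.
by rewrite mxE ji andbF mulr0.
Qed.

Lemma diff_grad g x v : differentiable g x -> 'd g x v = dotv (grad g x) v.
Proof.
move=> dg; rewrite [in LHS](row_sum_delta v) linear_sum /dotv.
by apply: eq_bigr => i _; rewrite linearZ /= mxE deriveE // mulrC.
Qed.

Lemma is_derive_line g x v (t : R) : differentiable g (x + t *: v) ->
  is_derive t (1 : R) (fun s : R => g (x + s *: v)) (dotv (grad g (x + t *: v)) v).
Proof.
move=> dg; apply: is_derive_eps => eps eps0.
have K0 : 0 < `|v| + 1 by rewrite ltr_wpDl.
have [|d d0 Hd] := differentiable_eps dg (_ : 0 < eps / (`|v| + 1)).
  by rewrite divr_gt0.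
exists (d / (`|v| + 1)); first by rewrite divr_gt0.
move=> s; rewrite ltr_pdivlMr // => sd.
have sv : `|s *: v| <= `|s| * (`|v| + 1) by rewrite normrZ ler_wpM2l // lerDl.
have := Hd (s *: v) (le_lt_trans sv sd).
rewrite linearZ diff_grad //= (_ : s *: (1 : R) = s); last exact: mulr1.
rewrite scalerDl addrA => /le_trans; apply.
have -> : eps * `|s| = eps / (`|v| + 1) * (`|s| * (`|v| + 1)).
  by field; exact: lt0r_neq0.
by rewrite ler_pM2l ?divr_gt0.
Qed.

Lemma pos_lt_both (d d' : R) : 0 < d -> 0 < d' -> exists s, [/\ 0 < s, s < d & s < d'].
Proof.
move=> d0 d'0; exists (Num.min d d' / 2); have m0 : 0 < Num.min d d' by rewrite lt_min d0.
have m1 : Num.min d d' <= d by rewrite ge_min lexx.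
have m2 : Num.min d d' <= d' by rewrite ge_min lexx orbT.
by split; lra.
Qed.

Lemma local_min_derive0 (phi : R -> R) (a d : R) : 0 < d ->
  (forall t, `|t| < d -> phi 0 <= phi t) -> is_derive (0 : R) (1 : R) phi a -> a = 0.
Proof.
move=> d0 Hmin [dphi Da]; apply/eqP; rewrite -normr_le0; apply/ler_addgt0Pl => eps eps0.
have [d' d'0 Hd'] := derivable_eps dphi eps0; rewrite addr0.
have [s [s0 sd1 sd2]] := pos_lt_both d0 d'0.
have H1 := Hd' s; have H2 := Hd' (- s); have M1 := Hmin s; have M2 := Hmin (- s).
rewrite normrN in M2, H2; rewrite (gtr0_norm s0) in M1, M2, H1, H2.
have {}M1 := M1 sd1; have {}M2 := M2 sd1.
have := H1 sd2; have := H2 sd2.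
rewrite Da /GRing.scale /= !mulr1 !add0r.
move=> /ler_normlP[_ h1] /ler_normlP[_ h2]; rewrite ler_norml.
by apply/andP; split; rewrite -(ler_pM2l s0); lra.
Qed.

(** Only the derivative is expanded at [0], so the mean value theorem does the work: if [Q < 0], the
    slope is negative at all small positive points and [phi] falls below [phi 0]. *)
Lemma local_min_second (phi a : R -> R) (Q d : R) : 0 < d ->
  (forall t, `|t| < d -> phi 0 <= phi t) ->
  (forall t, `|t| < d -> is_derive t (1 : R) phi (a t)) ->
  (forall eps, 0 < eps -> exists2 d', 0 < d' &
     forall t, `|t| < d' -> `|a t - t * Q| <= eps * `|t|) -> 0 <= Q.
Proof.
move=> d0 Hmin Hd Ha; rewrite leNgt; apply/negP => Q0.
have [|d' d'0 Hd'] := Ha (- Q / 2); first by rewrite divr_gt0 // oppr_gt0.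
have [s [s0 sd1 sd2]] := pos_lt_both d0 d'0.
have [||c /[!in_itv]/=/andP[c0 cs] Hc] := @MVT R phi a 0 s s0.
- move=> t; rewrite in_itv /= => /andP[t0 ts]; apply: Hd.
  by rewrite gtr0_norm //; lra.
- apply: derivable_within_continuous => t; rewrite in_itv /= => /andP[t0 ts].
  have td : `|t| < d by rewrite ger0_norm //; lra.
  by have [] := Hd t td.
have := Hd' c; rewrite gtr0_norm // => /(_ (lt_trans cs sd2)) /ler_normlP[_ h].
have := Hmin s; rewrite gtr0_norm // => /(_ sd1).
rewrite -subr_ge0 Hc subr0 pmulr_lge0 // => ac.
have : 0 < c * - Q by rewrite mulr_gt0 // oppr_gt0.
lra.
Qed.

End Lines.

(** * Functions with Lipschitz gradient on a ball *)

Section C11.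
Context {R : realType} {n : nat}.
Local Notation V := 'rV[R]_n.+1.
Implicit Types (x y z u v w : V).

Lemma differentiable_rV m (G : V -> 'rV[R]_m) x :
  (forall i, differentiable (fun y => G y 0 i : R) x) -> differentiable G x.
Proof.
move=> dG.
have -> : G = \sum_(i < m) (fun y => G y 0 i *: (delta_mx 0 i : 'rV[R]_m)).
  by apply/funext => y; rewrite fct_sumE [LHS]row_sum_delta.
by apply: differentiable_sum => i; exact: differentiableZl.
Qed.

Lemma ball_not_null z0 (d : R) : 0 < d -> ~ cube_null (ball z0 d).
Proof.
move=> d0 HN.
apply: (@unit_cube_not_null R n).
pose phi (z : V) := (2 / d) *: (z - z0).
have d20 : 0 < 2 / d by rewrite divr_gt0.
apply: (@cube_null_sub _ _ _ (phi @` ball z0 d)); last first.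
  apply: (cube_null_lipschitz d20) => // x y _ _; rewrite /phi -scalerBr normrZ gtr0_norm //.
  by rewrite opprB addrA subrK.
move=> x Hx; exists (z0 + (d / 2) *: x).
  rewrite -ball_normE /= opprD addrA subrr sub0r normrN normrZ gtr0_norm ?divr_gt0 //.
  have : `|x| <= 1.
    by rewrite ler_norm_rV //; apply/forallP => i; have /andP[a b] := Hx i; rewrite ger0_norm.
  by have := normr_ge0 x; nra.
rewrite /phi addrAC subrr add0r scalerA (_ : 2 / d * (d / 2) = 1) ?scale1r //.
by field; exact: lt0r_neq0.
Qed.

Context (g : V -> R) (x0 : V) (rho L : R) (rho0 : 0 < rho) (L0 : 0 < L).
Context (dg : forall x, ball x0 rho x -> differentiable g x).
Context (gL : forall x y, ball x0 rho x -> ball x0 rho y ->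
  `|grad g x - grad g y| <= L * `|x - y|).

Lemma twice_differentiable_null :
  cube_null [set x | ball x0 (rho / 2) x /\ ~ twice_differentiable g x].
Proof.
apply: (@cube_null_sub _ _ _ (\bigcup_i
  [set x | ball x0 (rho / 2) x /\ ~ differentiable (fun y => grad g y 0 i : R) x])).
  move=> x [xr Nd]; apply: contrapT => H; apply: Nd; split.
    have : nbhs x (ball x0 rho).
      apply: open_nbhs_nbhs; split; first exact: ball_open.
      have h : rho / 2 <= rho by have := rho0; lra.
      exact: (le_ball h).
    by apply: filterS.
  apply: differentiable_rV => i; apply: contrapT => Ndi; apply: H; exists i => //.
apply: cube_null_bigcup_count => i; apply: (rademacher L0 rho0) => x y xr yr.
apply: le_trans (gL xr yr); have := coord_le_norm (grad g x - grad g y) i.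
by rewrite !mxE.
Qed.

Lemma contact_twice_differentiable (P : set V) (Psi : V -> V) (K d : R) z0 :
  0 < K -> 0 < d -> P `<=` ball x0 (rho / 2) ->
  (forall x y, P x -> P y -> `|Psi x - Psi y| <= K * `|x - y|) ->
  ball z0 d `<=` Psi @` P ->
  exists x, P x /\ twice_differentiable g x.
Proof.
move=> K0 d0 Pball PsiK sur; apply: contrapT => H.
apply: (@ball_not_null z0 d d0); apply: (cube_null_sub sur).
apply: (cube_null_lipschitz K0) => //; apply: cube_null_sub twice_differentiable_null.
by move=> x Px; split; [exact: Pball|move=> tx; apply: H; exists x].
Qed.

Lemma ball_segment x y (t : R) : ball x0 rho x -> ball x0 rho y -> 0 <= t <= 1 ->
  ball x0 rho (y + t *: (x - y)).
Proof.
rewrite -!ball_normE /= => xr yr /andP[t0 t1].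
have -> : x0 - (y + t *: (x - y)) = t *: (x0 - x) + (1 - t) *: (x0 - y).
  by apply/rowP => i; rewrite !mxE; ring.
rewrite (le_lt_trans (ler_normD _ _)) // !normrZ (ger0_norm t0) ger0_norm ?subr_ge0 //.
have [->|tn0] := eqVneq t 0; first by rewrite mul0r add0r subr0 mul1r.
have : t * `|x0 - x| < t * rho by rewrite ltr_pM2l // lt_neqAle eq_sym tn0.
have : (1 - t) * `|x0 - y| <= (1 - t) * rho by rewrite ler_wpM2l ?subr_ge0 // ltW.
lra.
Qed.

Lemma C11_lipschitz : exists2 C : R, 0 < C & forall x y,
  ball x0 rho x -> ball x0 rho y -> `|g x - g y| <= C * `|x - y|.
Proof.
pose B := `|grad g x0| + L * rho.
have Bb x : ball x0 rho x -> `|grad g x| <= B.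
  move=> xr; have := gL xr (ballxx x0 rho0).
  have := lerB_dist (grad g x) (grad g x0).
  have : L * `|x - x0| <= L * rho.
    by rewrite ler_pM2l // distrC ltW //; move: xr; rewrite -ball_normE.
  rewrite /B; lra.
have B0 : 0 <= B by rewrite addr_ge0 // mulr_ge0 // ltW.
exists (n.+1%:R * B + 1); first by rewrite ltr_wpDl // mulr_ge0.
move=> x y xr yr.
have Hd (t : R) : 0 <= t <= 1 -> is_derive t (1 : R) (fun s : R => g (y + s *: (x - y)))
    (dotv (grad g (y + t *: (x - y))) (x - y)).
  by move=> t01; apply: is_derive_line; apply: dg; exact: ball_segment.
have [||c] := @MVT R (fun s : R => g (y + s *: (x - y)))
  (fun t => dotv (grad g (y + t *: (x - y))) (x - y)) 0 1 ltr01.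
- by move=> t; rewrite in_itv /= => /andP[a b]; apply: Hd; rewrite !ltW.
- apply: derivable_within_continuous => t; rewrite in_itv /= => t01.
  by have [] := Hd t t01.
rewrite in_itv /= => /andP[c0 c1].
rewrite /= scale1r scale0r addr0 [y + (x - y)]addrC subrK subr0 mulr1 => ->.
rewrite (le_trans (dotv_norm_le _ _)) // ler_wpM2r // ler_wpDr //.
by rewrite ler_wpM2l //; apply: Bb; apply: ball_segment => //; rewrite !ltW.
Qed.

Lemma hessian_expansion x v (eps : R) : twice_differentiable g x -> 0 < eps ->
  exists2 d : R, 0 < d & forall t, `|t| < d ->
    `|dotv (grad g (x + t *: v)) v - dotv (grad g x) v - t * quad (hessian g x) v|
      <= eps * `|t|.
Proof.
move=> [_ dG] eps0; pose K := n.+1%:R * (`|v| + 1) * (`|v| + 1).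
have v10 : 0 < `|v| + 1 by rewrite ltr_wpDl.
have K0 : 0 < K by rewrite !mulr_gt0.
have [|d d0 Hd] := differentiable_eps dG (_ : 0 < eps / K); first by rewrite divr_gt0.
exists (d / (`|v| + 1)); first by rewrite divr_gt0.
move=> t; rewrite ltr_pdivlMr // => td.
have tv : `|t *: v| <= `|t| * (`|v| + 1) by rewrite normrZ ler_wpM2l // lerDl.
have := Hd (t *: v) (le_lt_trans tv td); rewrite linearZ /= => H.
(* A quadratic form does not see transposition: exchanging the two sums reconciles [quad] with the
   row-vector convention [v *m hessian g x]. *)
have Eq : quad (hessian g x) v = dotv ('d (grad g) x v) v.
  have -> : 'd (grad g) x v = v *m hessian g x by rewrite /hessian /jacobian mul_rV_lin1.
  rewrite /quad /dotv.
  under eq_bigr do rewrite !mxE mulr_suml; rewrite exchange_big /=.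
  apply: eq_bigr => i _; rewrite [in RHS]mxE mulr_suml; apply: eq_bigr => j _.
  by rewrite mxE; ring.
rewrite Eq -dotvZl -!dotvBl (le_trans (dotv_norm_le _ _)) //.
have h1 : n.+1%:R * `|v| * (eps / K * `|t *: v|) <= eps * `|t|.
  have -> : eps * `|t| = n.+1%:R * (`|v| + 1) * (eps / K * (`|t| * (`|v| + 1))).
    rewrite /K; field; rewrite (lt0r_neq0 v10) /=.
    by rewrite addrC natr1 pnatr_eq0.
  apply: ler_pM.
  - by rewrite mulr_ge0.
  - by rewrite mulr_ge0 // divr_ge0 ?(ltW eps0) ?(ltW K0).
  - by rewrite ler_wpM2l // lerDl.
  - by rewrite ler_wpM2l // divr_ge0 ?(ltW eps0) ?(ltW K0).
by apply: le_trans h1; rewrite mulrAC ler_wpM2l // mulr_ge0.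
Qed.

(** Supplies compactness for limits of Hessians: a row of the Hessian is the derivative of the
    gradient along a coordinate vector. *)
Lemma hessian_bound x : ball x0 rho x -> twice_differentiable g x ->
  `|hessian g x| <= L.
Proof.
move=> xr [_ dG]; apply/ler_addgt0Pl => eps eps0.
rewrite /Num.norm /= mx_normrE; apply/bigmax_leP; split.
  by rewrite addr_ge0 // ltW.
move=> [i j] _ /=.
have -> : hessian g x i j = ('d (grad g) x (delta_mx 0 i)) 0 j.
  have -> : 'd (grad g) x (delta_mx 0 i) = delta_mx 0 i *m hessian g x.
    by rewrite /hessian /jacobian mul_rV_lin1.
  by rewrite -rowE [RHS]mxE.
set e := delta_mx 0 i; apply: le_trans (coord_le_norm _ _) _.
have [d d0 Hd] := differentiable_eps dG eps0.
have : nbhs x (ball x0 rho).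
  by apply: open_nbhs_nbhs; split => //; exact: ball_open.
move=> /nbhs_ballP[d' /= d'0 Hd'].
have e1 : `|e| <= 1.
  rewrite ler_norm_rV //; apply/forallP => k; rewrite mxE.
  by case: (_ && _); rewrite ?normr0 ?normr1.
have [s [s0 sd1 sd2]] := pos_lt_both d0 d'0.
have se : `|s *: e| <= s by rewrite normrZ (gtr0_norm s0) ler_piMr // ltW.
have := Hd (s *: e) (le_lt_trans se sd1); rewrite linearZ /= => H1.
have sball : ball x0 rho (x + s *: e).
  apply: Hd'; rewrite -ball_normE /= opprD addrA subrr sub0r normrN.
  exact: le_lt_trans se sd2.
have H2 := gL sball xr; rewrite addrAC subrr add0r in H2.
rewrite -(ler_pM2l s0) -[in leLHS](gtr0_norm s0) -normrZ.
rewrite -[s *: _](subrK (grad g (x + s *: e) - grad g x)) (le_trans (ler_normD _ _)) //.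
rewrite distrC.
have h3 : eps * `|s *: e| <= eps * s by rewrite ler_pM2l.
have h4 : L * `|s *: e| <= L * s by rewrite ler_pM2l.
by lra.
Qed.

End C11.

(** * Jensen's lemma *)

Section Jensen.
Context {R : realType} {n : nat}.
Local Notation V := 'rV[R]_n.+1.
Implicit Types (x y z u v w : V).
Context (g : V -> R) (x0 : V) (rho L : R) (rho0 : 0 < rho) (L0 : 0 < L).
Context (dg : forall x, ball x0 rho x -> differentiable g x).
Context (gL : forall x y, ball x0 rho x -> ball x0 rho y ->
  `|grad g x - grad g y| <= L * `|x - y|).
Context (S : {set 'I_n.+1}).

(** The coordinates of [z] in [S] are the tilt; the others will be the offset of [slice]. *)
Definition tilted (kappa : R) z x : R :=
  g x + kappa / 2 * (\sum_(i in S) (x 0 i - x0 0 i) ^+ 2) -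
  \sum_(i in S) z 0 i * (x 0 i - x0 0 i).

Definition slice (r : R) z : set V := [set x |
  `|x - x0| <= r /\ forall i, i \notin S -> x 0 i = x0 0 i + z 0 i].

Definition tilted_slope (kappa : R) z x v : R :=
  dotv (grad g x) v + kappa * (\sum_(i in S) (x 0 i - x0 0 i) * v 0 i) -
  \sum_(i in S) z 0 i * v 0 i.

Lemma is_derive_tilted kappa z x v (t : R) : ball x0 rho (x + t *: v) ->
  is_derive t (1 : R) (fun s : R => tilted kappa z (x + s *: v))
    (tilted_slope kappa z (x + t *: v) v).
Proof.
move=> xb.
have H := is_derive_line (dg xb).
pose A := \sum_(i in S) (x 0 i - x0 0 i) ^+ 2.
pose B := \sum_(i in S) (x 0 i - x0 0 i) * v 0 i.
pose C := \sum_(i in S) v 0 i ^+ 2.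
pose D := \sum_(i in S) z 0 i * (x 0 i - x0 0 i).
pose E := \sum_(i in S) z 0 i * v 0 i.
have Ef : (fun s : R => tilted kappa z (x + s *: v)) = (fun s : R => g (x + s *: v)) +
   (fun s : R => kappa / 2 * (A + 2 * B * s + C * s ^+ 2) - (D + E * s)).
  apply/funext => s; rewrite /tilted !fctE -addrA; congr (_ + _).
  rewrite /A /B /C /D /E; congr (_ * _ - _).
    rewrite mulr_sumr !mulr_suml -!big_split /=; apply: eq_bigr => i _.
    by rewrite !mxE; ring.
  rewrite mulr_suml -big_split /=; apply: eq_bigr => i _.
  by rewrite !mxE; ring.
rewrite Ef.
have -> : tilted_slope kappa z (x + t *: v) v =
    dotv (grad g (x + t *: v)) v + (kappa / 2 * (2 * B + C * (2 * t)) - E).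
  rewrite /tilted_slope -addrA; congr (_ + (_ - _)).
  rewrite /B /C mulrDr [in RHS]mulrA.
  have -> : \sum_(i in S) ((x + t *: v) 0 i - x0 0 i) * v 0 i = B + C * t.
    rewrite /B /C mulr_suml -big_split /=; apply: eq_bigr => i _.
    by rewrite !mxE; ring.
  by rewrite -/B -/C; field.
apply: is_deriveD.
apply: is_derive_eps => eps eps0.
pose K := `|kappa / 2 * C| + 1.
have K0 : 0 < K by rewrite /K ltr_wpDl.
exists (eps / K); first by rewrite divr_gt0.
move=> s; rewrite ltr_pdivlMr // => sK.
rewrite (_ : s *: (1 : R) = s); last exact: mulr1.
rewrite (_ : _ - _ = kappa / 2 * C * s * s); last by rewrite /GRing.scale /=; ring.
rewrite normrM ler_wpM2r // normrM; apply: le_trans (ltW sK).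
by rewrite mulrC ler_wpM2l // lerDl.
Qed.

Lemma slice_compact (r : R) z : 0 <= r -> `|z| <= r -> compact (slice r z).
Proof.
move=> r0 zr.
pose a i := if i \in S then x0 0 i - r else x0 0 i + z 0 i.
pose b i := if i \in S then x0 0 i + r else x0 0 i + z 0 i.
have := @rV_compact R n.+1 (fun i => `[a i, b i]%classic)
  (fun i => @segment_compact R (a i) (b i)).
congr compact; apply/seteqP; split => x /=.
  move=> H; split.
    rewrite ler_norm_rV //; apply/forallP => i; rewrite !mxE ler_distl.
    have := H i; rewrite in_itv /= /a /b; case: (i \in S) => [//|/andP[a1 a2]].
    have := coord_le_norm z i; rewrite ler_norml => /andP[b1 b2].
    by apply/andP; split; lra.
  move=> i iS; have := H i; rewrite in_itv /= /a /b (negbTE iS) => /andP[h1 h2].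
  by apply/eqP; rewrite eq_le h1 h2.
move=> [xr xS] i; rewrite in_itv /= /a /b; case: ifPn => iS.
  by have := coord_le_norm (x - x0) i; rewrite !mxE -ler_distl; move/le_trans; apply.
by rewrite xS // lexx.
Qed.

Lemma continuous_tilted kappa z x : ball x0 rho x ->
  {for x, continuous (tilted kappa z)}.
Proof.
move=> xb; have cg := differentiable_continuous (dg xb).
have cc i : (y 0 i : R) @[y --> x] --> x 0 i by exact: coord_continuous.
have cB i : (y 0 i - x0 0 i : R) @[y --> x] --> x 0 i - x0 0 i.
  by apply: cvgB => //; exact: cvg_cst.
have c2 : (\sum_(i in S) (y 0 i - x0 0 i) ^+ 2 : R) @[y --> x] -->
    \sum_(i in S) (x 0 i - x0 0 i) ^+ 2.
  apply: cvg_big => [|i _]; first exact: add_continuous.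
  by rewrite expr2; under eq_cvg do rewrite expr2; apply: cvgM.
have c3 : (\sum_(i in S) z 0 i * (y 0 i - x0 0 i) : R) @[y --> x] -->
    \sum_(i in S) z 0 i * (x 0 i - x0 0 i).
  apply: cvg_big => [|i _]; first exact: add_continuous.
  by apply: cvgM => //; exact: cvg_cst.
exact: cvgB (cvgD cg (cvgM (cvg_cst (kappa / 2)) c2)) c3.
Qed.

(* Jensen's lemma: the points where some slightly tilted perturbation is minimal
   on its slice are mapped by [Psi] onto a ball, hence do not form a null set. *)
Lemma jensen (kappa : R) : 0 < kappa ->
  (forall x, ball x0 rho x -> (forall i, i \notin S -> x 0 i = x0 0 i) -> g x0 <= g x) ->
  exists x, [/\ ball x0 rho x, twice_differentiable g x &
    forall v, (forall i, i \notin S -> v 0 i = 0) ->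
      0 <= quad (hessian g x) v + kappa * dotv v v].
Proof.
move=> kappa0 Hmin; pose r := rho / 4.
have r0 : 0 < r by rewrite divr_gt0.
have [C C0 HC] := C11_lipschitz rho0 L0 dg gL.
(* A minimizer on the boundary in a direction of [S], compared with the point [p] below, would give
   [kappa * r ^+ 2 / 2 <= d * M]; [d] makes the right side at most half of the left. *)
pose M := 2 * C + n.+1%:R * r + 1.
have M0 : 0 < M by rewrite /M ltr_wpDl // addr_ge0 ?mulr_ge0 // ltW.
pose d := Num.min r (kappa * r ^+ 2 / (4 * M)).
have d0 : 0 < d by rewrite lt_min r0 divr_gt0 ?mulr_gt0 ?exprn_gt0.
have dr : d <= r by rewrite /d ge_min lexx.
have dM : d * M <= kappa * r ^+ 2 / 4.
  have h : d <= kappa * r ^+ 2 / (4 * M) by rewrite /d ge_min lexx orbT.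
  apply: (le_trans (ler_wpM2r (ltW M0) h)).
  by rewrite le_eqVlt; apply/orP; left; apply/eqP; field; exact: lt0r_neq0.
have rball x : `|x - x0| <= r -> ball x0 (rho / 2) x.
  move=> xr; rewrite -ball_normE /= distrC (le_lt_trans xr) // /r.
  by have := rho0; lra.
have rball' x : `|x - x0| <= r -> ball x0 rho x.
  move=> /rball; have h : rho / 2 <= rho by have := rho0; lra.
  exact: (le_ball h).
pose P := [set x | exists z, `|z| < d /\ slice r z x /\
  (forall i, i \in S -> `|x 0 i - x0 0 i| < r) /\
  forall y, slice r z y -> tilted kappa z x <= tilted kappa z y].
(* Vanishing slope on [S] and the slice equation off [S] say exactly that [Psi] returns the
   parameter [z] from the minimizer. *)
pose Psi x : V := \row_i (if i \in S then grad g x 0 i + kappa * (x 0 i - x0 0 i)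
  else x 0 i - x0 0 i).
have lmin z x v : `|z| < d -> slice r z x ->
    (forall i, i \in S -> `|x 0 i - x0 0 i| < r) ->
    (forall y, slice r z y -> tilted kappa z x <= tilted kappa z y) ->
    (forall i, i \notin S -> v 0 i = 0) ->
    exists2 e : R, 0 < e & forall t, `|t| < e -> slice r z (x + t *: v) /\
      ball x0 rho (x + t *: v).
  move=> zd [xr xS] xint xmin vS.
  have [e e0 He] : exists2 e : R, 0 < e & forall i, i \in S -> `|x 0 i - x0 0 i| + e <= r.
    exists (\big[Num.min/1]_(i in S) (r - `|x 0 i - x0 0 i|)).
      by apply: lt_bigmin => // i iS; rewrite subr_gt0 xint.
    move=> i iS; rewrite -lerBrDl; exact: bigmin_le_cond.
  have v10 : 0 < `|v| + 1 by rewrite ltr_wpDl.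
  exists (e / (`|v| + 1)); first by rewrite divr_gt0.
  move=> t; rewrite ltr_pdivlMr // => te.
  have sl : slice r z (x + t *: v).
    split; last by move=> i iS; rewrite !mxE vS // mulr0 addr0 xS.
    rewrite ler_norm_rV ?(ltW r0) //; apply/forallP => i; rewrite !mxE.
    have [iS|iS] := boolP (i \in S); last first.
      rewrite vS // mulr0 addr0; have := coord_le_norm (x - x0) i; rewrite !mxE.
      by move/le_trans; apply.
    rewrite addrAC (le_trans (ler_normD _ _)) // (le_trans _ (He i iS)) // lerD2l.
    rewrite (le_trans _ (ltW te)) // normrM ler_wpM2l //.
    by rewrite (le_trans (coord_le_norm v i)) // lerDl.
  by split => //; apply: rball'; case: sl.
have slope0 z x v : `|z| < d -> slice r z x ->
    (forall i, i \in S -> `|x 0 i - x0 0 i| < r) ->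
    (forall y, slice r z y -> tilted kappa z x <= tilted kappa z y) ->
    (forall i, i \notin S -> v 0 i = 0) -> tilted_slope kappa z x v = 0.
  move=> zd xsl xint xmin vS; have [e e0 He] := lmin z x v zd xsl xint xmin vS.
  apply: (@local_min_derive0 R (fun t => tilted kappa z (x + t *: v)) _ e e0).
    by move=> t te; rewrite scale0r addr0; apply: xmin; have [] := He t te.
  have := @is_derive_tilted kappa z x v 0; rewrite scale0r addr0; apply.
  by apply: rball'; case: xsl.
have sur : ball 0 d `<=` Psi @` P.
  move=> z; rewrite -ball_normE /= sub0r normrN => zd.
  have zr : `|z| <= r by rewrite (le_trans (ltW zd)).
  pose p : V := \row_i (if i \in S then x0 0 i else x0 0 i + z 0 i).
  have px0 : `|p - x0| <= `|z|.
    rewrite ler_norm_rV //; apply/forallP => i; rewrite !mxE; case: (i \in S).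
      by rewrite subrr normr0.
    by rewrite addrAC subrr add0r coord_le_norm.
  have psl : slice r z p.
    split; first exact: le_trans zr.
    by move=> i /negbTE iS; rewrite mxE iS.
  have [|||x /set_mem xsl xmin'] := @EVT_min_rV R n.+1 (tilted kappa z) (slice r z).
  - by exists p.
  - by apply: slice_compact => //; exact: ltW.
  - apply: continuous_in_subspaceT => y /set_mem[yr _].
    by apply: continuous_tilted; exact: rball'.
  have xmin y : slice r z y -> tilted kappa z x <= tilted kappa z y.
    by move=> ysl; apply: xmin'; exact/mem_set.
  have [xr xS] := xsl.
  have xi i : `|x 0 i - x0 0 i| <= r.
    by have := coord_le_norm (x - x0) i; rewrite !mxE => /le_trans; apply.
  have xint i : i \in S -> `|x 0 i - x0 0 i| < r.
    move=> iS; rewrite lt_neqAle xi andbT; apply/eqP => Er.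
    have := xmin p psl; rewrite /tilted.
    have -> : \sum_(j in S) (p 0 j - x0 0 j) ^+ 2 = 0.
      by rewrite big1 // => j jS; rewrite mxE jS subrr expr0n.
    have -> : \sum_(j in S) z 0 j * (p 0 j - x0 0 j) = 0.
      by rewrite big1 // => j jS; rewrite mxE jS subrr mulr0.
    rewrite mulr0 addr0 subr0.
    (* The hypothesis compares [x0] only with points of its own slice, so the coordinates of [x] off
       [S] are reset first, at cost [C * |z|]. *)
    pose x' : V := \row_j (if j \in S then x 0 j else x0 0 j).
    have xx' : `|x - x'| <= `|z|.
      rewrite ler_norm_rV //; apply/forallP => j; rewrite !mxE; case: ifPn => jS.
        by rewrite subrr normr0.
      by rewrite xS // addrAC subrr add0r coord_le_norm.
    have x'r : `|x' - x0| <= r.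
      rewrite ler_norm_rV ?(ltW r0) //; apply/forallP => j; rewrite !mxE; case: ifPn => jS.
        exact: xi.
      by rewrite subrr normr0 ltW.
    have gx' : g x0 <= g x'.
      by apply: Hmin; [exact: rball'|move=> j /negbTE jS; rewrite mxE jS].
    have h1 := HC _ _ (rball' _ xr) (rball' _ x'r).
    have pr : `|p - x0| <= r by exact: le_trans zr.
    have h2 := HC _ _ (rball' _ pr) (ballxx x0 rho0).
    have h3 : C * `|x - x'| <= C * `|z| by rewrite ler_pM2l.
    have h4 : C * `|p - x0| <= C * `|z| by rewrite ler_pM2l.
    have h5 : C * `|z| <= C * d by rewrite ler_pM2l // ltW.
    have h6 : r ^+ 2 <= \sum_(j in S) (x 0 j - x0 0 j) ^+ 2.
      rewrite (bigD1 i) //= -[(x 0 i - x0 0 i) ^+ 2]real_normK ?num_real // Er lerDl.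
      by apply: sumr_ge0 => j _; exact: sqr_ge0.
    have h7 : \sum_(j in S) z 0 j * (x 0 j - x0 0 j) <= n.+1%:R * r * d.
      apply: (@le_trans _ _ (\sum_(j in S) d * r)).
        apply: ler_sum => j _; rewrite (le_trans (ler_norm _)) // normrM ler_pM //.
        by rewrite (le_trans (coord_le_norm z j)) // ltW.
      rewrite sumr_const -[leLHS]mulr_natl [d * r]mulrC mulrA.
      rewrite ler_pM2r // ler_pM2r // ler_nat.
      by rewrite -[X in (_ <= X)%N]card_ord max_card.
    have h8 : kappa / 2 * r ^+ 2 <= kappa / 2 * (\sum_(j in S) (x 0 j - x0 0 j) ^+ 2).
      by rewrite ler_pM2l // divr_gt0.
    have h9 : 0 < kappa * r ^+ 2 by rewrite mulr_gt0 ?exprn_gt0.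
    move: h1 h2 => /ler_normlP[h1 _] /ler_normlP[_ h2].
    move=> h0; have h10 := d0; have := dM; rewrite /M => h11.
    clear -h0 h1 h2 h3 h4 h5 h7 h8 h9 h10 h11 gx'.
    lra.
  exists x; first by exists z.
  apply/rowP => i; rewrite mxE; case: ifPn => iS; last first.
    by rewrite xS // addrAC subrr add0r.
  have := slope0 z x (delta_mx 0 i) zd xsl xint xmin.
  have vS j : j \notin S -> (delta_mx 0 i : V) 0 j = 0.
    by rewrite mxE andTb; case: (eqVneq j i) => // ->; rewrite iS.
  move=> /(_ vS); rewrite /tilted_slope dotv_delta.
  have E (F : 'I_n.+1 -> R) : \sum_(j in S) F j * (delta_mx 0 i : V) 0 j = F i.
    rewrite (bigD1 i) //= big1 ?addr0 ?mxE ?eqxx ?mulr1 // => j /andP[_ /negbTE ji].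
    by rewrite mxE ji mulr0.
  by rewrite !E => /eqP; rewrite subr_eq0 => /eqP.
have PsiK x y : P x -> P y -> `|Psi x - Psi y| <= (L + kappa + 1) * `|x - y|.
  move=> [z [_ [[xr _] _]]] [z' [_ [[yr _] _]]].
  have xyn := normr_ge0 (x - y).
  rewrite ler_norm_rV ?mulr_ge0 ?addr_ge0 ?(ltW L0) ?(ltW kappa0) //.
  apply/forallP => i; have xyi : `|x 0 i - y 0 i| <= `|x - y|.
    by have := coord_le_norm (x - y) i; rewrite !mxE.
  rewrite [(Psi x - Psi y) 0 i]mxE [(- Psi y) 0 i]mxE [Psi x 0 i]mxE [Psi y 0 i]mxE.
  case: ifPn => iS; last first.
    rewrite opprB addrA subrK (le_trans xyi) //.
    have := mulr_ge0 (ltW L0) xyn; have := mulr_ge0 (ltW kappa0) xyn; lra.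
  have := gL (rball' _ xr) (rball' _ yr).
  have := coord_le_norm (grad g x - grad g y) i; rewrite [X in `|X| <= _ -> _]mxE.
  rewrite [(- grad g y) 0 i]mxE => h1 h2.
  rewrite (_ : _ - _ = (grad g x 0 i - grad g y 0 i) + kappa * (x 0 i - y 0 i)); last by ring.
  rewrite (le_trans (ler_normD _ _)) // normrM (gtr0_norm kappa0).
  have : kappa * `|x 0 i - y 0 i| <= kappa * `|x - y| by rewrite ler_pM2l.
  lra.
have [||x [Px tx]] := @contact_twice_differentiable R n g x0 rho L rho0 L0 dg gL P Psi
  (L + kappa + 1) d 0 _ d0 _ PsiK sur.
- by rewrite !addr_gt0.
- by move=> x [z [_ [[xr _] _]]]; exact: rball.
have [z [zd [xsl [xint xmin]]]] := Px.
have xb : ball x0 rho x by apply: rball'; case: xsl.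
exists x; split => // v vS.
have [e e0 He] := lmin z x v zd xsl xint xmin vS.
apply: (@local_min_second R (fun t => tilted kappa z (x + t *: v))
  (fun t => tilted_slope kappa z (x + t *: v) v) _ e e0).
- by move=> t te; rewrite scale0r addr0; apply: xmin; have [] := He t te.
- by move=> t te; apply: is_derive_tilted; have [] := He t te.
move=> eps eps0; have [e' e'0 He'] := hessian_expansion v tx eps0.
exists e' => // t te; have := He' t te.
have s0 := slope0 z x v zd xsl xint xmin vS.
have Ed : dotv v v = \sum_(i in S) v 0 i * v 0 i.
  rewrite /dotv (bigID (fun i => i \in S)) /= [X in _ + X]big1 ?addr0 // => i iS.
  by rewrite vS // mulr0.
have Es : tilted_slope kappa z (x + t *: v) v = tilted_slope kappa z x v +
   (dotv (grad g (x + t *: v)) v - dotv (grad g x) v) + kappa * t * dotv v v.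
  rewrite /tilted_slope Ed.
  have -> : \sum_(i in S) ((x + t *: v) 0 i - x0 0 i) * v 0 i =
    \sum_(i in S) (x 0 i - x0 0 i) * v 0 i + t * \sum_(i in S) v 0 i * v 0 i.
    rewrite mulr_sumr -big_split /=; apply: eq_bigr => i _.
    by rewrite !mxE; ring.
  ring.
by rewrite Es s0 add0r (_ : _ - _ - _ =
   dotv (grad g (x + t *: v)) v - dotv (grad g x) v + kappa * t * dotv v v -
    t * (quad (hessian g x) v + kappa * dotv v v)) //; ring.
Qed.

End Jensen.

(** * Growth along parallel segments *)

Section Growth.
Context {R : realType} {n : nat}.
Local Notation V := 'rV[R]_n.+1.
Implicit Types (x y z u v w : V).

(** The supremum of the superlevel set. Taking the last point of the level, not just any, is what
    forces [phi] to drop immediately afterwards. *)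
Lemma last_level (phi : R -> R) (K mu : R) : 0 < K ->
  (forall s t, 0 <= s <= 1 -> 0 <= t <= 1 -> `|phi s - phi t| <= K * `|s - t|) ->
  mu <= phi 0 -> phi 1 < mu ->
  exists t, [/\ 0 <= t < 1, phi t = mu & forall s, t < s <= 1 -> phi s < mu].
Proof.
move=> K0 phiK mu0 mu1.
pose E := [set t : R | 0 <= t <= 1 /\ mu <= phi t].
have E0 : E 0 by split => //; rewrite lexx ler01.
have supE : has_sup E by split; [exists 0|exists 1 => t [/andP[]]].
pose t := sup E.
have t01 : 0 <= t <= 1.
  apply/andP; split; first exact: ub_le_sup supE.2 _ E0.
  by apply: ge_sup; [exists 0|move=> s [/andP[]]].
have after s : t < s <= 1 -> phi s < mu.
  move=> /andP[ts s1]; rewrite ltNge; apply/negP => ms.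
  have : s <= t.
    apply: ub_le_sup supE.2 _ _; split => //; rewrite s1 andbT.
    by case/andP: t01 => t0 _; lra.
  by rewrite leNgt ts.
have ge : mu <= phi t.
  rewrite leNgt; apply/negP => lt.
  have d0 : 0 < (mu - phi t) / K by rewrite divr_gt0 // subr_gt0.
  have [s [/andP[s0 s1] ms] st] := sup_adherent d0 supE.
  have sle : s <= t by apply: ub_le_sup supE.2 _ _; split => //; rewrite s0 s1.
  have s01 : 0 <= s <= 1 by rewrite s0 s1.
  have := phiK s t s01 t01; rewrite [`|s - t|]ler0_norm ?subr_le0 ?opprB // => /ler_normlP[_ h].
  have : K * (t - s) < mu - phi t by rewrite mulrC -ltr_pdivlMr //; move: st; rewrite -/t; lra.
  lra.
have tn1 : t < 1.
  rewrite lt_neqAle; case/andP: t01 => _ ->; rewrite andbT; apply/eqP => t1.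
  by move: ge; rewrite t1 leNgt mu1.
exists t; split => //; first by case/andP: t01 => -> _.
apply/eqP; rewrite eq_le ge andbT leNgt; apply/negP => gt.
pose s := Num.min 1 (t + (phi t - mu) / (2 * K)).
have e0 : 0 < (phi t - mu) / (2 * K) by rewrite divr_gt0 ?subr_gt0 ?mulr_gt0.
have ts : t < s by rewrite lt_min tn1 ltrDl.
have s1 : s <= 1 by rewrite /s ge_min lexx.
have se : s <= t + (phi t - mu) / (2 * K) by rewrite /s ge_min lexx orbT.
have := after s; rewrite ts s1 => /(_ isT) sm.
have s01 : 0 <= s <= 1 by rewrite s1 andbT; case/andP: t01 => ? _; lra.
have := phiK s t s01 t01; rewrite [`|s - t|]gtr0_norm ?subr_gt0 // => /ler_normlP[h _].
have : K * (s - t) <= (phi t - mu) / 2.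
  have h1 : s - t <= (phi t - mu) / (2 * K) by lra.
  rewrite mulrC; apply: (le_trans (ler_wpM2r (ltW K0) h1)).
  by rewrite le_eqVlt; apply/orP; left; apply/eqP; field; exact: lt0r_neq0.
lra.
Qed.

Context (g : V -> R) (x0 : V) (rho L : R) (rho0 : 0 < rho) (L0 : 0 < L).
Context (dg : forall x, ball x0 rho x -> differentiable g x).
Context (gL : forall x y, ball x0 rho x -> ball x0 rho y ->
  `|grad g x - grad g y| <= L * `|x - y|).

(* Along a pencil of parallel segments, the last points where a tilt of the
   slope equals a prescribed level are sent by a Lipschitz map onto a ball. *)
Lemma slope_growth (c : R) w : `|w| < rho / 4 ->
  (forall x, ball x0 rho x -> twice_differentiable g x ->
     c < quad (hessian g x) w) ->
  c <= dotv (grad g (x0 + w) - grad g x0) w.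
Proof.
move=> wr Hc; rewrite leNgt; apply/negP => lt.
have rh0 := rho0.
(* For [w = 0] the negated claim says [0 < c], while one point of twice differentiability, provided
   by Rademacher's theorem, gives [c < 0]. *)
have [w0|/rV0Pn[i0 wi0]] := eqVneq w 0.
  have [x [xb tx]] : exists x, ball x0 (rho / 2) x /\ twice_differentiable g x.
    apply: (@contact_twice_differentiable R n g x0 rho L rho0 L0 dg gL _ id 1 (rho / 2) x0) => //.
    - by rewrite divr_gt0.
    - by move=> x y _ _; rewrite mul1r.
    - by move=> x xb; exists x.
  have h : rho / 2 <= rho by lra.
  have := Hc x (le_ball h xb) tx; rewrite w0 /quad mul0mx.
  move: lt; rewrite w0 addr0 subrr.
  have -> : dotv (0 : V) 0 = 0 by rewrite /dotv big1 // => i _; rewrite mxE mul0r.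
  by move=> /ltW /le_lt_trans h1 /h1; rewrite ltxx.
pose k x := dotv (grad g x) w.
(* The quotient grows by [1] along [w], so [m] is the slope corrected by the growth [c] to be
   proved: it drops between [x0] and [x0 + w] exactly when the claim fails. *)
pose m x := k x - c * ((x 0 i0 - x0 0 i0) / w 0 i0).
pose K := n.+1%:R * L * `|w| + `|c| / `|w 0 i0| + 1.
have wn : 0 < `|w 0 i0| by rewrite normr_gt0.
have K1 : 0 <= n.+1%:R * L * `|w| + `|c| / `|w 0 i0|.
  by rewrite addr_ge0 ?mulr_ge0 ?(ltW L0) ?invr_ge0.
have K0 : 0 < K by rewrite /K ltr_wpDl.
have mK x y : ball x0 rho x -> ball x0 rho y -> `|m x - m y| <= K * `|x - y|.
  move=> xb yb; have xyn := normr_ge0 (x - y).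
  have xyi : `|x 0 i0 - y 0 i0| <= `|x - y|.
    by have := coord_le_norm (x - y) i0; rewrite !mxE.
  have -> : m x - m y = dotv (grad g x - grad g y) w - c / w 0 i0 * (x 0 i0 - y 0 i0).
    by rewrite dotvBl /m /k; ring.
  rewrite (le_trans (ler_normB _ _)) // !normrM normfV.
  have h1 := dotv_norm_le (grad g x - grad g y) w.
  have h2 : n.+1%:R * `|grad g x - grad g y| * `|w| <= n.+1%:R * (L * `|x - y|) * `|w|.
    by rewrite ler_wpM2r // ler_wpM2l // gL.
  have h3 : `|c| / `|w 0 i0| * `|x 0 i0 - y 0 i0| <= `|c| / `|w 0 i0| * `|x - y|.
    by rewrite ler_wpM2l // divr_ge0.
  rewrite /K; lra.
have b0 := ballxx x0 rho0.
have bw : ball x0 rho (x0 + w).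
  by rewrite -ball_normE /= opprD addrA subrr sub0r normrN; lra.
have m0 : m x0 = k x0 by rewrite /m subrr mul0r mulr0 subr0.
have m1 : m (x0 + w) = k (x0 + w) - c.
  by rewrite /m mxE addrAC subrr add0r divff // mulr1.
pose gam := m x0 - m (x0 + w).
have gam0 : 0 < gam.
  by move: lt; rewrite /gam m0 m1 dotvBl -/(k _) -/(k _); lra.
pose mu0 := (m x0 + m (x0 + w)) / 2.
(* Shifting the segment and the level by less than [d] perturbs the comparison by at most
   [d * (K + 1) <= gam / 4], below the distance [gam / 2] from [mu0] to the values of [m] at both
   ends. *)
pose d := Num.min (rho / 8) (gam / (4 * (K + 1))).
have K10 : 0 < K + 1 by rewrite addr_gt0.
have d0 : 0 < d by rewrite lt_min !divr_gt0 // mulr_gt0.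
have d1 : d <= rho / 8 by rewrite /d ge_min lexx.
have d2 : d * (K + 1) <= gam / 4.
  have h : d <= gam / (4 * (K + 1)) by rewrite /d ge_min lexx orbT.
  apply: (le_trans (ler_wpM2r (ltW K10) h)).
  by rewrite le_eqVlt; apply/orP; left; apply/eqP; field; exact: lt0r_neq0.
pose e0 : V := delta_mx 0 i0.
(* Projection along [w] onto the hyperplane where coordinate [i0] is that of [x0] identifies the
   segment; the coordinate freed in this way records the level. *)
pose Psi x := x - ((x 0 i0 - x0 0 i0) / w 0 i0) *: w + (m x - mu0) *: e0.
pose P := [set x | ball x0 (rho / 2) x /\
  exists2 e : R, 0 < e & forall s, 0 < s < e -> m (x + s *: w) <= m x].
have sur : ball x0 d `<=` Psi @` P.
  move=> z; rewrite -ball_normE /= distrC => zd.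
  pose y : V := z - (z 0 i0 - x0 0 i0) *: e0.
  pose mu := mu0 + (z 0 i0 - x0 0 i0).
  have yi0 : y 0 i0 = x0 0 i0 by rewrite !mxE !eqxx /=; ring.
  have zi0 : `|z 0 i0 - x0 0 i0| <= `|z - x0|.
    by have := coord_le_norm (z - x0) i0; rewrite !mxE.
  have yx0 : `|y - x0| <= `|z - x0|.
    rewrite ler_norm_rV //; apply/forallP => i.
    have := coord_le_norm (z - x0) i; rewrite !mxE eqxx /=; case: (eqVneq i i0) => [->|_] /=.
      by rewrite mulr1 opprB addrCA subrr addr0 subrr normr0.
    by rewrite mulr0 subr0.
  have yt (t : R) : 0 <= t <= 1 -> `|y + t *: w - x0| < d + rho / 4.
    move=> /andP[t0 t1]; rewrite addrAC (le_lt_trans (ler_normD _ _)) //.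
    have : `|t *: w| <= `|w| by rewrite normrZ ger0_norm // ler_piMl.
    lra.
  have ybt (t : R) : 0 <= t <= 1 -> ball x0 rho (y + t *: w).
    by move=> /yt; rewrite -ball_normE /= distrC; lra.
  have [||||t [/andP[t0 t1] mt after]] :=
      @last_level (fun t => m (y + t *: w)) (K * (`|w| + 1)) mu.
  - by rewrite mulr_gt0 // ltr_wpDl.
  - move=> s t s01 t01; rewrite (le_trans (mK _ _ (ybt _ s01) (ybt _ t01))) //.
    rewrite opprD addrACA subrr add0r -scalerBl normrZ -mulrA ler_pM2l //.
    by rewrite mulrC ler_wpM2r // lerDl.
  - have := mK _ _ (ybt 0 _) b0; rewrite lexx ler01 scale0r addr0 => /(_ isT).
    move=> /ler_normlP[h _].
    have h2 : K * `|y - x0| <= K * d by rewrite ler_pM2l // (le_trans yx0) // ltW.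
    have := ler_norm (z 0 i0 - x0 0 i0); rewrite /mu /mu0.
    move: d2 gam0; rewrite /gam; lra.
  - have := mK _ _ (ybt 1 _) bw; rewrite lexx ler01 scale1r => /(_ isT).
    have -> : y + w - (x0 + w) = y - x0 by rewrite opprD addrACA subrr addr0.
    move=> /ler_normlP[_ h].
    have h2 : K * `|y - x0| <= K * d by rewrite ler_pM2l // (le_trans yx0) // ltW.
    have := ler_norm (- (z 0 i0 - x0 0 i0)); rewrite normrN /mu /mu0.
    move: d2 gam0; rewrite /gam; lra.
  exists (y + t *: w).
    split.
      have t01 : 0 <= t <= 1 by rewrite t0 ltW.
      by rewrite -ball_normE /= distrC; have := yt t t01; lra.
    exists (1 - t); first by rewrite subr_gt0.
    move=> s /andP[s0 s1]; rewrite mt -addrA -scalerDl ltW // after //.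
    by rewrite ltrDl s0 -lerBrDl ltW.
  rewrite /Psi mt.
  have -> : (y + t *: w) 0 i0 - x0 0 i0 = t * w 0 i0 by rewrite mxE yi0 mxE; ring.
  have -> : mu - mu0 = z 0 i0 - x0 0 i0 by rewrite /mu addrAC subrr add0r.
  by rewrite mulfK // addrK /y subrK.
have PsiK x y : P x -> P y -> `|Psi x - Psi y| <= (1 + `|w| / `|w 0 i0| + K) * `|x - y|.
  have h : rho / 2 <= rho by lra.
  move=> [/(le_ball h) xb _] [/(le_ball h) yb _].
  have xyi : `|x 0 i0 - y 0 i0| <= `|x - y|.
    by have := coord_le_norm (x - y) i0; rewrite !mxE.
  have -> : Psi x - Psi y = (x - y) - ((x 0 i0 - y 0 i0) / w 0 i0) *: w +
      (m x - m y) *: e0.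
    rewrite /Psi; move: (m x) (m y) => a b.
    by apply/rowP => i; rewrite !mxE; ring.
  have e1 : `|e0| <= 1.
    rewrite ler_norm_rV //; apply/forallP => i; rewrite mxE.
    by case: (_ && _); rewrite ?normr0 ?normr1.
  rewrite (le_trans (ler_normD _ _)) //.
  have h1 := ler_normB (x - y) (((x 0 i0 - y 0 i0) / w 0 i0) *: w).
  have h2 : `|(m x - m y) *: e0| <= K * `|x - y|.
    by rewrite normrZ (le_trans _ (mK _ _ xb yb)) // ler_piMr.
  have h3 : `|((x 0 i0 - y 0 i0) / w 0 i0) *: w| <= `|w| / `|w 0 i0| * `|x - y|.
    rewrite normrZ normrM normfV mulrAC [leRHS]mulrAC ler_pM2r ?invr_gt0 //.
    by rewrite mulrC ler_wpM2l.
  lra.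
have [||x [[xb [e e_gt0 He]] tx]] := @contact_twice_differentiable R n g x0 rho L rho0 L0 dg gL P Psi
  (1 + `|w| / `|w 0 i0| + K) d x0 _ d0 _ PsiK sur.
- by rewrite addr_gt0 // ltr_wpDr // divr_ge0.
- by move=> x [].
have h : rho / 2 <= rho by lra.
have Hq := Hc x (le_ball h xb) tx.
pose eps := (quad (hessian g x) w - c) / 2.
have eps0 : 0 < eps by rewrite divr_gt0 // subr_gt0.
have [e' e'0 He'] := hessian_expansion w tx eps0.
have [s [s0 se se']] := pos_lt_both e_gt0 e'0.
have := He' s; rewrite gtr0_norm // => /(_ se') /ler_normlP[h1 _].
have := He s; rewrite s0 se => /(_ isT); apply/negP; rewrite -ltNge -subr_gt0.
have -> : m (x + s *: w) - m x = k (x + s *: w) - k x - s * c.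
  by rewrite /m !mxE; field.
have : 0 < s * eps by rewrite mulr_gt0.
rewrite /eps in h1 *; rewrite -/(k _) -/(k _) in h1; lra.
Qed.

(** Subtract the quadratic model along the segment: the remaining slope at [t] is nonnegative by
    [slope_growth] applied to [t *: w], and the mean value theorem concludes. *)
Lemma quadratic_growth (c : R) w : 0 <= c -> `|w| < rho / 4 ->
  (forall x t, ball x0 rho x -> twice_differentiable g x -> t != 0 -> w != 0 ->
     c * dotv (t *: w) (t *: w) < quad (hessian g x) (t *: w)) ->
  g x0 + dotv (grad g x0) w + c / 2 * dotv w w <= g (x0 + w).
Proof.
move=> c0 wr Hc; have rh0 := rho0.
have dot0 : dotv (0 : V) 0 = 0 by rewrite /dotv big1 // => i _; rewrite mxE mul0r.
have [->|w0] := eqVneq w 0.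
  rewrite addr0 dot0 mulr0 addr0 /dotv big1 ?addr0 // => i _.
  by rewrite [X in _ * X]mxE mulr0.
pose D := dotv (grad g x0) w; pose Q := dotv w w.
pose phi (t : R) := g (x0 + t *: w) - (D * t + c / 2 * Q * t ^+ 2).
have tb (t : R) : 0 <= t <= 1 -> `|t *: w| < rho / 4.
  move=> /andP[t0 t1]; apply: le_lt_trans wr; rewrite normrZ ger0_norm //.
  by rewrite ler_piMl.
have Hd (t : R) : 0 <= t <= 1 -> is_derive t (1 : R) phi
    (dotv (grad g (x0 + t *: w)) w - (D + c * Q * t)).
  move=> /tb t01; apply: is_deriveB.
    apply: is_derive_line; apply: dg.
    by rewrite -ball_normE /= opprD addrA subrr sub0r normrN; lra.
  apply: is_derive_eps => eps eps0.
  pose K := `|c / 2 * Q| + 1.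
  have K0 : 0 < K by rewrite /K ltr_wpDl.
  exists (eps / K); first by rewrite divr_gt0.
  move=> s; rewrite ltr_pdivlMr // => sK.
  rewrite (_ : s *: (1 : R) = s); last exact: mulr1.
  rewrite (_ : _ - _ = c / 2 * Q * s * s); last by rewrite /GRing.scale /=; field.
  rewrite normrM ler_wpM2r // normrM; apply: le_trans (ltW sK).
  by rewrite mulrC ler_wpM2l // lerDl.
have [||t] := @MVT R phi (fun t => dotv (grad g (x0 + t *: w)) w - (D + c * Q * t)) 0 1 ltr01.
- by move=> t; rewrite in_itv /= => /andP[a b]; apply: Hd; rewrite !ltW.
- apply: derivable_within_continuous => t; rewrite in_itv /= => t01.
  by have [] := Hd t t01.
rewrite in_itv /= => /andP[t0 t1] E.
have t01 : 0 <= t <= 1 by rewrite !ltW.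
have := @slope_growth (c * dotv (t *: w) (t *: w)) (t *: w) (tb t t01).
have tn : t != 0 by rewrite lt0r_neq0.
move=> /(_ (fun x xb tx => Hc x t xb tx tn w0)).
rewrite dotvZl !dotvZr dotvBl -/D -/Q => H.
have {}H : c * Q * t <= dotv (grad g (x0 + t *: w)) w - D.
  rewrite -(ler_pM2l t0); apply: le_trans H.
  by rewrite le_eqVlt; apply/orP; left; apply/eqP; ring.
move: E; rewrite subr0 mulr1 /phi scale1r scale0r addr0 => E.
rewrite -/D -/Q; move: E; rewrite expr1n expr0n /=; lra.
Qed.

End Growth.

(** * The objective near a point *)

Section AbsPower.
Context {R : realType}.
Implicit Types (q t s : R).

Lemma absqN q t : absq q (- t) = absq q t.
Proof. by rewrite /absq oppr_eq0 normrN. Qed.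

Lemma is_derive_absq_gt0 q t : 0 < t ->
  is_derive t (1 : R) (absq q) (q * t `^ (q - 1)).
Proof.
move=> t0; have H := is_derive1_powR q t0.
apply: is_derive_eps => eps eps0; have [d d0 Hd] := derivable_eps (ex_derive (is_derive := H)) eps0.
rewrite (derive_val (is_derive := H)) in Hd.
exists (Num.min d t); first by rewrite lt_min d0.
move=> s; rewrite lt_min => /andP[/Hd + st].
rewrite (_ : s *: (1 : R) = s); last exact: mulr1.
have ts : 0 < t + s by move: st => /ltr_normlP[h1 h2]; lra.
by rewrite /absq !gt_eqF // (gtr0_norm ts) (gtr0_norm t0).
Qed.

Lemma absq_C11_gt0 q t0 : 0 < t0 ->
  exists (L : R), 0 < L /\ forall s t, `|s - t0| < t0 / 2 -> `|t - t0| < t0 / 2 ->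
    `|q * s `^ (q - 1) - q * t `^ (q - 1)| <= L * `|s - t|.
Proof.
move=> tp; pose e := q - 1 - 1.
(* The power with exponent [e] is monotone, in a sense that depends on the sign of [e], so an
   endpoint bounds it in either case. *)
pose B := Num.max ((t0 / 2) `^ e) ((2 * t0) `^ e).
pose L := `|q * (q - 1)| * B + 1.
have B0 : 0 <= B by rewrite le_max powR_ge0.
exists L; split; first by rewrite /L ltr_wpDl // mulr_ge0.
have powB c : t0 / 2 <= c <= 2 * t0 -> c `^ e <= B.
  move=> /andP[c1 c2]; have c0 : 0 < c by apply: lt_le_trans c1; rewrite divr_gt0.
  have [e0|e0] := leP 0 e.
    rewrite /B le_max; apply/orP; right; apply: ge0_ler_powR; rewrite ?nnegrE //; lra.
  rewrite /B le_max; apply/orP; left.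
  rewrite -[e]opprK !(powRN _ (- e)) lef_pV2 ?posrE ?powR_gt0 ?divr_gt0 //.
  by apply: ge0_ler_powR; rewrite ?nnegrE //; lra.
suff H s t : s <= t -> `|s - t0| < t0 / 2 -> `|t - t0| < t0 / 2 ->
    `|q * s `^ (q - 1) - q * t `^ (q - 1)| <= L * `|s - t|.
  move=> s t hs ht; have [st|/ltW ts] := leP s t; first exact: H.
  by rewrite distrC [`|s - t|]distrC; exact: H.
move=> st; rewrite !ltr_distl => /andP[s1 s2] /andP[t1 t2].
have Hd (c : R) : 0 < c -> is_derive c (1 : R) (fun x : R => q * x `^ (q - 1))
    (q * ((q - 1) * c `^ e)).
  move=> c0; have := is_deriveZ q (is_derive1_powR (q - 1) c0); exact.
have [||c] := @MVT_segment R (fun x => q * x `^ (q - 1)) (fun c => q * ((q - 1) * c `^ e)) s t st.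
- by move=> x; rewrite in_itv /= => /andP[h1 h2]; apply: Hd; lra.
- apply: derivable_within_continuous => x; rewrite in_itv /= => /andP[h1 h2].
  have x0 : 0 < x by lra.
  by have [] := Hd x x0.
rewrite in_itv /= => /andP[c1 c2] E; rewrite distrC E [`|s - t|]distrC normrM ler_wpM2r //.
rewrite mulrA normrM (ger0_norm (powR_ge0 _ _)) /L ler_wpDr // ler_wpM2l // powB //.
by apply/andP; split; lra.
Qed.

(** The negative side follows from the positive one because [absq] is even. *)
Lemma absq_C11 q t0 : t0 != 0 -> exists (psi : R -> R) (r L : R),
  [/\ 0 < r, 0 < L,
      forall t, `|t - t0| < r -> is_derive t (1 : R) (absq q) (psi t) &
      forall s t, `|s - t0| < r -> `|t - t0| < r -> `|psi s - psi t| <= L * `|s - t|].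
Proof.
rewrite neq_lt => /orP[tn|tp]; last first.
  have [L [L0 HL]] := absq_C11_gt0 q tp.
  exists (fun t => q * t `^ (q - 1)), (t0 / 2), L; split => //; first by rewrite divr_gt0.
  move=> t; rewrite ltr_distl => /andP[h1 h2]; apply: is_derive_absq_gt0; lra.
have tp : 0 < - t0 by rewrite oppr_gt0.
have [L [L0 HL]] := absq_C11_gt0 q tp.
have flip t : `|t - t0| = `|- t - - t0| by rewrite -opprD normrN.
exists (fun t => - (q * (- t) `^ (q - 1))), (- t0 / 2), L; split => //.
- by rewrite divr_gt0.
- move=> t; rewrite ltr_distl => /andP[h1 h2].
  have tn' : 0 < - t by lra.
  have H := is_derive_absq_gt0 q tn'.
  apply: is_derive_eps => eps eps0; have [d d0 Hd] := derivable_eps (ex_derive (is_derive := H)) eps0.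
  rewrite (derive_val (is_derive := H)) in Hd.
  exists d => // s sd; have := Hd (- s); rewrite normrN => /(_ sd).
  rewrite (_ : s *: (1 : R) = s); last exact: mulr1.
  rewrite (_ : - s *: (1 : R) = - s); last exact: mulr1.
  rewrite -opprD !absqN; congr (_ <= _); congr `|_|.
  by rewrite /GRing.scale /=; ring.
- move=> s t; rewrite !flip => hs ht; have := HL _ _ hs ht.
  rewrite -opprD normrN; congr (_ <= _).
  by rewrite -normrN; congr `|_|; ring.
Qed.

End AbsPower.

Section Objective.
Context {R : realType} {n : nat}.
Local Notation V := 'rV[R]_n.+1.
Implicit Types (x y z u v w : V).

Lemma row_subE x y i : (x - y) 0 i = x 0 i - y 0 i.
Proof. by rewrite !mxE. Qed.

Lemma LC1_ball (f : V -> R) (x0 : V) : LC1 f x0 ->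
  exists (rho L : R), [/\ 0 < rho, 0 < L,
    forall x, ball x0 rho x -> differentiable f x &
    forall x y, ball x0 rho x -> ball x0 rho y ->
      `|grad f x - grad f y| <= L * `|x - y|].
Proof.
move=> [U [oU dU _ lU]].
have [r /= r0 rU] : nbhs_ball x0 U by apply/nbhs_ballP; exact: open_nbhs_nbhs.
move: lU; rewrite /lipschitz_on => /pinfty_ex_gt0[L L0 HL].
exists r, L; split => //; first by move=> x /rU /dU.
by move=> x y /rU Ux /rU Uy; exact: (HL (x, y)).
Qed.

Lemma differentiable_coord_comp (phi : R -> R) (i : 'I_n.+1) x :
  derivable phi (x 0 i) 1 -> differentiable (fun y : V => phi (y 0 i)) x.
Proof.
move=> /derivable1_diffP dphi.
by apply: (@differentiable_comp _ _ _ _ (fun y : V => y 0 i : R) phi) => //; exact: differentiable_coord.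
Qed.

Lemma derive_coord_comp (phi : R -> R) (i j : 'I_n.+1) x a :
  is_derive (x 0 i) (1 : R) phi a ->
  'D_(delta_mx 0 j) (fun y : V => phi (y 0 i)) x = (i == j)%:R * a.
Proof.
move=> [dphi Da]; suff H : is_derive x (delta_mx 0 j : V) (fun y : V => phi (y 0 i)) ((i == j)%:R * a).
  by have [] := H.
apply: is_derive_eps => eps eps0; have [d d0 Hd] := derivable_eps dphi eps0.
exists d => // t td; rewrite !mxE /=.
case: eqP => _; last by rewrite mulr0 addr0 mul0r scaler0 !subrr normr0 mulr_ge0 // ltW.
have := Hd t td; rewrite Da mulr1 mul1r.
by rewrite (_ : t *: (1 : R) = t) //; exact: mulr1.
Qed.

Lemma objE_sum (f : V -> R) lambda q (S : {set 'I_n.+1}) x :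
  objE f lambda q S x = f x + lambda * \sum_(k < #|S|) absq q (x 0 (enum_val k)).
Proof. by rewrite /objE /lqq; congr (_ + _ * _); apply: eq_bigr => k _; rewrite mxE. Qed.

Lemma objE_C11 (f : V -> R) (lambda q : R) (xs : V) : LC1 f xs ->
  exists (rho L : R), [/\ 0 < rho, 0 < L,
    forall x, ball xs rho x -> differentiable (objE f lambda q (supp xs)) x &
    forall x y, ball xs rho x -> ball xs rho y ->
      `|grad (objE f lambda q (supp xs)) x - grad (objE f lambda q (supp xs)) y|
         <= L * `|x - y|].
Proof.
move=> /LC1_ball[rf [Lf [rf0 Lf0 df fL]]]; set S := supp xs.
have HS (k : 'I_#|S|) : exists p : (R -> R) * (R * R),
  [/\ 0 < p.2.1, 0 < p.2.2,
      forall t, `|t - xs 0 (enum_val k)| < p.2.1 -> is_derive t (1 : R) (absq q) (p.1 t) &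
      forall s t, `|s - xs 0 (enum_val k)| < p.2.1 -> `|t - xs 0 (enum_val k)| < p.2.1 ->
        `|p.1 s - p.1 t| <= p.2.2 * `|s - t|].
  have xk : xs 0 (enum_val k) != 0 by have := enum_valP k; rewrite inE.
  by have [psi [r [L H]]] := absq_C11 q xk; exists (psi, (r, L)).
have [p Hp] := choice HS.
pose rho := Num.min rf (\big[Num.min/1]_k (p k).2.1).
have rho0 : 0 < rho.
  by rewrite lt_min rf0; apply: lt_bigmin => // k _; have [] := Hp k.
have rhof x : ball xs rho x -> ball xs rf x.
  by apply: le_ball; rewrite /rho ge_min lexx.
have rhok x (k : 'I_#|S|) : ball xs rho x -> `|x 0 (enum_val k) - xs 0 (enum_val k)| < (p k).2.1.
  rewrite -ball_normE /= distrC => xr.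
  have h : rho <= (p k).2.1.
    by rewrite /rho ge_min; apply/orP; right; exact: bigmin_le.
  apply: lt_le_trans h; apply: le_lt_trans xr.
  by have := coord_le_norm (x - xs) (enum_val k); rewrite !mxE.
have E : objE f lambda q S = f + lambda *: \sum_(k < #|S|) (fun x : V => absq q (x 0 (enum_val k))).
  by apply/funext => x; rewrite objE_sum !fctE fct_sumE.
have dk x (k : 'I_#|S|) : ball xs rho x -> differentiable (fun y : V => absq q (y 0 (enum_val k))) x.
  move=> xr; apply: differentiable_coord_comp.
  by have [_ _ H _] := Hp k; have [] := H _ (rhok x k xr).
have dsum x : ball xs rho x ->
    differentiable (lambda *: \sum_(k < #|S|) (fun x : V => absq q (x 0 (enum_val k)))) x.
  by move=> xr; apply: differentiableZ; apply: differentiable_sum => k; exact: dk.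
have dE x : ball xs rho x -> differentiable (objE f lambda q S) x.
  by move=> xr; rewrite E; apply: differentiableD; [exact/df/rhof|exact: dsum].
have gE x i : ball xs rho x -> grad (objE f lambda q S) x 0 i =
    grad f x 0 i + lambda * \sum_(k < #|S|) (enum_val k == i)%:R * (p k).1 (x 0 (enum_val k)).
  move=> xr; rewrite !mxE E deriveD; first last.
  - by apply: diff_derivable; exact: dsum.
  - by apply: diff_derivable; exact/df/rhof.
  rewrite deriveZ; last by apply: diff_derivable; apply: differentiable_sum => k; exact: dk.
  rewrite derive_sum; last by move=> k; apply: diff_derivable; exact: dk.
  congr (_ + _ * _); apply: eq_bigr => k _; apply: derive_coord_comp.
  by have [_ _ H _] := Hp k; exact: (H _ (rhok x k xr)).
pose L := Lf + `|lambda| * \sum_k (p k).2.2.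
have L0 : 0 < L.
  rewrite /L ltr_wpDr // mulr_ge0 // sumr_ge0 // => k _.
  by have [_ /ltW] := Hp k.
exists rho, L; split => // x y xr yr.
rewrite ler_norm_rV; last by rewrite mulr_ge0 // ltW.
apply/forallP => i; move: (grad (objE f lambda q S)) gE => G gE.
rewrite row_subE !gE //.
have h1 := fL x y (rhof x xr) (rhof y yr).
have h2 : `|grad f x 0 i - grad f y 0 i| <= `|grad f x - grad f y|.
  have := coord_le_norm (grad f x - grad f y) i.
  by rewrite row_subE.
have h3 : `|\sum_(k < #|S|) (enum_val k == i)%:R * (p k).1 (x 0 (enum_val k)) -
    \sum_(k < #|S|) (enum_val k == i)%:R * (p k).1 (y 0 (enum_val k))| <=
    (\sum_k (p k).2.2) * `|x - y|.
  rewrite -sumrB mulr_suml (le_trans (ler_norm_sum _ _ _)) //; apply: ler_sum => k _.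
  have [_ Lk _ H] := Hp k.
  rewrite -mulrBr normrM; apply: (@le_trans _ _ (1 * `|(p k).1 (x 0 (enum_val k)) - (p k).1 (y 0 (enum_val k))|)).
    by rewrite ler_wpM2r //; case: (_ == _); rewrite ?normr1 ?normr0.
  rewrite mul1r (le_trans (H _ _ (rhok x k xr) (rhok y k yr))) // ler_pM2l //.
  by have := coord_le_norm (x - y) (enum_val k); rewrite !mxE.
move: h3; set a := \sum_(k < #|S|) _; set b := \sum_(k < #|S|) _ => h3.
rewrite (_ : _ - _ = (grad f x 0 i - grad f y 0 i) + lambda * (a - b)); last by ring.
rewrite (le_trans (ler_normD _ _)) // normrM /L.
have : `|lambda| * `|a - b| <= `|lambda| * ((\sum_k (p k).2.2) * `|x - y|) by rewrite ler_wpM2l.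
lra.
Qed.

End Objective.

(** * Limits of Hessians *)

Section Compactness.
Context {R : realType}.

(** Bolzano-Weierstrass with explicit rates: a cluster point yields indices [kap j >= j], and
    passages to the limit become inequalities closed by [le_inv_nat]. *)
Lemma bounded_subseq m (u : nat -> 'rV[R]_m) (B : R) : (forall k, `|u k| <= B) ->
  exists (p : 'rV[R]_m) (kap : nat -> nat),
    (forall j, (j <= kap j)%N) /\ forall j, `|u (kap j) - p| < j.+1%:R^-1.
Proof.
move=> uB; pose A := [set x : 'rV[R]_m | `|x| <= B].
have cA : compact A.
  apply: bounded_closed_compact.
    exists B; split; first by rewrite num_real.
    by move=> M BM x /= xB; rewrite (le_trans xB) // ltW.
  have -> : A = (fun x : 'rV[R]_m => `|x|) @^-1` [set r | r <= B] by [].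
  by apply: closed_comp; [move=> x _; exact: norm_continuous|exact: closed_le].
have [|p [_ clp]] := cA (u @ \oo) _; first by exists 0%N => // k _; exact: uB.
have H j : exists k, (j <= k)%N /\ `|u k - p| < j.+1%:R^-1.
  have [||_ [[k jk <-] pk]] := clp [set u k | k in [set k | (j <= k)%N]] (ball p j.+1%:R^-1).
  - by exists j => // k jk; exists k.
  - exact: nbhsx_ballx.
  by exists k; split => //; move: pk; rewrite -ball_normE /= distrC.
have [kap Hk] := choice H.
by exists p, kap; split => j; have [] := Hk j.
Qed.

Lemma ler_norm_mx m n (A : 'M[R]_(m, n)) (r : R) : 0 <= r ->
  (forall i j, `|A i j| <= r) -> `|A| <= r.
Proof.
move=> r0 H; rewrite /Num.norm /= mx_normrE; apply/bigmax_leP; split => //.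
Qed.

Lemma entry_le_norm m n (A : 'M[R]_(m, n)) i j : `|A i j| <= `|A|.
Proof.
rewrite [leRHS]/Num.norm /= mx_normrE.
exact: (le_bigmax _ (fun ij : 'I_m * 'I_n => `|A ij.1 ij.2|) (i, j)).
Qed.

Lemma bounded_mx_subseq m n (H : nat -> 'M[R]_(m, n)) (B : R) : (forall k, `|H k| <= B) ->
  exists (p : 'M[R]_(m, n)) (kap : nat -> nat),
    (forall j, (j <= kap j)%N) /\ forall j, `|H (kap j) - p| < j.+1%:R^-1.
Proof.
move=> HB; have B0 : 0 <= B by apply: le_trans (HB 0%N).
have [|p [kap [Hk Hp]]] := @bounded_subseq _ (fun k => mxvec (H k)) B.
  move=> k; apply: ler_norm_mx => // i j; rewrite (ord1 i).
  by case/mxvec_indexP: j => i' j'; rewrite mxvecE (le_trans (entry_le_norm _ _ _)).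
exists (vec_mx p), kap; split => // j; apply: le_lt_trans (Hp j).
apply: ler_norm_mx => // i i'; have := entry_le_norm (mxvec (H (kap j)) - p) 0 (mxvec_index i i').
by rewrite -{1}[p]vec_mxK -linearB /= mxvecE.
Qed.

Lemma inv_nat_le (j k : nat) : (j <= k)%N -> k.+1%:R^-1 <= j.+1%:R^-1 :> R.
Proof. by move=> jk; rewrite lef_pV2 ?posrE // ler_nat. Qed.

Lemma le_inv_nat (x B : R) : (forall j : nat, x <= B * j.+1%:R^-1) -> x <= 0.
Proof.
move=> H; rewrite leNgt; apply/negP => x0.
have B0 : 0 < B by have := H 0%N; rewrite invr1 mulr1; apply: lt_le_trans.
have [|k Hk] := @inv_nat_lt R (x / B); first by rewrite divr_gt0.
have := H k; apply/negP; rewrite -ltNge -ltr_pdivlMl // mulrC //.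
Qed.

Lemma quadE n (M : 'M[R]_n) x : quad M x = \sum_i \sum_j M i j * (x 0 i * x 0 j).
Proof.
rewrite /quad /dotv; apply: eq_bigr => i _; rewrite mxE mulr_suml.
by apply: eq_bigr => j _; rewrite mxE; ring.
Qed.

Lemma quadZ n (M : 'M[R]_n) a x : quad M (a *: x) = a ^+ 2 * quad M x.
Proof.
rewrite !quadE mulr_sumr; apply: eq_bigr => i _; rewrite mulr_sumr.
by apply: eq_bigr => j _; rewrite !mxE; ring.
Qed.

Lemma quad_close n (A B : 'M[R]_n) (v w : 'rV[R]_n) : `|v| <= 1 -> `|w| <= 1 ->
  `|quad A v - quad B w| <= n%:R ^+ 2 * (`|A - B| + 2 * `|B| * `|v - w|).
Proof.
move=> v1 w1; rewrite !quadE -sumrB (le_trans (ler_norm_sum _ _ _)) //.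
set D := `|A - B| + _.
suff H i j : `|A i j * (v 0 i * v 0 j) - B i j * (w 0 i * w 0 j)| <= D.
  apply: (@le_trans _ _ (\sum_(i < n) \sum_(j < n) D)).
    apply: ler_sum => i _; rewrite -sumrB (le_trans (ler_norm_sum _ _ _)) //.
    by apply: ler_sum.
  rewrite !sumr_const !card_ord -!mulrnA -[leLHS]mulr_natl natrM.
  by rewrite expr2.
have vi k : `|v 0 k| <= 1 by rewrite (le_trans (entry_le_norm _ _ _)).
have wi k : `|w 0 k| <= 1 by rewrite (le_trans (entry_le_norm _ _ _)).
have vw k : `|v 0 k - w 0 k| <= `|v - w|.
  by have := entry_le_norm (v - w) 0 k; rewrite !mxE.
have AB : `|A i j - B i j| <= `|A - B|.
  by have := entry_le_norm (A - B) i j; rewrite !mxE.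
have Bij := entry_le_norm B i j.
rewrite (_ : _ - _ = (A i j - B i j) * (v 0 i * v 0 j) +
  B i j * (v 0 i * (v 0 j - w 0 j) + (v 0 i - w 0 i) * w 0 j)); last by ring.
rewrite (le_trans (ler_normD _ _)) // /D lerD //.
  rewrite !normrM -[leRHS]mulr1 ler_pM ?mulr_ge0 //.
  by rewrite -[leRHS]mulr1 ler_pM.
rewrite normrM [2 * _]mulrC -mulrA ler_pM //.
rewrite (le_trans (ler_normD _ _)) // !normrM mulrDl mul1r lerD //.
  by rewrite -[leRHS]mul1r ler_pM.
by rewrite -[leRHS]mulr1 ler_pM.
Qed.

End Compactness.

Section Subspace.
Context {R : realType} {n : nat}.
Local Notation V := 'rV[R]_n.+1.
Implicit Types (x y z u w : V) (S : {set 'I_n.+1}).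

Definition extvec S (v : 'rV[R]_#|S|) : V :=
  \row_i \sum_(k < #|S|) v 0 k * (enum_val k == i)%:R.

Lemma extvec_off S (v : 'rV[R]_#|S|) i : i \notin S -> extvec v 0 i = 0.
Proof.
move=> iS; rewrite mxE big1 // => k _; case: eqP => [E|_]; last by rewrite mulr0.
by move: iS; rewrite -E enum_valP.
Qed.

Lemma sum_extvec S (v : 'rV[R]_#|S|) (F : 'I_n.+1 -> R) :
  \sum_i F i * extvec v 0 i = \sum_k F (enum_val k) * v 0 k.
Proof.
under eq_bigr do rewrite mxE mulr_sumr; rewrite exchange_big /=.
apply: eq_bigr => k _; rewrite (bigD1 (enum_val k)) //= eqxx mulr1 big1 ?addr0 //.
by move=> i /negbTE ik; rewrite eq_sym ik !mulr0.
Qed.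

(** Turns conditions on principal submatrices into conditions on vectors supported in [S], [extvec]
    being extension by zero. *)
Lemma quad_submat S (M : 'M[R]_n.+1) (v : 'rV[R]_#|S|) :
  quad (submat S M) v = quad M (extvec v).
Proof.
rewrite !quadE.
transitivity (\sum_i (\sum_j M i j * extvec v 0 j) * extvec v 0 i); last first.
  by apply: eq_bigr => i _; rewrite mulr_suml; apply: eq_bigr => j _; ring.
rewrite sum_extvec; apply: eq_bigr => k _; rewrite sum_extvec mulr_suml.
by apply: eq_bigr => l _; rewrite mxE; ring.
Qed.

Lemma extvec_subvec S w : (forall i, i \notin S -> w 0 i = 0) ->
  extvec (subvec S w) = w.
Proof.
move=> wS; apply/rowP => i; rewrite mxE.
have [iS|iS] := boolP (i \in S); last first.
  rewrite wS // big1 // => k _; case: eqP => [E|_]; last by rewrite mulr0.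
  by move: iS; rewrite -E enum_valP.
have [r Er] : exists r : 'I_#|S|, enum_val r = i.
  by exists (enum_rank_in iS i); exact: enum_rankK_in.
rewrite (bigD1 r) //= mxE Er eqxx mulr1 big1 ?addr0 //.
move=> k kr; case: eqP => [E|_]; last by rewrite mulr0.
by move: kr; rewrite -(inj_eq enum_val_inj) Er E eqxx.
Qed.

Lemma objF_objE (f : V -> R) lambda q S x :
  objF f lambda q x = objE f lambda q S x + lambda * \sum_(i | i \notin S) absq q (x 0 i).
Proof.
rewrite objE_sum /objF /lqq (bigID (fun i => i \in S)) /= mulrDr addrA.
congr (_ + _ * _ + _ * _).
by rewrite (big_enum_val (fun i => absq q (x 0 i))).
Qed.

Lemma absq0 q : absq q (0 : R) = 0.
Proof. by rewrite /absq eqxx. Qed.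

Lemma objF_supported (f : V -> R) lambda q S x : (forall i, i \notin S -> x 0 i = 0) ->
  objF f lambda q x = objE f lambda q S x.
Proof.
by move=> xS; rewrite (objF_objE _ _ _ S) big1 ?mulr0 ?addr0 // => i /xS ->; rewrite absq0.
Qed.

Lemma quad0 (M : 'M[R]_n.+1) : quad M 0 = 0.
Proof. by rewrite -(scale0r (0 : V)) quadZ expr0n mul0r. Qed.

Lemma dotv0 x : dotv 0 x = 0.
Proof. by rewrite -(scale0r (0 : V)) dotvZl mul0r. Qed.

Lemma supp_off x i : i \notin supp x -> x 0 i = 0.
Proof. by rewrite inE negbK => /eqP. Qed.

Lemma generalized_hessianI (g : V -> R) x (u : nat -> V) (H : 'M[R]_n.+1) :
  (forall k, `|u k - x| <= k.+1%:R^-1) ->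
  (forall k, twice_differentiable g (u k)) ->
  (forall k, `|hessian g (u k) - H| <= k.+1%:R^-1) ->
  generalized_hessian g x H.
Proof.
move=> ux tu Hu; apply: sub_gen_smallest; exists u; split => //.
  apply/cvgrPdist_le => eps eps0; have [k Hk] := inv_nat_lt eps0.
  exists k => // j /= kj; rewrite distrC (le_trans (ux j)) //.
  by rewrite (le_trans (inv_nat_le kj)) // ltW.
apply/cvgrPdist_le => eps eps0; have [k Hk] := inv_nat_lt eps0.
exists k => // j /= kj; rewrite distrC (le_trans (Hu j)) //.
by rewrite (le_trans (inv_nat_le kj)) // ltW.
Qed.

Context (g : V -> R) (x0 : V) (rho L : R) (rho0 : 0 < rho) (L0 : 0 < L).
Context (dg : forall x, ball x0 rho x -> differentiable g x).
Context (gL : forall x y, ball x0 rho x -> ball x0 rho y ->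
  `|grad g x - grad g y| <= L * `|x - y|).

(** Jensen's lemma on shrinking balls with [kappa] tending to [0]. The Hessians are bounded by [L],
    so a subsequence converges, and the inequality passes to the limit on unit vectors, which
    suffices by homogeneity. *)
Lemma slice_min_hessian S :
  (forall x, ball x0 rho x -> (forall i, i \notin S -> x 0 i = x0 0 i) -> g x0 <= g x) ->
  exists H, generalized_hessian g x0 H /\
    forall w : V, (forall i, i \notin S -> w 0 i = 0) -> 0 <= quad H w.
Proof.
move=> Hmin.
have Hk (k : nat) : exists x, [/\ ball x0 rho x, `|x - x0| <= k.+1%:R^-1,
    twice_differentiable g x & forall v : V, (forall i, i \notin S -> v 0 i = 0) ->
      0 <= quad (hessian g x) v + k.+1%:R^-1 * dotv v v].
  pose r := Num.min rho k.+1%:R^-1.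
  have r0 : 0 < r by rewrite lt_min rho0 /= invr_gt0 ltr0n.
  have rr x : ball x0 r x -> ball x0 rho x by apply: le_ball; rewrite /r ge_min lexx.
  have [||x [xr tx Hx]] := @jensen R n g x0 r L r0 L0
    (fun x xb => dg (rr x xb)) (fun x y xb yb => gL (rr x xb) (rr y yb)) S k.+1%:R^-1.
  - by rewrite invr_gt0.
  - by move=> x /rr; exact: Hmin.
  exists x; split => //; first exact: rr.
  move: xr; rewrite -ball_normE /= distrC => /ltW /le_trans; apply.
  by rewrite /r ge_min lexx orbT.
have [u Hu] := choice Hk.
have [|H [kap [kapj HH]]] := @bounded_mx_subseq R _ _ (fun k => hessian g (u k)) L.
  by move=> k; have [ub _ tu _] := Hu k; exact: (hessian_bound L0 gL ub tu).
exists H; split.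
  apply: (@generalized_hessianI _ _ (u \o kap)).
  - by move=> k; have [_ h _ _] := Hu (kap k); rewrite (le_trans h) // inv_nat_le.
  - by move=> k; have [_ _ h _] := Hu (kap k).
  - by move=> k; rewrite ltW //; exact: HH.
move=> w wS; have [->|w0] := eqVneq w 0.
  by rewrite quad0.
have wn : 0 < `|w| by rewrite normr_gt0.
pose v := `|w|^-1 *: w.
have vS i : i \notin S -> v 0 i = 0 by move=> iS; rewrite mxE wS // mulr0.
have v1 : `|v| <= 1 by rewrite normrZ normfV normr_id mulVf ?lt0r_neq0.
suff : 0 <= quad H v by rewrite quadZ pmulr_rge0 // exprn_gt0 // invr_gt0.
rewrite -oppr_le0.
apply: (@le_inv_nat R _ (n.+1%:R ^+ 2 + n.+1%:R)) => j.
have [_ _ _ /(_ v vS) h1] := Hu (kap j).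
have := quad_close (hessian g (u (kap j))) H v1 v1.
rewrite subrr normr0 mulr0 addr0 => /ler_normlP[_ h2].
have h3 : n.+1%:R ^+ 2 * `|hessian g (u (kap j)) - H| <= n.+1%:R ^+ 2 * j.+1%:R^-1.
  by rewrite ler_wpM2l ?sqr_ge0 // ltW //; exact: HH.
have h4 : (kap j).+1%:R^-1 * dotv v v <= j.+1%:R^-1 * n.+1%:R.
  apply: ler_pM; [by []|exact: dotv_ge0|exact: inv_nat_le|].
  rewrite (le_trans (ler_norm _)) // (le_trans (dotv_norm_le _ _)) // -mulrA.
  rewrite -[leRHS]mulr1 ler_pM2l //.
  by rewrite -[leRHS]mulr1 ler_pM.
move: h1 h2 h3 h4; move: (j.+1%:R^-1) ((kap j).+1%:R^-1 * _) => e k'; lra.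
Qed.

(** Failure for every constant [k.+1%:R^-1] gives Hessians at points tending to [x0] and unit
    directions in [R^S] with almost nonpositive values; a joint limit contradicts the hypothesis.
    The factor [n.+1] bounds [dotv v v] when the sup norm of [v] is [1]. *)
Lemma uniform_positivity S :
  (forall H, generalized_hessian g x0 H ->
     forall w : V, (forall i, i \notin S -> w 0 i = 0) -> w != 0 -> 0 < quad H w) ->
  exists c r, [/\ 0 < c, 0 < r <= rho &
    forall x w, ball x0 r x -> twice_differentiable g x ->
      (forall i, i \notin S -> w 0 i = 0) -> c * dotv w w <= quad (hessian g x) w].
Proof.
move=> Hpos; apply: contrapT => N.
have Hk (k : nat) : exists p : V * V, [/\ ball x0 rho p.1, `|p.1 - x0| <= k.+1%:R^-1,
    twice_differentiable g p.1 & [/\ (forall i, i \notin S -> p.2 0 i = 0), `|p.2| = 1 &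
      quad (hessian g p.1) p.2 <= n.+1%:R * k.+1%:R^-1]].
  apply: contrapT => N'; apply: N.
  pose r := Num.min rho k.+1%:R^-1.
  have r0 : 0 < r by rewrite lt_min rho0 /= invr_gt0 ltr0n.
  have rle : r <= rho by rewrite /r ge_min lexx.
  exists k.+1%:R^-1, r; split; [by rewrite invr_gt0|by rewrite r0|].
  move=> x w xr tx wS; rewrite leNgt; apply/negP => lt; apply: N'.
  have w0 : w != 0.
    by apply/eqP => w0; move: lt; rewrite w0 quad0 dotv0 mulr0 ltxx.
  have wn : 0 < `|w| by rewrite normr_gt0.
  exists (x, `|w|^-1 *: w); split => //=.
  - exact: (le_ball rle).
  - move: xr; rewrite -ball_normE /= distrC => /ltW /le_trans; apply.
    by rewrite /r ge_min lexx orbT.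
  have n1 : `| `|w|^-1 *: w| = 1 by rewrite normrZ normfV normr_id mulVf ?lt0r_neq0.
  split => //; first by move=> i iS; rewrite mxE wS // mulr0.
  set v := `|w|^-1 *: w in n1 *.
  have E : w = `|w| *: v by rewrite /v scalerA mulfV ?scale1r ?lt0r_neq0.
  move: lt; rewrite {1}E {2}E {3}E quadZ dotvZl dotvZr.
  rewrite (_ : _ * (_ * _) = `|w| ^+ 2 * (k.+1%:R^-1 * dotv v v)); last by ring.
  rewrite ltr_pM2l ?exprn_gt0 // => /ltW /le_trans; apply.
  rewrite mulrC ler_pM2r ?invr_gt0 // (le_trans (ler_norm _)) //.
  by rewrite (le_trans (dotv_norm_le _ _)) // n1 !mulr1.
have [p Hp] := choice Hk.
have [|H [k1 [k1j HH]]] := @bounded_mx_subseq R _ _ (fun k => hessian g (p k).1) L.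
  by move=> k; have [ub _ tu _] := Hp k; exact: (hessian_bound L0 gL ub tu).
have [|v [k2 [k2j Hv]]] := @bounded_subseq R _ (fun k => (p (k1 k)).2) 1.
  by move=> k; have [_ _ _ [_ -> _]] := Hp (k1 k).
pose kap j := k1 (k2 j).
have kapj j : (j <= kap j)%N by rewrite /kap (leq_trans (k2j j)).
have HHk j : `|hessian g (p (kap j)).1 - H| <= j.+1%:R^-1.
  by rewrite (le_trans (ltW (HH (k2 j)))) // inv_nat_le.
have vS i : i \notin S -> v 0 i = 0.
  move=> iS; apply/eqP; rewrite -normr_le0; apply: (@le_inv_nat R _ 1) => j.
  have [_ _ _ [pS _ _]] := Hp (k1 (k2 j)).
  have := coord_le_norm ((p (k1 (k2 j))).2 - v) i; rewrite row_subE pS // sub0r normrN.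
  by move=> /le_trans; apply; rewrite mul1r ltW.
have v1 : `|v| = 1.
  apply/eqP; rewrite -subr_eq0 -normr_le0; apply: (@le_inv_nat R _ 1) => j.
  have [_ _ _ [_ pn _]] := Hp (k1 (k2 j)).
  rewrite mul1r -[X in _ - X]pn distrC (le_trans (ler_dist_dist _ _)) // ltW //; exact: Hv.
have v0 : v != 0 by rewrite -normr_gt0 v1.
have : generalized_hessian g x0 H.
  apply: (@generalized_hessianI _ _ (fun j => (p (kap j)).1)).
  - by move=> k; have [_ h _ _] := Hp (kap k); rewrite (le_trans h) // inv_nat_le.
  - by move=> k; have [_ _ h _] := Hp (kap k).
  - exact: HHk.
move=> /Hpos/(_ v vS v0); rewrite ltNge => /negP; apply.
apply: (@le_inv_nat R _ (n.+1%:R + n.+1%:R ^+ 2 * (1 + 2 * `|H|))) => j.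
have [_ _ _ [_ pn pq]] := Hp (kap j).
have := @quad_close R _ (hessian g (p (kap j)).1) H (p (kap j)).2 v.
rewrite pn v1 lexx => /(_ isT isT) /ler_normlP[h1 _].
have h2 : n.+1%:R ^+ 2 * (`|hessian g (p (kap j)).1 - H| + 2 * `|H| * `|(p (kap j)).2 - v|)
   <= n.+1%:R ^+ 2 * (j.+1%:R^-1 + 2 * `|H| * j.+1%:R^-1).
  rewrite ler_wpM2l ?sqr_ge0 // lerD // ler_wpM2l ?mulr_ge0 // ltW //; exact: Hv.
have h3 : n.+1%:R * (kap j).+1%:R^-1 <= n.+1%:R * j.+1%:R^-1 :> R.
  by rewrite ler_wpM2l // inv_nat_le.
move: h1 h2 h3 pq; move: (j.+1%:R^-1) ((kap j).+1%:R^-1) => e k'; lra.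
Qed.

End Subspace.

(** * Optimality conditions *)

Section Final.
Context {R : realType}.

(** Write [|t| = |t|^(1 - q) * |t|^q]: the first factor is small near [0]. The bound [tau <= 1]
    serves later to dominate squares by absolute values. *)
Lemma linear_le_absq (q lambda D : R) : 0 <= q -> q < 1 -> 0 < lambda -> 0 < D ->
  exists2 tau : R, 0 < tau <= 1 & forall t, `|t| <= tau -> D * `|t| <= lambda * absq q t.
Proof.
move=> q0 q1 l0 D0; have e0 : 0 < 1 - q by rewrite subr_gt0.
have b0 : 0 < lambda / D by rewrite divr_gt0.
pose tau := Num.min 1 ((lambda / D) `^ (1 - q)^-1).
have tau0 : 0 < tau by rewrite lt_min ltr01 powR_gt0.
exists tau; first by rewrite tau0 /tau ge_min lexx.
move=> t tt; rewrite /absq; case: eqP => [->|/eqP t0].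
  by rewrite normr0 !mulr0.
have tp : 0 < `|t| by rewrite normr_gt0.
have E : `|t| = `|t| `^ (1 - q) * `|t| `^ q.
  by rewrite -powRD ?subrK ?powRr1 // (negbTE (lt0r_neq0 tp)) implybT.
rewrite {1}E mulrA ler_pM2r ?powR_gt0 // mulrC -ler_pdivlMr //.
have -> : lambda / D = ((lambda / D) `^ (1 - q)^-1) `^ (1 - q).
  by rewrite -powRrM mulVf ?lt0r_neq0 // powRr1 // ltW.
apply: ge0_ler_powR; rewrite ?nnegrE ?powR_ge0 ?(ltW e0) //.
by rewrite (le_trans tt) // /tau ge_min lexx orbT.
Qed.

Context {n : nat}.
Local Notation V := 'rV[R]_n.+1.

Lemma enorm_sqr (x : V) : enorm x ^+ 2 = dotv x x.
Proof. by rewrite /enorm sqr_sqrtr // dotv_ge0. Qed.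

Lemma dotv_subZ_sqr (x y : V) (t : R) :
  dotv (x - t *: y) (x - t *: y) = dotv x x - 2 * t * dotv x y + t ^+ 2 * dotv y y.
Proof.
rewrite /dotv !mulr_sumr -sumrB -big_split; apply: eq_bigr => i _.
by rewrite /= !mxE; ring.
Qed.

Context (f : V -> R) (lambda q : R) (xs : V).
Local Notation S := (supp xs).
Local Notation g := (objE f lambda q S).

(** On [R^S] the power term is [g - f]. Testing the proximal inequality on [xs + t *: e] makes [phi]
    minimal at [0]; the first-order terms in [f] cancel and leave [alpha] times a partial derivative
    of [g]. *)
Lemma stationary_grad0 (alpha : R) i : differentiable f xs -> differentiable g xs ->
  0 < alpha -> P_stationary f lambda q alpha xs -> i \in S -> grad g xs 0 i = 0.
Proof.
move=> df dgx a0 Hst iS; pose e : V := delta_mx 0 i.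
have eS (t : R) j : j \notin S -> (xs + t *: e) 0 j = 0.
  move=> jS; rewrite !mxE supp_off // add0r andTb.
  by case: (eqVneq j i) => [ji|_]; [rewrite ji iS in jS|rewrite mulr0].
have xsS j : j \notin S -> xs 0 j = 0 by exact: supp_off.
pose d : R := grad f xs 0 i.
pose phi (t : R) := alpha * d * t + 2^-1 * t ^+ 2 +
  alpha * (g (xs + t *: e) - f (xs + t *: e)).
have lq (x : V) : (forall j, j \notin S -> x 0 j = 0) -> lambda * lqq q x = g x - f x.
  by move=> xS; rewrite -(objF_supported f lambda q xS) /objF addrAC subrr add0r.
have Hphi t : `|t| < 1 -> phi 0 <= phi t.
  move=> _; have := Hst (xs + t *: e); rewrite !enorm_sqr.
  rewrite -!mulrA (lq _ xsS) (lq _ (eS t)).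
  set z := xs - alpha *: grad f xs.
  have -> : z - xs = - alpha *: grad f xs by rewrite /z addrAC subrr add0r scaleNr.
  have -> : z - (xs + t *: e) = - alpha *: grad f xs - t *: e.
    by rewrite /z opprD addrA [xs - _ - xs]addrAC subrr add0r scaleNr.
  have -> : dotv (- alpha *: grad f xs - t *: e) (- alpha *: grad f xs - t *: e) =
      dotv (- alpha *: grad f xs) (- alpha *: grad f xs) + 2 * (alpha * d * t) + t ^+ 2.
    rewrite dotv_subZ_sqr [dotv (_ *: _) e]dotvZl !dotv_delta [e 0 i]mxE !eqxx -/d.
    by rewrite /=; ring.
  rewrite /phi scale0r addr0 mulr0 expr0n /= mulr0; lra.
have D : is_derive (0 : R) (1 : R) phi (alpha * grad g xs 0 i).
  have Hg := @is_derive_line R n g xs e 0; have Hf := @is_derive_line R n f xs e 0.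
  rewrite scale0r addr0 in Hg Hf; have {}Hg := Hg dgx; have {}Hf := Hf df.
  have Hgf := is_deriveZ alpha (is_deriveB Hg Hf).
  have Hq : is_derive (0 : R) (1 : R) (fun t : R => alpha * d * t + 2^-1 * t ^+ 2) (alpha * d).
    apply: is_derive_eps => eps eps0; exists eps => // s se.
    rewrite (_ : s *: (1 : R) = s); last exact: mulr1.
    rewrite add0r (_ : _ - _ = 2^-1 * s * s); last by rewrite /GRing.scale /=; ring.
    rewrite normrM ler_wpM2r // normrM ger0_norm ?invr_ge0 //.
    by have := normr_ge0 s; lra.
  have := is_deriveD Hq Hgf; rewrite !dotv_delta -/d /GRing.scale /=.
  by rewrite (_ : alpha * d + _ = alpha * grad g xs 0 i); last by ring.
have /eqP := local_min_derive0 ltr01 Hphi D.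
by rewrite mulf_eq0 gt_eqF //= => /eqP.
Qed.

Lemma local_min_part : LC1 f xs -> local_minimizer (objF f lambda q) xs ->
  exists M : 'M[R]_#|S|, generalized_hessian_supp f lambda q xs M /\
    forall v : 'rV[R]_#|S|, 0 <= quad M v.
Proof.
move=> /(objE_C11 lambda q)[rho [L [rho0 L0 dg gL]]] /nbhs_ballP[r1 /= r10 Hr1].
pose r := Num.min rho r1.
have r0 : 0 < r by rewrite lt_min rho0.
have rr x : ball xs r x -> ball xs rho x by apply: le_ball; rewrite /r ge_min lexx.
have rr1 x : ball xs r x -> ball xs r1 x by apply: le_ball; rewrite /r ge_min lexx orbT.
have [|H [HH Hq]] := @slice_min_hessian R n g xs r L r0 L0 (fun x xb => dg x (rr x xb))
    (fun x y xb yb => gL x y (rr x xb) (rr y yb)) S.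
  move=> x xb xS; have := Hr1 x (rr1 x xb).
  rewrite (@objF_supported R n f lambda q S); last by move=> i; exact: supp_off.
  by rewrite (@objF_supported R n f lambda q S) // => i iS; rewrite xS // supp_off.
exists (submat S H); split; first by exists H.
move=> v; rewrite quad_submat; apply: Hq => i; exact: extvec_off.
Qed.

(** Split [x] into [xs + w] with [w] in [R^S] and a remainder of size [T]. Leaving [R^S] changes [g]
    by at most [C * T], while the power term gains at least [(C + 1) * T]; the surplus [T] dominates
    the squares off [S]. *)
Lemma growth_part (alpha : R) : 0 <= q -> q < 1 -> 0 < lambda -> LC1 f xs -> 0 < alpha ->
  P_stationary f lambda q alpha xs ->
  (forall M : 'M[R]_#|S|, generalized_hessian_supp f lambda q xs M ->
     forall v : 'rV[R]_#|S|, v != 0 -> 0 < quad M v) ->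
  exists eta : R, 0 < eta /\ \forall x \near xs,
    objF f lambda q xs + eta * enorm (x - xs) ^+ 2 <= objF f lambda q x.
Proof.
move=> q0 q1 l0 fLC a0 Hst Hpos.
have [rf [Lf [rf0 _ df _]]] := LC1_ball fLC.
have [rho [L [rho0 L0 dg gL]]] := objE_C11 lambda q fLC.
have gS i : i \in S -> grad g xs 0 i = 0.
  apply: (@stationary_grad0 alpha) => //; first by apply: df; exact: ballxx.
  by apply: dg; exact: ballxx.
have [|c [r [c0 /andP[r0 rrho] Hc]]] := @uniform_positivity R n g xs rho L rho0 L0 gL S.
  move=> H HH w wS w0; rewrite -(extvec_subvec wS) -quad_submat; apply: Hpos; first by exists H.
  apply: contra_neq w0 => w0; rewrite -(extvec_subvec wS) w0.
  by apply/rowP => i; rewrite !mxE big1 // => k _; rewrite mxE mul0r.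
have rr x : ball xs r x -> ball xs rho x by exact: le_ball.
have [C C0 HC] := C11_lipschitz rho0 L0 dg gL.
have [|tau /andP[tau0 tau1] Htau] := @linear_le_absq q lambda (C + 1) q0 q1 l0.
  by rewrite addr_gt0.
have grow (w : V) : `|w| < r / 4 -> (forall i, i \notin S -> w 0 i = 0) ->
    g xs + c / 4 * dotv w w <= g (xs + w).
  (* [quadratic_growth] asks for a strict inequality, so half of [c] is given away; integrating the
     slope halves it again. *)
  move=> wr wS; have c20 : 0 < c / 2 by rewrite divr_gt0.
  have := @quadratic_growth R n g xs r L r0 L0 (fun x xb => dg x (rr x xb))
    (fun x y xb yb => gL x y (rr x xb) (rr y yb)) (c / 2) w (ltW c20) wr.
  have -> : dotv (grad g xs) w = 0.
    rewrite /dotv big1 // => i _; have [iS|iS] := boolP (i \in S).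
      by rewrite gS // mul0r.
    by rewrite wS // mulr0.
  rewrite addr0 (_ : c / 2 / 2 = c / 4); last by field.
  apply=> x t xb tx t0 w0.
  have twS i : i \notin S -> (t *: w) 0 i = 0 by move=> iS; rewrite mxE wS // mulr0.
  apply: lt_le_trans (Hc x (t *: w) xb tx twS).
  rewrite ltr_pM2r; last by apply: dotv_gt0; rewrite scaler_eq0 negb_or t0.
  lra.
pose eta := Num.min (c / 4) 1.
have eta0 : 0 < eta by rewrite lt_min divr_gt0 //=.
have etac : eta <= c / 4 by rewrite /eta ge_min lexx.
have eta1 : eta <= 1 by rewrite /eta ge_min lexx orbT.
exists eta; split => //.
pose d := Num.min (r / 4) tau.
have d0 : 0 < d by rewrite lt_min divr_gt0.
apply/nbhs_ballP; exists d => //= x; rewrite -ball_normE /= distrC => xd.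
have xr : `|x - xs| < r / 4 by apply: (lt_le_trans xd); rewrite /d ge_min lexx.
have xtau : `|x - xs| < tau by apply: (lt_le_trans xd); rewrite /d ge_min lexx orbT.
pose w : V := \row_i (if i \in S then x 0 i - xs 0 i else 0).
have wS i : i \notin S -> w 0 i = 0 by move=> /negbTE iS; rewrite mxE iS.
have wle : `|w| <= `|x - xs|.
  rewrite ler_norm_rV //; apply/forallP => i; rewrite mxE; case: ifP => _.
    by have := coord_le_norm (x - xs) i; rewrite row_subE.
  by rewrite normr0.
have h1 := grow w (le_lt_trans wle xr) wS.
pose T := \sum_(i | i \notin S) `|x 0 i|.
have T0 : 0 <= T by apply: sumr_ge0.
have xwT : `|x - (xs + w)| <= T.
  rewrite ler_norm_rV //; apply/forallP => i; rewrite row_subE [(xs + w) 0 i]mxE [w 0 i]mxE.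
  case: ifPn => iS; first by rewrite [xs 0 i + _]addrC subrK subrr normr0.
  by rewrite addr0 (supp_off iS) subr0 /T (bigD1 i) //= lerDl sumr_ge0.
have xb : ball xs rho x.
  by rewrite -ball_normE /= distrC; clear -f lambda q xr r0 rrho; lra.
have wb : ball xs rho (xs + w).
  by rewrite -ball_normE /= opprD addrA subrr sub0r normrN; clear -f lambda q wle xr r0 rrho; lra.
have h2 := HC x (xs + w) xb wb.
have h3 : C * `|x - (xs + w)| <= C * T by rewrite ler_pM2l.
have xi i : i \notin S -> `|x 0 i| <= tau.
  move=> iS; have := coord_le_norm (x - xs) i; rewrite row_subE (supp_off iS) subr0.
  by move=> /le_trans; apply; exact: ltW.
have h4 : (C + 1) * T <= lambda * \sum_(i | i \notin S) absq q (x 0 i).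
  by rewrite /T !mulr_sumr; apply: ler_sum => i iS; apply: Htau; exact: xi.
have h5 : enorm (x - xs) ^+ 2 <= dotv w w + T.
  rewrite enorm_sqr /dotv (bigID (fun i => i \in S)) /= lerD //.
    rewrite [leRHS](bigID (fun i => i \in S)) /= ler_wpDr //.
      by apply: sumr_ge0 => i _; rewrite -expr2 sqr_ge0.
    by apply: ler_sum => i iS; rewrite row_subE [w 0 i]mxE iS.
  apply: ler_sum => i iS; rewrite row_subE (supp_off iS) subr0 -expr2 -real_normK ?num_real //.
  by rewrite expr2 ler_piMr // (le_trans (xi i iS)).
have h6 : eta * enorm (x - xs) ^+ 2 <= eta * (dotv w w + T) by rewrite ler_pM2l.
have h7 : eta * dotv w w <= c / 4 * dotv w w by rewrite ler_wpM2r // dotv_ge0.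
have h8 : eta * T <= T by rewrite ler_piMl.
rewrite (@objF_supported R n f lambda q S); last by move=> i; exact: supp_off.
rewrite (objF_objE _ _ _ S).
move: h2 => /ler_normlP[h2 _].
by clear -f lambda q h1 h2 h3 h4 h6 h7 h8; lra.
Qed.

End Final.

Theorem theorem3p2 (R : realType) (n : nat) (f : 'rV[R]_n -> R)
    (lambda q : R) (xs : 'rV[R]_n)
    (f_C1 : continuously_differentiable f)
    (f_bounded_below : has_lbound (range f))
    (lambda_gt0 : 0 < lambda)
    (q_ge0 : 0 <= q) (q_lt1 : q < 1)
    (grad0_neq0 : grad f 0 != 0)
    (f_LC1 : LC1 f xs) :
  (local_minimizer (objF f lambda q) xs ->
   exists M : 'M[R]_#|supp xs|,
     generalized_hessian_supp f lambda q xs M /\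
     forall v : 'rV[R]_#|supp xs|, 0 <= quad M v)
  /\
  (forall alpha : R, 0 < alpha ->
     lambda < alpha `^ (1 - q) / 2 * `|grad f 0| `^ (2 - q) ->
     P_stationary f lambda q alpha xs ->
     (forall M : 'M[R]_#|supp xs|, generalized_hessian_supp f lambda q xs M ->
      forall v : 'rV[R]_#|supp xs|, v != 0 -> 0 < quad M v) ->
     exists eta : R, 0 < eta /\
       \forall x \near xs,
         objF f lambda q xs + eta * enorm (x - xs) ^+ 2 <= objF f lambda q x).
Proof.
case: n => [|n] in f xs f_C1 f_bounded_below grad0_neq0 f_LC1 *.
  (* In dimension [0] the gradient has no entries, against [grad0_neq0]. *)
  by rewrite [grad f 0]thinmx0 eqxx in grad0_neq0.
split; first exact: local_min_part.
move=> alpha alpha_gt0 _; exact: growth_part.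
Qed.
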